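(* Let $\mu^1=\mu^1_t(dx)\,dt$ and $\mu^2=\mu^2_t(dx)\,dt$ be two solutions to the Cauchy problem $$\partial_t\mu+\mathrm{div}(b\mu)=0,\qquad \mu|_{t=0}=\nu$$ on $\mathbb{R}^d\times[0,T]$ (with the same $b$ and the same locally bounded Borel measure $\nu$ on $\mathbb{R}^d$). Put $\mu_t=\mu_t^1-\mu_t^2$ and $\mu=\mu_t(dx)\,dt$. Assume that there is a number $C_1\ge 0$ such that for every ball $U\subset\mathbb{R}^d$ one can find a number $C_2\ge 0$, a sequence of vector fields $b_k\in C^{\infty}(\mathbb{R}^d\times\mathbb{R}^1,\mathbb{R}^d)$ and a sequence of positive functions $V_k\in C^1(\mathbb{R}^d)$ (all depending on the measure $\mu$, the constant $C_1$ and the ball $U$) such that (i) $|b_k(x,t)|\le C_1+C_1|x|$ for all $k$ and all $(x,t)\in\mathbb{R}^d\times[0,T]$; (ii) $\inf_k\inf_{x\in U}V_k(x)>0$ and $$\langle b_k(x,t),\nabla V_k(x)\rangle\le\Bigl(C_2-2\max_{|\xi|=1}\langle\mathcal{B}_k(x,t)\xi,\xi\rangle\Bigr)V_k(x)$$ for every $k$ and every $(x,t)\in U\times[0,T]$, where $\mathcal{B}_k=(\partial_{x_i}b_k^j)_{i,j\le d}$; (iii) $\displaystyle\lim_{k\to\infty}\int_0^T\int_U|b_k(x,t)-b(x,t)|\sqrt{V_k(x)}\,|\mu_t|(dx)\,dt=0$. Then $\mu=0$, i.e., $\mu^1=\mu^2$.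
   Context: $T>0$ is fixed and $b\colon\mathbb{R}^d\times[0,T]\to\mathbb{R}^d$ is a Borel vector field. A locally bounded Borel measure on $\mathbb{R}^d$ is a real-valued (possibly signed) function on the class of all bounded Borel sets that is countably additive on the Borel subsets of every compact set; locally bounded Borel measures on $\mathbb{R}^d\times[0,T]$ are defined similarly. $|\mu|$ denotes the total variation of $\mu$. A locally bounded Borel measure $\mu$ on $\mathbb{R}^d\times[0,T]$ is given by a family of locally bounded Borel measures $(\mu_t)_{t\in[0,T]}$ on $\mathbb{R}^d$ (written $\mu=\mu_t(dx)\,dt$) if for every bounded Borel set $B\subset\mathbb{R}^d$ the mapping $t\mapsto\mu_t(B)$ is measurable, $t\mapsto|\mu_t|(K)$ belongs to $L^1[0,T]$ for every compact $K\subset\mathbb{R}^d$, and $$\int_0^T\int_{\mathbb{R}^d}u(x,t)\,\mu(dx\,dt)=\int_0^T\int_{\mathbb{R}^d}u(x,t)\,\mu_t(dx)\,dt\quad\text{for all }u\in C_0^\infty(\mathbb{R}^d\times(0,T)).$$ A solution to the Cauchy problem $\partial_t\mu+\mathrm{div}(b\mu)=0$, $\mu|_{t=0}=\nu$, is a locally bounded Borel measure $\mu$ on $\mathbb{R}^d\times[0,T]$ given by a family $(\mu_t)_{t\in[0,T]}$ of locally bounded Borel measures such that $b\in L^1(|\mu|,U\times[0,T])$ for every ball $U\subset\mathbb{R}^d$ and, for every function $u$ that is continuous on $\mathbb{R}^d\times[0,T)$ along with its first order derivatives in $t$ and $x$ and satisfies $u(x,t)=0$ whenever $|x|>R$ for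 some $R$, one has $$\int_{\mathbb{R}^d}u(x,t)\,\mu_t(dx)=\int_{\mathbb{R}^d}u(x,0)\,\nu(dx)+\int_0^t\int_{\mathbb{R}^d}\bigl[\partial_tu+\langle b,\nabla u\rangle\bigr]\,\mu_s(dx)\,ds$$ for almost every $t\in[0,T]$. Two measures given by families $(\mu^1_t)$, $(\mu^2_t)$ are equal iff $\mu^1_t=\mu^2_t$ for almost every $t\in[0,T]$. *)

(* Defs.v *)
From HB Require Import structures.
From mathcomp Require Import all_boot all_order all_algebra.
From mathcomp Require Import all_classical all_reals all_analysis.
Set Implicit Arguments.
Unset Strict Implicit.
Unset Printing Implicit Defensive.
Import Order.TTheory GRing.Theory Num.Theory.
Import numFieldNormedType.Exports.
Local Open Scope classical_set_scope.
Local Open Scope ring_scope.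

Section Borel.
Context {R : realType} (X : normedModType R).

Definition borel := g_sigma_algebraType (@open X).

Definition borel_set (A : set X) : Prop := measurable (A : set borel).

(* "Bounded" is expressed as "contained in a compact set"; on R^d and on
   R^d x R these coincide, see [bounded_rV] and [bounded_rV_prod]. *)
Definition bounded_borel (A : set X) : Prop :=
  borel_set A /\ exists2 K : set X, compact K & A `<=` K.

End Borel.

Lemma bounded_rV (R : realType) (d : nat) (A : set 'rV[R]_d) :
  bounded_set A <-> exists2 K : set 'rV[R]_d, compact K & A `<=` K.
Proof.
split=> [[M [Mr HM]]|[K cK AK]]; last first.
  have [M [Mr HM]] := compact_bounded cK.
  by exists M; split => // x /HM Kx y /AK /Kx.
exists [set x | `|x| <= M + 1]; last first.
  by move=> x Ax /=; apply: HM Ax; rewrite ltrDl.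
apply: bounded_closed_compact.
  by exists (M + 1); split; [rewrite realD|move=> x /ltW Mx y /= /le_trans; apply].
rewrite (_ : [set x | _] = (fun x : 'rV[R]_d => `|x|) @^-1` [set r | r <= M + 1])//.
by apply: closed_comp => [x _|]; [exact: norm_continuous|exact: closed_le].
Qed.

Lemma bounded_rV_prod (R : realType) (d : nat) (A : set ('rV[R]_d * R)) :
  bounded_set A <-> exists2 K : set ('rV[R]_d * R), compact K & A `<=` K.
Proof.
split=> [[M [Mr HM]]|[K cK AK]]; last first.
  have [M [Mr HM]] := compact_bounded cK.
  by exists M; split => // x /HM Kx y /AK /Kx.
have [K cK HK] : exists2 K : set 'rV[R]_d, compact K &
    [set x | `|x| <= M + 1] `<=` K.
  apply/bounded_rV; exists (M + 1).
  by split; [rewrite realD|move=> x /ltW Mx y /= /le_trans; apply].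
exists (K `*` `[- (M + 1), M + 1]).
  by apply: compact_setX => //; exact: segment_compact.
move=> [x t] Axt; have : `|(x, t)| <= M + 1 by apply: HM Axt; rewrite ltrDl.
rewrite prod_normE/= ge_max => /andP[xM tM]; split => /=; first exact: HK.
by rewrite in_itv/= -ler_norml.
Qed.

(* A locally bounded (signed) Borel measure: only the values on bounded Borel
   sets are meaningful, the values on other sets are unconstrained. *)
Record lbmeasure (R : realType) (X : normedModType R) := LBMeasure {
  lbm :> set X -> R ;
  lbm_sigma_additive : forall (K : set X) (F : (set X)^nat), compact K ->
    (forall i, borel_set (F i)) -> (forall i, F i `<=` K) -> trivIset setT F ->
    series (fun i => lbm (F i)) @ \oo --> lbm (\bigcup_i F i) }.

Section LBMeasureOperations.
Context {R : realType} {X : normedModType R}.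
Implicit Types mu nu : lbmeasure X.

Fact lbm_opp_sigma_additive mu (K : set X) (F : (set X)^nat) : compact K ->
    (forall i, borel_set (F i)) -> (forall i, F i `<=` K) -> trivIset setT F ->
  series (fun i => - mu (F i)) @ \oo --> - mu (\bigcup_i F i).
Proof.
move=> cK mF FK tF.
rewrite (_ : series _ = - series (fun i => mu (F i))).
  exact: cvgN (lbm_sigma_additive cK mF FK tF).
by apply/funext => n; rewrite /series/= sumrN.
Qed.

Definition lbm_opp mu : lbmeasure X :=
  @LBMeasure R X (fun A => - mu A) (lbm_opp_sigma_additive (mu := mu)).

Fact lbm_sub_sigma_additive mu nu (K : set X) (F : (set X)^nat) : compact K ->
    (forall i, borel_set (F i)) -> (forall i, F i `<=` K) -> trivIset setT F ->
  series (fun i => mu (F i) - nu (F i)) @ \oo -->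
  mu (\bigcup_i F i) - nu (\bigcup_i F i).
Proof.
move=> cK mF FK tF.
rewrite (_ : series _ = series (fun i => mu (F i)) - series (fun i => nu (F i))).
  exact: cvgB (lbm_sigma_additive cK mF FK tF) (lbm_sigma_additive cK mF FK tF).
by apply/funext => n; rewrite /series/= sumrB.
Qed.

Definition lbm_sub mu nu : lbmeasure X :=
  @LBMeasure R X (fun A => mu A - nu A)
    (lbm_sub_sigma_additive (mu := mu) (nu := nu)).

End LBMeasureOperations.

Section TotalVariation.
Context {R : realType} {X : normedModType R}.
Implicit Types mu : lbmeasure X.
Local Open Scope ereal_scope.

(* The positive part mu^+ of the Jordan decomposition, as an upper variation;
   below, mu^- = (- mu)^+ and |mu| = mu^+ + mu^-. *)
Definition lbm_pos mu (A : set (borel X)) : \bar R :=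
  ereal_sup [set (mu B)%:E | B in [set B | bounded_borel B /\ B `<=` A]].

Lemma lbm_set0 mu : mu set0 = 0%R.
Proof.
have /cvgP/cvg_series_cvg_0 : series (fun=> mu set0) @ \oo --> mu set0.
  have := @lbm_sigma_additive _ _ mu set0 (fun=> set0) compact0.
  rewrite bigcup0//; apply => //; first by move=> _; exact: measurable0.
  - by move=> _.
  - by move=> i j _ _ [x [[]]].
by move=> /(cvg_unique _ (cvg_cst _)); apply.
Qed.

Lemma bounded_borel0 : bounded_borel (set0 : set X).
Proof. by split; [exact: measurable0|exists set0 => //; exact: compact0]. Qed.

Lemma bounded_borelU (A B : set X) :
  bounded_borel A -> bounded_borel B -> bounded_borel (A `|` B).
Proof.
move=> [mA [K cK AK]] [mB [L cL BL]]; split; first exact: measurableU.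
by exists (K `|` L); [exact: compactU|exact: setUSS].
Qed.

Lemma lbm_setU mu (A B : set X) : bounded_borel A -> bounded_borel B ->
  A `&` B = set0 -> mu (A `|` B) = (mu A + mu B)%R.
Proof.
move=> bA bB AB; have [_ [K cK ABK]] := bounded_borelU bA bB.
have := @lbm_sigma_additive _ _ mu K (bigcup2 A B) cK.
rewrite bigcup2E => cv.
have {}cv : series (fun i => mu (bigcup2 A B i)) @ \oo --> mu (A `|` B).
  apply: cv.
  - move=> [|[|i]]; rewrite /bigcup2/=; [exact: bA.1|exact: bB.1|].
    exact: measurable0.
  - move=> [|[|i]]; rewrite /bigcup2/= => x ?; apply: ABK => //; by [left|right].
  - have nAB x : A x -> B x -> False.
      by move=> Ax Bx; have : (A `&` B) x by []; rewrite AB.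
    by move=> [|[|i]] [|[|j]] _ _ //= [x []]// => [Ax /(nAB _ Ax)|Bx /nAB /(_ Bx)].
apply: (cvg_unique _ cv) => //.
apply/cvg_ballP => e e0; exists 2%N => // n /= n2.
rewrite (_ : series _ n = mu A + mu B)%R; first exact: ballxx.
rewrite /series/= (big_cat_nat _ n2)//= big_nat_recl// big_nat1/=.
rewrite [X in (_ + X)%R]big1_seq ?addr0//= => i.
by rewrite mem_index_iota; case: i => [|[|i]]//= _; rewrite lbm_set0.
Qed.

Lemma lbm_pos_ge0 mu A : 0 <= lbm_pos mu A.
Proof.
apply: ereal_sup_ubound; exists set0; last by rewrite lbm_set0.
by split; [exact: bounded_borel0|].
Qed.

Lemma lbm_pos0 mu : lbm_pos mu set0 = 0.
Proof.
apply/eqP; rewrite eq_le lbm_pos_ge0 andbT; apply: ge_ereal_sup.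
by move=> _ [B [_ +] <-]; rewrite subset0 => ->; rewrite lbm_set0.
Qed.

Lemma lbm_pos_superadditive mu A B : A `&` B = set0 ->
  lbm_pos mu A + lbm_pos mu B <= lbm_pos mu (A `|` B).
Proof.
move=> AB; have := lbm_pos_ge0 mu (A `|` B).
have key C D : bounded_borel C -> C `<=` A -> bounded_borel D -> D `<=` B ->
    (mu C)%:E + (mu D)%:E <= lbm_pos mu (A `|` B).
  move=> bC CA bD DB; apply: ereal_sup_ubound; exists (C `|` D).
    by split; [exact: bounded_borelU|exact: setUSS].
  rewrite lbm_setU ?EFinD// -subset0 -AB => x [/CA Ax /DB Bx].
  by split.
case: (lbm_pos mu (A `|` B)) key => // [c|]; last by rewrite !leey.
move=> key _.
have keyA C : bounded_borel C -> C `<=` A -> lbm_pos mu B <= (c - mu C)%:E.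
  move=> bC CA; apply: ge_ereal_sup => _ [D [bD DB] <-].
  by have := key _ _ bC CA bD DB; rewrite -EFinD !lee_fin lerBrDl.
have fB : lbm_pos mu B \is a fin_num.
  rewrite ge0_fin_numE ?lbm_pos_ge0//.
  exact: le_lt_trans (keyA _ bounded_borel0 (@sub0set _ _)) (ltry _).
rewrite -leeBrDr//; apply: ge_ereal_sup => _ [C [bC CA] <-].
by rewrite leeBrDr// -leeBrDl// -EFinB; exact: keyA.
Qed.

Lemma lbm_pos_semi_sigma_additive mu : semi_sigma_additive (lbm_pos mu).
Proof.
move=> F mF tF mUF.
have cvgF : (fun n => \sum_(0 <= i < n) lbm_pos mu (F i)) @ \oo -->
    \sum_(i <oo) lbm_pos mu (F i).
  by apply: is_cvg_nneseries => i _ _; exact: lbm_pos_ge0.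
suff -> : lbm_pos mu (\bigcup_n F n) = \sum_(i <oo) lbm_pos mu (F i) by [].
apply/eqP; rewrite eq_le; apply/andP; split.
  apply: ge_ereal_sup => _ [B [[mB [K cK BK]] BF] <-].
  have : series (fun i => mu (B `&` F i)) @ \oo --> mu B.
    rewrite -{2}(setIidl BF) setI_bigcupr; apply: (lbm_sigma_additive cK).
    - by move=> i; exact: measurableI.
    - by move=> i x [/BK].
    - exact: trivIset_setIl.
  have leS n : (series (fun i => mu (B `&` F i)) n)%:E <=
      \sum_(i <oo) lbm_pos mu (F i).
    rewrite /series/= -sumEFin; apply: le_trans (nneseries_lim_ge _ _); last first.
      by move=> *; exact: lbm_pos_ge0.
    apply: lee_sum => i _; apply: ereal_sup_ubound; exists (B `&` F i) => //.
    split; last exact: subIsetr.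
    by split; [exact: measurableI|exists K => // x [/BK]].
  have : 0 <= \sum_(i <oo) lbm_pos mu (F i).
    by apply: nneseries_ge0 => *; exact: lbm_pos_ge0.
  case: (\sum_(i <oo) lbm_pos mu (F i)) leS => // [c|]; last by rewrite !leey.
  move=> leS _ cB; rewrite lee_fin -(cvg_lim _ cB)//.
  by apply: limr_le; [apply/cvg_ex; exists (mu B)|exact: nearW].
apply: lime_le; first by apply/cvg_ex; eexists; exact: cvgF.
apply: nearW => n.
have : \sum_(0 <= i < n) lbm_pos mu (F i) <= lbm_pos mu (\big[setU/set0]_(i < n) F i).
  elim: n => [|n IH]; first by rewrite big_geq ?lbm_pos_ge0.
  rewrite big_nat_recr//= big_ord_recr/=.
  apply: le_trans (lbm_pos_superadditive _ _); first exact: leeD2r.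
  rewrite setIC -subset0 => x [Fnx].
  rewrite -bigcup_mkord => -[i /= ltin Fix].
  by move: (ltin); rewrite (tF i n I I _) ?ltnn//; exists x.
move=> /le_trans; apply; apply: le_ereal_sup => _ [B [bB BF] <-]; exists B => //.
split => //; apply: subset_trans BF _; exact: bigsetU_bigcup.
Qed.

HB.instance Definition _ mu := isMeasure.Build _ _ _ (lbm_pos mu)
  (lbm_pos0 mu) (lbm_pos_ge0 mu) (@lbm_pos_semi_sigma_additive mu).

Definition lbm_neg mu : set (borel X) -> \bar R := lbm_pos (lbm_opp mu).

HB.instance Definition _ mu := Measure.on (lbm_neg mu).

Definition lbm_tv mu : set (borel X) -> \bar R :=
  measure_add (lbm_pos mu) (lbm_neg mu).

HB.instance Definition _ mu := Measure.on (lbm_tv mu).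

(* Meaningful when f is |mu|-integrable on D. *)
Definition lbm_integral mu (D : set X) (f : X -> R) : R :=
  (\int[lbm_pos mu]_(x in D) f x - \int[lbm_neg mu]_(x in D) f x)%R.

End TotalVariation.

(* R with the sigma-algebra of Lebesgue measurable sets: measurability in time
   and "almost every t" refer to the completed Lebesgue measure. *)
Notation lebesgueType R := (caratheodory_type (@wlength R idfun)^*%mu).
Notation leb := (@completed_lebesgue_measure _).

Section Calculus.
Context {R : realType}.

Definition dotp (d : nat) (x y : 'rV[R]_d) : R := \sum_(i < d) x 0 i * y 0 i.

(* The library norm on 'rV[R]_d is the sup norm. *)
Definition enorm (d : nat) (x : 'rV[R]_d) : R := Num.sqrt (dotp x x).

Definition eball (d : nat) (c : 'rV[R]_d) (r : R) : set 'rV[R]_d :=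
  [set x | enorm (x - c) < r].

Fixpoint Ck (n : nat) (V W : normedModType R) (f : V -> W) : Prop :=
  if n is m.+1 then
    (forall x, differentiable f x) /\ (forall v, Ck m (fun x => 'D_v f x))
  else continuous f.

Definition smooth (V W : normedModType R) (f : V -> W) : Prop :=
  forall n, Ck n f.

Definition grad (d : nat) (f : 'rV[R]_d -> R) (x : 'rV[R]_d) : 'rV[R]_d :=
  \row_i 'D_(delta_mx 0 i) f x.

(* max of <B xi, xi> over the Euclidean unit sphere; it is attained if 0 < d. *)
Definition max_quad (d : nat) (B : 'M[R]_d) : R :=
  sup [set dotp (xi *m B^T) xi | xi in [set xi : 'rV[R]_d | enorm xi = 1]].

End Calculus.

Section Cauchy.
Context {R : realType} {d : nat}.
Implicit Types (T : R) (b : 'rV[R]_d * R -> 'rV[R]_d).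
Local Notation E := 'rV[R]_d.

(* Derivative in time within [0, T), hence one-sided at time 0. *)
Definition dt_quot (u : E * R -> R) (z : E * R) : R -> R :=
  fun h => h^-1 * (u (z.1, z.2 + h) - u z).

Definition dt_filter T (z : E * R) : set_system R :=
  within [set h | 0 <= z.2 + h < T] 0^'.

Definition dt T (u : E * R -> R) (z : E * R) : R :=
  lim (dt_quot u z @ dt_filter T z).

Definition gradx (u : E * R -> R) (z : E * R) : E :=
  grad (fun y => u (y, z.2)) z.1.

(* The test functions of the Cauchy problem: C^1 on R^d x [0, T) and vanishing
   for large |x|, without any condition as t -> T. *)
Definition cauchy_test T (u : E * R -> R) : Prop :=
  let S := [set z : E * R | 0 <= z.2 < T] in
  [/\ {within S, continuous u},
      forall z, S z -> cvg (dt_quot u z @ dt_filter T z),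
      {within S, continuous (dt T u)},
      forall z, S z -> forall i,
        derivable (fun y => u (y, z.2)) z.1 (delta_mx 0 i) &
      {within S, continuous (gradx u)}] /\
  exists r, forall x t, 0 <= t < T -> r < enorm x -> u (x, t) = 0.

(* The elements of C_0^oo(R^d x (0, T)), extended by 0. *)
Definition test_function T (u : E * R -> R) : Prop :=
  let supp := closure [set z | u z != 0] in
  [/\ smooth u, compact supp & supp `<=` setT `*` `]0, T[].

(* A locally bounded Borel measure on R^d x [0, T] is seen as one on R^d x R
   that is carried by R^d x [0, T]. *)
Definition carried_by_strip T (mu : lbmeasure (E * R)%type) : Prop :=
  forall A, bounded_borel A -> A `&` (setT `*` `[0, T]) = set0 -> mu A = 0.

Definition given_by T (mu : lbmeasure (E * R)%type) (mu_ : R -> lbmeasure E) :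
    Prop :=
  [/\ forall B, bounded_borel B ->
        measurable_fun (`[0, T] : set (lebesgueType R)) (fun t => mu_ t B),
      forall K, compact K ->
        leb.-integrable (`[0, T] : set (lebesgueType R))
          (fun t => lbm_tv (mu_ t) K) &
      forall u, test_function T u ->
        lbm_integral mu (setT `*` `[0, T]) u =
        \int[leb]_(t in `[0, T]) lbm_integral (mu_ t) setT (fun x => u (x, t))].

Definition cauchy_solution T b (nu : lbmeasure E) (mu : lbmeasure (E * R)%type)
    (mu_ : R -> lbmeasure E) : Prop :=
  [/\ carried_by_strip T mu,
      given_by T mu mu_,
      forall c r, 0 < r ->
        (lbm_tv mu).-integrable (eball c r `*` `[0, T])
          (fun z => (enorm (b z))%:E) &
      forall u, cauchy_test T u -> {ae leb, forall t, t \in `[0, T] ->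
        lbm_integral (mu_ t) setT (fun x => u (x, t)) =
        lbm_integral nu setT (fun x => u (x, 0)) +
        \int[leb]_(s in `[0, t]) lbm_integral (mu_ s) setT
          (fun x => dt T u (x, s) + dotp (b (x, s)) (gradx u (x, s)))}].

End Cauchy.

(* Main.v *)
(* Duality.  For a smooth compactly supported psi and a time t, one needs a test function u such
   that u(., t) is close to psi, d_t u + <b_k, grad u> is small on [0, t], and
   |grad u| <= C sqrt V_k with C independent of k.  Testing the equation for mu = mu^1 - mu^2
   with u then bounds the integral of psi against mu_t by C times the integral in (iii), up to
   small errors, and psi ranges over a countable family that determines mu_t.

   Instead of the flow of b_k, the function u is obtained from an explicit Euler scheme: psi is
   composed with the maps x + eta_j(t) b_k(x, t_j), where the step sizes eta_j depend on t in a
   C^1 way so that u is C^1 in (x, t).  The linear growth (i) keeps the supports in a fixed ball,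
   and (ii) makes sup |grad u|^2 / V_k grow by a factor 1 + (C2 + 1) h at most in each step of
   length h, for h small depending on k.

   The measures mu^i are linked to the slices mu^i_t only through smooth test functions.  These
   determine mu^i, so that mu^i(A) is the integral of mu^i_t(A_t) dt; choosing in each slice a
   nearly maximizing set among countably many gives |mu^i_t| dt <= |mu^i|, hence the
   integrability of b with respect to |mu^i_t| dt. *)
Require Import Defs.
From HB Require Import structures.
From mathcomp Require Import all_boot all_order all_algebra.
From mathcomp Require Import all_classical all_reals all_analysis.
From mathcomp Require Import measurable_realfun.
From mathcomp Require Import ring lra.
Set Implicit Arguments.
Unset Strict Implicit.
Unset Printing Implicit Defensive.
Import Order.TTheory GRing.Theory Num.Theory.
Import numFieldNormedType.Exports.
Local Open Scope classical_set_scope.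
Local Open Scope ring_scope.
Import HBNNSimple.

(** * Signed measures and their integrals *)

Section LBMeasureTheory.
Context {R : realType} {X : normedModType R}.
Implicit Types (mu nu : lbmeasure X) (A B K : set X).

(** The test function depends on the time [t] at which the equation is read, while each test
    function comes with its own null set of times. The scheme therefore yields, for each [k] and
    each accuracy, one countable family serving every [t]; with a countable family of [psi] this
    leaves a single null set. The order of the choices is forced: [C1] and the support of [psi] fix
    the ball [U], the ball fixes [C2] and the sequences, and only then is the step length [h]
    chosen, depending on [k] and on the accuracy. The final bound is an accuracy term plus a
    multiple of the integral in (iii), so constants depending on [b_k] may enter through [h] but
    never through that multiple. Switching between steps must be C^1 in time, so neighbouring steps
    overlap, which creates commutation errors; the tent profile is chosen so that these still add up
    to [O(h)]. Variations of signed measures are handled as suprema, and as countable suprema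
    whenever measurability in [t] is needed. *)

Lemma bounded_borelS A B :
  borel_set A -> A `<=` B -> bounded_borel B -> bounded_borel A.
Proof.
by move=> mA AB [_ [K cK BK]]; split => //; exists K => // x /AB /BK.
Qed.

Lemma bounded_borelD A B :
  bounded_borel A -> borel_set B -> bounded_borel (A `\` B).
Proof.
move=> bA mB; apply: (bounded_borelS _ _ bA); last exact: subDsetl.
by apply: (@measurableD _ (borel X)) => //; exact: bA.1.
Qed.

Lemma bounded_borelI A B :
  bounded_borel A -> borel_set B -> bounded_borel (A `&` B).
Proof.
move=> bA mB; apply: (bounded_borelS _ _ bA); last exact: subIsetl.
by apply: (@measurableI _ (borel X)) => //; exact: bA.1.
Qed.

Lemma open_borel A : open A -> borel_set A.
Proof. by move=> oA; apply: sub_sigma_algebra. Qed.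

Lemma closed_borel A : closed A -> borel_set A.
Proof.
move=> cA; rewrite /borel_set -(setCK A).
by apply: (@measurableC _ (borel X)); apply: open_borel; exact: closed_openC.
Qed.

Lemma compact_bounded_borel K : compact K -> bounded_borel K.
Proof.
move=> cK; split; last by exists K.
by apply: closed_borel; apply: compact_closed.
Qed.

Lemma lbm_setD mu A B : bounded_borel A -> borel_set B -> B `<=` A ->
  mu (A `\` B) = mu A - mu B.
Proof.
move=> bA mB BA; have bB := bounded_borelS mB BA bA.
rewrite -{2}(setDUK BA) lbm_setU//; first by rewrite addrAC subrr add0r.
  exact: bounded_borelD.
by rewrite setDE setICA setICr setI0.
Qed.

Lemma lbm_tvE mu A : (lbm_tv mu A = lbm_pos mu A + lbm_neg mu A)%E.
Proof. exact: measure_addE. Qed.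

Lemma lbm_pos_ge mu A B : bounded_borel B -> B `<=` A ->
  ((mu B)%:E <= lbm_pos mu A)%E.
Proof. by move=> bB BA; apply: ereal_sup_ubound; exists B. Qed.

(** Some [C] in [A] has [|mu C| >= 1 + |mu A|], so [mu] is at least 1 in absolute value on [C] and
    on its complement in [A]. The variation is additive, so one of the two has infinite variation
    and is taken as [B]. *)
Lemma lbm_tv_infinite_step mu A : bounded_borel A -> lbm_tv mu A = +oo%E ->
  exists B, [/\ borel_set B, B `<=` A, lbm_tv mu B = +oo%E &
                1 <= `|mu (A `\` B)|].
Proof.
move=> bA tvA.
have sup_infty nu : lbm_pos nu A = +oo%E -> exists C,
    [/\ bounded_borel C, C `<=` A & 1 + `|mu A| <= nu C].
  move=> pA; have [_ [C [bC CA] <-] ltC] :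
      exists2 y, [set (nu B)%:E | B in [set B | bounded_borel B /\ B `<=` A]] y
               & ((1 + `|mu A|)%:E < y)%E.
    by apply: ereal_sup_gt; rewrite [X in (_ < X)%E]pA ltry.
  by exists C; split => //; rewrite -lee_fin ltW.
have [C [bC CA leC]] : exists C,
    [/\ bounded_borel C, C `<=` A & 1 + `|mu A| <= `|mu C|].
  have [/sup_infty[C [bC CA le]]|pA] := eqVneq (lbm_pos mu A) +oo%E.
    by exists C; split => //; rewrite (le_trans le)// ler_norm.
  have [/sup_infty[C [bC CA le]]|nA] := eqVneq (lbm_neg mu A) +oo%E.
    by exists C; split => //; rewrite (le_trans le)// -normrN ler_norm.
  move: tvA; rewrite lbm_tvE.
  have : lbm_pos mu A \is a fin_num.
    by rewrite ge0_fin_numE ?lbm_pos_ge0// ltey.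
  have : lbm_neg mu A \is a fin_num.
    by rewrite ge0_fin_numE ?lbm_pos_ge0// ltey.
  by move=> /fineK <- /fineK <-.
have mD : mu (A `\` C) = mu A - mu C by apply: lbm_setD => //; exact: bC.1.
have [tC|tC] := eqVneq (lbm_tv mu C) +oo%E.
  exists C; split => //; first exact: bC.1.
  rewrite mD distrC; apply: le_trans (lerB_dist _ _).
  by rewrite lerBrDr.
exists (A `\` C); split => //.
- by apply: (bounded_borelD bA _).1; exact: bC.1.
- have := tvA; rewrite -{1}(setDUK CA) (measureU (lbm_tv mu))/=.
  + by case: (lbm_tv mu (A `\` C)) => [r| |//]; move: tC; case: (lbm_tv mu C).
  + by case: bC.
  + by case: bC => mC _; case: (bounded_borelD bA mC).
  + by rewrite setDE setICA setICr setI0.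
- by rewrite setDD (setIidr CA) (le_trans _ leC)// lerDl.
Qed.

(** Iterating the previous step gives a decreasing sequence whose successive differences are
    disjoint and have values at least 1 in absolute value; their series cannot converge, against
    countable additivity inside a compact set. *)
Lemma lbm_tv_finite mu A : bounded_borel A -> (lbm_tv mu A < +oo)%E.
Proof.
move=> bA; rewrite ltNge leye_eq; apply/negP => /eqP tvA.
pose T := {B : set X | [/\ borel_set B, B `<=` A & lbm_tv mu B = +oo%E]}.
have step (B : T) : exists C : T, sval C `<=` sval B /\
    1 <= `|mu (sval B `\` sval C)|.
  case: B => [B [mB BA tvB]].
  have [C [mC CB tvC leC]] := lbm_tv_infinite_step (bounded_borelS mB BA bA) tvB.
  by exists (exist _ C (And3 mC (subset_trans CB BA) tvC)).
have [f fP] := choice step.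
pose F n := sval (iter n f (exist _ A (And3 bA.1 (@subset_refl _ A) tvA))).
have FS n : F n.+1 `<=` F n by have [] := fP (iter n f (exist _ A (And3 bA.1 (@subset_refl _ A) tvA))).
have FSn m n : (m <= n)%N -> F n `<=` F m.
  elim: n => [|n IH]; first by rewrite leqn0 => /eqP->.
  by rewrite leq_eqVlt => /predU1P[->//|/IH]; apply: subset_trans; exact: FS.
pose D n := F n `\` F n.+1.
have mF n : borel_set (F n) by rewrite /F; case: (iter _ _ _) => ? [].
have FA n : F n `<=` A by rewrite /F; case: (iter _ _ _) => ? [].
have tD : trivIset setT D.
  have lt_disj i j : (i < j)%N -> D i `&` D j = set0.
    by move=> ij; rewrite -subset0 => x [[Fi nFi] [Fj _]]; apply/nFi/(FSn _ _ ij).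
  apply/trivIsetP => i j _ _; case: ltngtP => // [/lt_disj//|/lt_disj].
  by rewrite setIC.
have mD n : borel_set (D n) by apply: (@measurableD _ (borel X)); exact: mF.
have [_ [K cK AK]] := bA.
have /cvgP/cvg_series_cvg_0 := @lbm_sigma_additive _ _ mu K D cK mD
  (fun n x => fun Dx => AK _ (FA n _ Dx.1)) tD.
move=> /cvgrPdist_lt/(_ 1 ltr01)[n _ /(_ n (leqnn n))].
rewrite sub0r normrN ltNge; case/negP.
by have [] := fP (iter n f (exist _ A (And3 bA.1 (@subset_refl _ A) tvA))).
Qed.

Lemma lbm_pos_finite mu A : bounded_borel A -> lbm_pos mu A \is a fin_num.
Proof.
move=> bA; rewrite ge0_fin_numE ?lbm_pos_ge0//.
by rewrite (le_lt_trans _ (lbm_tv_finite mu bA))// lbm_tvE leeDl// lbm_pos_ge0.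
Qed.

Lemma lbm_neg_finite mu A : bounded_borel A -> lbm_neg mu A \is a fin_num.
Proof. exact: lbm_pos_finite. Qed.

(* [mu^+ A - mu A] is the supremum of [- mu (A - B)] over [B] contained in [A]. *)
Lemma lbm_jordan mu A : bounded_borel A ->
  ((mu A)%:E = lbm_pos mu A - lbm_neg mu A)%E.
Proof.
move=> bA; apply/eqP; rewrite eq_sym eq_le; apply/andP; split.
  rewrite leeBlDr ?lbm_neg_finite//; apply: ge_ereal_sup => _ [B [bB BA] <-].
  have mB := bB.1.
  have := lbm_pos_ge (lbm_opp mu) (bounded_borelD bA mB) (@subDsetl _ A B).
  move=> /(leeD2l (mu A)%:E)/(le_trans _); apply.
  by rewrite -EFinD lee_fin /= lbm_setD// opprB addrCA subrr addr0.
rewrite leeBrDr ?lbm_neg_finite// addeC -leeBrDr//.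
apply: ge_ereal_sup => _ [B [bB BA] <-].
rewrite leeBrDr//; have mB := bB.1.
have := lbm_pos_ge mu (bounded_borelD bA mB) (@subDsetl _ A B).
by rewrite -EFinD /= lbm_setD// addrC.
Qed.

Lemma lbm_jordan_fine mu A : bounded_borel A ->
  mu A = fine (lbm_pos mu A) - fine (lbm_neg mu A).
Proof.
move=> bA; apply: EFin_inj; rewrite lbm_jordan// EFinB !fineK//.
  exact: lbm_neg_finite.
exact: lbm_pos_finite.
Qed.

End LBMeasureTheory.

Lemma le_measure_ge0_integral d (T : measurableType d) (R : realType)
    (m1 m2 : {measure set T -> \bar R}) (D : set T) (f : T -> \bar R) :
  measurable D -> (forall A, measurable A -> A `<=` D -> (m1 A <= m2 A)%E) ->
  (forall x, D x -> 0 <= f x)%E ->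
  (\int[m1]_(x in D) f x <= \int[m2]_(x in D) f x)%E.
Proof.
move=> mD m12 f0.
have f0' x : (0 <= (f \_ D) x)%E.
  by rewrite patchE; case: ifPn => // /set_mem /f0.
rewrite !(integral_mkcond D) !ge0_integralTE//.
apply: ge_ereal_sup => _ [h /= hf <-].
apply: (@le_trans _ _ (sintegral m2 h)); last first.
  by apply: ereal_sup_ubound; exists h.
rewrite !sintegralE; apply: lee_fsum => [|r [x _ hxr]]; first exact: fimfunP.
(* A simple function below [f \_ D] takes a positive value only inside [D], so the fibre to compare
   lies in [D]. *)
have [->|r0] := eqVneq r 0; first by rewrite !mul0e.
have r_gt0 : 0 < r by rewrite lt_neqAle eq_sym r0 -hxr/=.
rewrite lee_pmul2l// ?lte_fin//; apply: m12 => // y /= hyr.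
move: (hf y); rewrite hyr patchE; case: ifPn => [/set_mem//|_].
by rewrite lee_fin leNgt r_gt0.
Qed.

Lemma le_measure_integrable d (T : measurableType d) (R : realType)
    (m1 m2 : {measure set T -> \bar R}) (D : set T) (f : T -> \bar R) :
  measurable D -> (forall A, measurable A -> A `<=` D -> (m1 A <= m2 A)%E) ->
  m2.-integrable D f -> m1.-integrable D f.
Proof.
move=> mD m12 /integrableP[mf fi]; apply/integrableP; split => //.
exact: le_lt_trans (le_measure_ge0_integral mD m12 (fun _ _ => abse_ge0 _)) fi.
Qed.

Lemma integrable_measure_add d (T : measurableType d) (R : realType)
    (m1 m2 : {measure set T -> \bar R}) (D : set T) (f : T -> \bar R) :
  measurable D -> m1.-integrable D f -> m2.-integrable D f ->
  (measure_add m1 m2).-integrable D f.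
Proof.
move=> mD /integrableP[mf fi1] /integrableP[_ fi2]; apply/integrableP; split => //.
rewrite ge0_integral_measure_add//; first exact: lte_add_pinfty.
exact: measurableT_comp.
Qed.

Section LBMIntegral.
Context {R : realType} {X : normedModType R}.
Implicit Types (mu nu : lbmeasure X) (D : set X) (f g : X -> R).

Lemma lbm_tv_integrableP mu (D : set (borel X)) (f : borel X -> \bar R) :
  measurable D -> (lbm_tv mu).-integrable D f <->
  (lbm_pos mu).-integrable D f /\ (lbm_neg mu).-integrable D f.
Proof.
move=> mD; split=> [fi|[fp fn]]; last exact: integrable_measure_add.
split; apply: (le_measure_integrable mD _ fi) => A mA AD.
  by rewrite [X in (_ <= X)%E]lbm_tvE leeDl// lbm_pos_ge0.
by rewrite [X in (_ <= X)%E]lbm_tvE leeDr// lbm_pos_ge0.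
Qed.

Lemma lbm_integral_support mu (D E : set (borel X)) f :
  measurable D -> D `<=` E -> (forall x, E x -> ~ D x -> f x = 0) ->
  lbm_integral mu E f = lbm_integral mu D f.
Proof.
move=> mD DE f0; rewrite /lbm_integral.
suff RE (m : {measure set (borel X) -> \bar R}) :
    \int[m]_(x in E) f x = \int[m]_(x in D) f x by rewrite !RE.
rewrite (Rintegral_mkcond m E) (Rintegral_mkcond m D).
congr (fine _); apply: eq_integral => x _; congr EFin; rewrite !patchE.
case: ifPn => [/set_mem Ex|xE]; case: ifPn => //.
  by move=> /negP xD; apply: f0 => // Dx; apply: xD; exact/mem_set.
by move=> /set_mem/DE/mem_set; rewrite (negbTE xE).
Qed.

Lemma lbm_pos_sub_le mu nu (A : set (borel X)) :
  (lbm_pos (lbm_sub mu nu) A <= lbm_pos mu A + lbm_neg nu A)%E.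
Proof.
apply: ge_ereal_sup => _ [B [bB BA] <-].
rewrite EFinB; apply: leeD; first exact: lbm_pos_ge.
by rewrite -EFinN; exact: (lbm_pos_ge (lbm_opp nu)).
Qed.

Lemma lbm_neg_sub_le mu nu (A : set (borel X)) :
  (lbm_neg (lbm_sub mu nu) A <= lbm_neg mu A + lbm_pos nu A)%E.
Proof.
apply: ge_ereal_sup => _ [B [bB BA] <-] /=.
rewrite opprB EFinB addeC; apply: leeD; last exact: lbm_pos_ge.
by rewrite -EFinN; exact: (lbm_pos_ge (lbm_opp mu)).
Qed.

Lemma lbm_tv_sub_le mu nu (A : set (borel X)) :
  (lbm_tv (lbm_sub mu nu) A <= lbm_tv mu A + lbm_tv nu A)%E.
Proof.
rewrite !lbm_tvE; apply: le_trans (leeD (lbm_pos_sub_le _ _ _) (lbm_neg_sub_le _ _ _)) _.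
by rewrite addeACA [X in (_ + X <= _)%E]addeC.
Qed.

Lemma integrable_lbm_tv_sub mu nu (D : set (borel X)) (f : borel X -> \bar R) :
  measurable D -> (lbm_tv mu).-integrable D f -> (lbm_tv nu).-integrable D f ->
  (lbm_tv (lbm_sub mu nu)).-integrable D f.
Proof.
move=> mD muf nuf.
apply: (@le_measure_integrable _ _ _ _ (measure_add (lbm_tv mu) (lbm_tv nu))) => //.
  by move=> A mA AD; rewrite [X in (_ <= X)%E]measure_addE; exact: lbm_tv_sub_le.
exact: integrable_measure_add.
Qed.

(** The Jordan parts of [mu - nu] are not the differences of those of [mu] and [nu]. Moving negative
    terms across gives an equality of positive measures, [(mu - nu)^+ + mu^- + nu^+ = (mu - nu)^- +
    mu^+ + nu^-], which can be integrated. *)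
Lemma lbm_integral_sub mu nu (D : set (borel X)) (f : borel X -> R) :
  bounded_borel D ->
  (lbm_tv mu).-integrable D (EFin \o f) -> (lbm_tv nu).-integrable D (EFin \o f) ->
  lbm_integral (lbm_sub mu nu) D f = lbm_integral mu D f - lbm_integral nu D f.
Proof.
move=> bD; have mD : measurable D by case: bD.
move=> /(lbm_tv_integrableP _ _ mD)[mup mun] /(lbm_tv_integrableP _ _ mD)[nup nun].
have pS A : (lbm_pos (lbm_sub mu nu) A <= measure_add (lbm_pos mu) (lbm_neg nu) A)%E.
  by rewrite measure_addE lbm_pos_sub_le.
have nS A : (lbm_neg (lbm_sub mu nu) A <= measure_add (lbm_neg mu) (lbm_pos nu) A)%E.
  by rewrite measure_addE lbm_neg_sub_le.
have pI : (lbm_pos (lbm_sub mu nu)).-integrable D (EFin \o f).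
  apply: (@le_measure_integrable _ _ _ _ (measure_add (lbm_pos mu) (lbm_neg nu))) => //.
    by move=> A _ _; exact: pS.
  exact: integrable_measure_add.
have nI : (lbm_neg (lbm_sub mu nu)).-integrable D (EFin \o f).
  apply: (@le_measure_integrable _ _ _ _ (measure_add (lbm_neg mu) (lbm_pos nu))) => //.
    by move=> A _ _; exact: nS.
  exact: integrable_measure_add.
have mE A : measurable A -> A `<=` D ->
    measure_add (lbm_pos (lbm_sub mu nu)) (measure_add (lbm_neg mu) (lbm_pos nu)) A =
    measure_add (lbm_neg (lbm_sub mu nu)) (measure_add (lbm_pos mu) (lbm_neg nu)) A.
  move=> mA AD; have bA : bounded_borel A := bounded_borelS mA AD bD.
  rewrite !measure_addE [X in (_ + X = _)%E](measure_addE (lbm_neg mu)).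
  rewrite [X in (_ = _ + X)%E](measure_addE (lbm_pos mu)).
  have := lbm_jordan_fine (lbm_sub mu nu) bA => /=.
  rewrite (lbm_jordan_fine mu bA) (lbm_jordan_fine nu bA) => E.
  rewrite -(fineK (lbm_pos_finite (lbm_sub mu nu) bA)).
  rewrite -(fineK (lbm_neg_finite (lbm_sub mu nu) bA)).
  rewrite -(fineK (lbm_pos_finite mu bA)) -(fineK (lbm_neg_finite mu bA)).
  rewrite -(fineK (lbm_pos_finite nu bA)) -(fineK (lbm_neg_finite nu bA)).
  by rewrite -!EFinD; congr EFin; lra.
have := @eq_measure_integral _ _ _ D _ _ (EFin \o f) mE.
rewrite !integral_measure_add//; [|exact: integrable_measure_add..].
rewrite -(fineK (integrable_fin_num mD pI)) -(fineK (integrable_fin_num mD nI)).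
rewrite -(fineK (integrable_fin_num mD mup)) -(fineK (integrable_fin_num mD mun)).
rewrite -(fineK (integrable_fin_num mD nup)) -(fineK (integrable_fin_num mD nun)).
rewrite -!EFinD => -[].
by rewrite /lbm_integral /Rintegral => E; lra.
Qed.

Lemma le_abs_lbm_integral mu (D : set (borel X)) (f : borel X -> R) :
  measurable D -> (lbm_tv mu).-integrable D (EFin \o f) ->
  (`|lbm_integral mu D f|%:E <= \int[lbm_tv mu]_(x in D) `|f x|%:E)%E.
Proof.
move=> mD fi; have /(lbm_tv_integrableP _ _ mD)[fp fn] := fi.
have mf : measurable_fun D (fun x => `|f x|%:E).
  have /measurable_EFinP mf : measurable_fun D (EFin \o f) by case/integrableP: fp.
  by apply/measurable_EFinP; exact: measurableT_comp.
have -> : (\int[lbm_tv mu]_(x in D) `|f x|%:E =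
    \int[lbm_pos mu]_(x in D) `|f x|%:E + \int[lbm_neg mu]_(x in D) `|f x|%:E)%E.
  by rewrite -ge0_integral_measure_add.
have le (m : {measure set (borel X) -> \bar R}) : m.-integrable D (EFin \o f) ->
    (`|\int[m]_(x in D) f x|%:E <= \int[m]_(x in D) `|f x|%:E)%E.
  move=> fm; rewrite EFin_normr_Rintegral//.
  apply: le_trans (le_abse_integral _ mD _) _ => //.
  by case/integrableP: fm.
apply: le_trans (leeD (le _ fp) (le _ fn)).
by rewrite -EFinD lee_fin ler_normB.
Qed.

Lemma lbm_integralD mu (D : set (borel X)) (f g : borel X -> R) :
  measurable D -> (lbm_tv mu).-integrable D (EFin \o f) ->
  (lbm_tv mu).-integrable D (EFin \o g) ->
  lbm_integral mu D (f \+ g) = lbm_integral mu D f + lbm_integral mu D g.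
Proof.
move=> mD /(lbm_tv_integrableP _ _ mD)[fp fn] /(lbm_tv_integrableP _ _ mD)[gp gn].
rewrite /lbm_integral !RintegralD//; lra.
Qed.
End LBMIntegral.

(** * Coordinates, boxes and bumps *)

Section FiniteMeasureApproximation.
Context {R : realType} {d : measure_display} {T : measurableType d}.
Context {B : countType} (base : B -> set T).

(* Boolean combinations of the sets [base b], generated by the single operation
   "complement of the union", so that they are indexed by a countable type. *)
Fixpoint nor_set (t : GenTree.tree B) : set T :=
  match t with
  | GenTree.Leaf b => base b
  | GenTree.Node _ ts => ~` foldr (fun s A => nor_set s `|` A) set0 ts
  end.

Lemma nor_setC t : nor_set (GenTree.Node 0 [:: t]) = ~` nor_set t.
Proof. by rewrite /= setU0. Qed.

Lemma nor_setU s t :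
  nor_set (GenTree.Node 0 [:: GenTree.Node 0 [:: s; t]]) = nor_set s `|` nor_set t.
Proof. by rewrite /= !setU0 setCK. Qed.

Lemma nor_set0 : nor_set (GenTree.Node 0 [:: GenTree.Node 0 [::]]) = set0.
Proof. by rewrite /= !setU0 setCK. Qed.

Lemma measurable_nor_set : (forall b, measurable (base b)) ->
  forall t, measurable (nor_set t).
Proof.
move=> mbase; fix IH 1 => -[b|n ts] /=; first exact: mbase.
apply: measurableC; elim: ts => [|t ts IHts] /=; first exact: measurable0.
by apply: measurableU => //; exact: IH.
Qed.

(** The sets that can be approximated up to every [e] form a sigma-algebra containing the base.
    Complements leave the symmetric difference unchanged; a countable union is first replaced by a
    finite one, which costs [e / 2] since [m] is finite. *)
Lemma nor_set_approx (m : {measure set T -> \bar R}) (A : set T) (e : R) :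
  (forall b, measurable (base b)) -> (m setT < +oo)%E ->
  <<s range base >> A -> 0 < e ->
  exists t, (m (A `+` nor_set t) < e%:E)%E.
Proof.
move=> mbase moo sA; move: e.
have ms := measurable_nor_set mbase.
have mfin (C : set T) : measurable C -> m C \is a fin_num.
  move=> mC; rewrite ge0_fin_numE//; apply: le_lt_trans moo.
  by apply: le_measure => //; rewrite inE.
pose P (C : set T) := measurable C /\
  forall e : R, 0 < e -> exists t, (m (C `+` nor_set t) < e%:E)%E.
suff : P A by case.
have mY (C D : set T) : measurable C -> measurable D -> measurable (C `+` D).
  by move=> mC mD; apply: measurableU; exact: measurableD.
have PU (C D : set T) : P C -> P D -> P (C `|` D).
  move=> [mC aC] [mD aD]; split=> [|e e0]; first exact: measurableU.
  have e20 : 0 < e / 2 by rewrite divr_gt0.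
  have [s hs] := aC (e / 2) e20.
  have [t ht] := aD (e / 2) e20.
  exists (GenTree.Node 0 [:: GenTree.Node 0 [:: s; t]]); rewrite nor_setU.
  rewrite [e]splitr EFinD; apply: le_lt_trans (lteD hs ht).
  apply: le_trans (measureU2 _ _ _); [|exact: mY..].
  apply: le_measure; rewrite ?inE.
  - by apply: mY; exact: measurableU.
  - by apply: measurableU; exact: mY.
  - by move=> x /=; tauto.
move: A sA; apply: smallest_sub; last first.
  move=> _ [b _ <-]; split => // e e0; exists (GenTree.Leaf b).
  by rewrite setYK measure0 lte_fin.
split.
- split=> [|e e0]; first exact: measurable0.
  exists (GenTree.Node 0 [:: GenTree.Node 0 [::]]).
  by rewrite nor_set0 setYK measure0 lte_fin.
- move=> C [mC aC]; split=> [|e e0]; first exact: measurableD.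
  have [t ht] := aC _ e0; exists (GenTree.Node 0 [:: t]).
  rewrite nor_setC (_ : _ `+` _ = C `+` nor_set t)//.
  apply/seteqP; split=> x /=; have := pselect (C x);
    have := pselect (nor_set t x); tauto.
- move=> F PF; have mF n : measurable (F n) := (PF n).1.
  split=> [|e e0]; first exact: bigcupT_measurable.
  have e20 : 0 < e / 2 by rewrite divr_gt0.
  pose G n := \big[setU/set0]_(i < n.+1) F i.
  have PG n : P (G n).
    rewrite /G; elim: n => [|n IH]; last by rewrite big_ord_recr; exact: PU.
    by rewrite big_ord_recr big_ord0 /= set0U.
  have UG : \bigcup_n F n = \bigcup_n G n.
    by rewrite /G -bigcup_bigsetU_bigcup.
  have mG n : measurable (G n) := (PG n).1.
  have cG : m (G n) @[n --> \oo] --> m (\bigcup_n G n).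
    apply: nondecreasing_cvg_mu => //; first exact: bigcupT_measurable.
    by move=> i j ij; apply/subsetPset; exact: subset_bigsetU.
  have mU : measurable (\bigcup_n G n) by exact: bigcupT_measurable.
  have [n hn] : exists n, (m (\bigcup_n G n `\` G n) < (e / 2)%:E)%E.
    move: cG; rewrite -(fineK (mfin _ mU)) => /fine_cvgP[_] /cvgrPdist_lt.
    move=> /(_ _ e20)[n _ /(_ n (leqnn n))] /= hn.
    exists n; rewrite measureD//; last by rewrite -ge0_fin_numE// mfin.
    rewrite (setIidr (bigcup_sup _))//.
    rewrite -[X in (X - _ < _)%E]fineK ?mfin// -[X in (_ - X < _)%E]fineK ?mfin//.
    by rewrite -EFinB lte_fin; exact: le_lt_trans (ler_norm _) hn.
  have [t ht] := (PG n).2 (e / 2) e20.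
  exists t; rewrite UG [e]splitr EFinD; apply: le_lt_trans (lteD hn ht).
  apply: le_trans (measureU2 _ _ _); [|exact: measurableD|exact: mY].
  apply: le_measure; rewrite ?inE.
  + exact: mY.
  + by apply: measurableU; [exact: measurableD|exact: mY].
  + move=> x /= [[Ux nt]|[tx nU]].
      by have [?|?] := pselect (G n x); [right; left|left].
    right; right; split => // Gx; apply: nU; by exists n.
Qed.

End FiniteMeasureApproximation.
Section Boxes.
Context {R : realType} {X : normedModType R} {I : finType} (co : I -> X -> R).
Implicit Types (mu nu : lbmeasure X) (A B K : set X).

(* [co] is a finite family of continuous linear coordinates defining the topology
   and such that closed bounded sets are compact; used for R^d and R^d x R. *)
Definition coordinates :=
  [/\ forall i z, is_diff z (co i) (co i),
      forall (O : set X) z, open O -> O z -> exists2 e : R, 0 < e &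
        [set y | forall i, `|co i y - co i z| < e] `<=` O &
      forall M, 0 <= M -> compact [set z | forall i, `|co i z| <= M]].

Definition box (p : I -> R * R) : set X :=
  [set z | forall i, `|co i z - (p i).1| < (p i).2].

Definition rat_box (p : {ffun I -> rat * rat}) : set X :=
  box (fun i => (ratr (p i).1, ratr (p i).2)).

Hypothesis coP : coordinates.

Lemma coordinate_continuous i : continuous (co i).
Proof.
by move=> z; apply: differentiable_continuous; case: coP => /(_ i z)[].
Qed.

Lemma box_open p : open (box p).
Proof.
rewrite openE => z zp; rewrite /interior.
apply: (@filter_forall _ _ (fun i y => `|co i y - (p i).1| < (p i).2)) => i.
have : open ((fun y => `|co i y - (p i).1|) @^-1` [set r | r < (p i).2]).
  apply: open_comp; last exact: open_lt.
  move=> y _; apply: (@continuous_comp _ _ _ (fun y => co i y - (p i).1) (fun r => `|r|)).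
    by apply: continuousB; [exact: coordinate_continuous|exact: cst_continuous].
  exact: norm_continuous.
rewrite openE => /(_ z); apply; exact: zp.
Qed.

Lemma box_bounded p : exists2 K : set X, compact K & box p `<=` K.
Proof.
pose M := \sum_i (`|(p i).1| + `|(p i).2|).
exists [set z | forall i, `|co i z| <= M].
  by case: coP => _ _; apply; rewrite sumr_ge0.
move=> z zp i; have := zp i.
rewrite -[X in `|X| <= _](subrK (p i).1) => zpi.
apply: le_trans (ler_normD _ _) _; rewrite addrC /M (bigD1 i)//= -addrA.
rewrite lerD2l (le_trans (ltW zpi))// (le_trans (ler_norm _))// lerDl.
by rewrite sumr_ge0.
Qed.

Lemma box_bounded_borel p : bounded_borel (box p).
Proof.
by split; [apply: open_borel; exact: box_open|exact: box_bounded].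
Qed.

Lemma rat_box_basis (O : set X) z :
  open O -> O z -> exists p, rat_box p z /\ rat_box p `<=` O.
Proof.
move=> oO Oz; case: coP => _ /(_ O z oO Oz)[e e0 eO] _.
have [r] : exists q : rat, ratr q \in `]0, e / 2[ by apply: rat_in_itvoo; rewrite divr_gt0.
rewrite in_itv/= => /andP[r0 re].
have c i : exists q : rat, `|co i z - ratr q| < ratr r.
  have [q] : exists q : rat, ratr q \in `]co i z - ratr r, co i z + ratr r[.
    by apply: rat_in_itvoo; rewrite ltrD2l gtrN.
  rewrite in_itv/= => /andP[q1 q2]; exists q; rewrite ltr_norml; apply/andP; split; lra.
have [f fP] := choice c.
exists [ffun i => (f i, r)]; split=> [i|y yb]; first by rewrite ffunE.
apply: eO => i /=; have := yb i; have := fP i; rewrite /= ffunE => h1 h2.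
rewrite -[co i y](subrK (ratr (f i))) -addrA.
apply: le_lt_trans (ler_normD _ _) _; rewrite -normrN opprB distrC in h1.
by rewrite distrC in h1 *; lra.
Qed.

Lemma borel_rat_boxes : measurable `<=` (<<s range rat_box >> : set (set (borel X))).
Proof.
apply: smallest_sub; first exact: smallest_sigma_algebra.
move=> O oO.
pose F n := if unpickle n is Some p then
  if `[< rat_box p `<=` O >] then rat_box p else set0 else set0.
rewrite (_ : O = \bigcup_n F n); last first.
  apply/seteqP; split=> [z Oz|z [n _]].
    have [p [zp pO]] := rat_box_basis oO Oz; exists (pickle p) => //.
    by rewrite /F pickleK; case: asboolP.
  by rewrite /F; case: unpickle => // p; case: asboolP => // pO /pO.
apply: sigma_algebra_bigcup => n; rewrite /F.
case: unpickle => [p|]; last exact: sigma_algebra0.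
case: asboolP => _; last exact: sigma_algebra0.
by apply: sub_sigma_algebra; exists p.
Qed.

Lemma measurable_rat_box p : measurable (rat_box p : set (borel X)).
Proof. by apply: open_borel; exact: box_open. Qed.

Definition nor_box := nor_set (T := borel X) rat_box.

Lemma measurable_nor_box t : measurable (nor_box t).
Proof. by apply: measurable_nor_set => p; exact: measurable_rat_box. Qed.

(** Turns the upper variation into a supremum over a countable index set that does not depend on
    [mu]: hence measurability in [t] for families of measures, and the choice of nearly maximizing
    sets slice by slice. *)
Lemma lbm_pos_nor_box mu A : bounded_borel A ->
  lbm_pos mu A = ereal_sup (range (fun t => (mu (A `&` nor_box t))%:E)).
Proof.
move=> bA; have mA : measurable (A : set (borel X)) by case: bA.
have bAt t : bounded_borel (A `&` nor_box t).
  by apply: bounded_borelI => //; exact: measurable_nor_box.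
apply/eqP; rewrite eq_le; apply/andP; split; last first.
  by apply: ge_ereal_sup => _ [t _ <-]; apply: lbm_pos_ge => //; exact: subIsetl.
apply: ge_ereal_sup => _ [B [bB BA] <-]; apply/lee_addgt0Pr => e e0.
pose m := mrestr (lbm_tv mu) mA.
have mT : (m setT < +oo)%E by rewrite /m /mrestr setTI; exact: lbm_tv_finite.
have mB : measurable (B : set (borel X)) by case: bB.
have [t ht] : exists t, (m (B `+` nor_box t) < e%:E)%E.
  apply: nor_set_approx => //.
  - by move=> p; exact: measurable_rat_box.
  - by apply: borel_rat_boxes.
apply: (@le_trans _ _ ((mu (A `&` nor_box t))%:E + e%:E)%E); last first.
  by rewrite leeD2r//; apply: ereal_sup_ubound; exists t.
set S := nor_box t; have mS : borel_set S by exact: measurable_nor_box.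
have bBS : bounded_borel (B `\` S) by exact: bounded_borelD.
have bSB : bounded_borel (A `&` S `\` B) by apply: bounded_borelD => //; exact: bAt.
(* Passing from [B] to the intersection of [A] and [S] changes [mu] by its values on the two halves
   of their symmetric difference, hence by at most the variation of that difference. *)
have -> : mu B = mu (A `&` S) + (mu (B `\` S) - mu (A `&` S `\` B)).
  have -> : mu (A `&` S `\` B) = mu (A `&` S) - mu (B `&` S).
    rewrite -lbm_setD//; first by congr lbm; apply/seteqP; split=> x /=; tauto.
    - exact: bAt.
    - exact: measurableI.
    - exact: setSI.
  have : mu B = mu (B `&` S) + mu (B `\` S).
    rewrite -lbm_setU ?setUIDK//; first exact: bounded_borelI.
    by rewrite setDE setIACA setICr setI0.
  by move=> ->; lra.
rewrite EFinD leeD2l//; apply/ltW; apply: le_lt_trans ht.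
rewrite /m /mrestr lbm_tvE EFinB; apply: leeD.
  by apply: lbm_pos_ge => // x [Bx nSx]; split; [left|exact: BA].
rewrite -EFinN; apply: (lbm_pos_ge (lbm_opp mu)) => // x [[Ax Sx] nBx].
by split => //; right.
Qed.
End Boxes.

Section Coordinates.
Context {R : realType} (d : nat).
Local Notation E := 'rV[R]_d.

Lemma is_diff_continuous_linear (V W : normedModType R) (f : V -> W) (z : V) :
  linear f -> continuous f -> is_diff z f f.
Proof.
move=> lf cf.
pose flM := GRing.isLinear.Build _ _ _ _ f lf.
pose fL : {linear V -> W} := HB.pack f flM.
have -> : f = fL by [].
apply: DiffDef; first exact: linear_differentiable.
by rewrite diff_lin.
Qed.

Definition co_space (i : 'I_d) (x : E) : R := x 0 i.

Definition co_spacetime (i : option 'I_d) (z : E * R) : R :=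
  if i is Some j then z.1 0 j else z.2.

Lemma rV_ballP (x y : E) (e : R) : 0 < e ->
  ball x e y <-> forall i, `|y 0 i - x 0 i| < e.
Proof.
move=> e0; split=> [[_ +] i|h]; first by move=> /(_ 0 i); rewrite /ball/= distrC.
by split => // i j; rewrite ord1 /ball/= distrC.
Qed.

Lemma normr_rV_le (x : E) (e : R) : 0 <= e ->
  (`|x| <= e) <-> forall i, `|x 0 i| <= e.
Proof.
move=> e0; split=> [xe i|xe].
  apply: le_trans xe; have := (le_bigmax _ (fun ij : 'I_1 * 'I_d => `|x ij.1 ij.2|) (0, i)).
  by rewrite /Num.norm/= mx_normrE; apply.
by rewrite /Num.norm/= mx_normrE bigmax_le// => -[i j] _; rewrite ord1.
Qed.

Lemma coordinates_space : coordinates co_space.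
Proof.
split=> [i z|O z oO Oz|M M0].
- apply: is_diff_continuous_linear; last exact: coord_continuous.
  by move=> a x y; rewrite /co_space !mxE.
- have /nbhs_ballP[e e0 eO] : nbhs z O by exact: open_nbhs_nbhs.
  by exists e => // y ye; apply: eO; apply/rV_ballP.
- apply: bounded_closed_compact.
    exists M; split; first by rewrite num_real.
    move=> r Mr x /= xM; apply/normr_rV_le; first exact: le_trans M0 (ltW Mr).
    by move=> i; exact: le_trans (xM i) (ltW Mr).
  rewrite (_ : [set _ | _] = (fun x : E => `|x|) @^-1` [set r | r <= M]).
    by apply: closed_comp => [x _|]; [exact: norm_continuous|exact: closed_le].
  by apply/seteqP; split=> x /= /(normr_rV_le _ M0).
Qed.

Lemma coordinates_spacetime : coordinates co_spacetime.
Proof.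
split=> [i z|O z oO Oz|M M0].
- apply: is_diff_continuous_linear.
    by case: i => [i|] a x y; rewrite /co_spacetime/= ?mxE.
  case: i => [i|] y; last exact: cvg_snd.
  apply: (@continuous_comp _ _ _ fst (fun x : E => x 0 i)); first exact: cvg_fst.
  exact: coord_continuous.
- have /nbhs_ballP[e e0 eO] : nbhs z O by exact: open_nbhs_nbhs.
  exists e => // y ye; apply: eO; split.
    by apply/rV_ballP => // i; exact: (ye (Some i)).
  by rewrite /ball/= distrC; exact: (ye None).
- have [_ _ /(_ _ M0) cE] := coordinates_space.
  rewrite (_ : [set _ | _] = [set x | forall i, `|co_space i x| <= M] `*` `[- M, M]).
    by apply: compact_setX => //; exact: segment_compact.
  apply/seteqP; split=> -[x s] /=.
    move=> h; split; first by move=> i; exact: (h (Some i)).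
    by rewrite in_itv/= -ler_norml; exact: (h None).
  by rewrite in_itv/= -ler_norml => -[h1 h2] [i|] //; exact: h1.
Qed.
End Coordinates.

(** * Smooth approximations of indicator functions *)

Section FlatFunction.
Context {R : realType}.

(** The classical function [s^-j exp(-1/s)], extended by 0 to [s <= 0]. The index [j] makes the
    family closed under differentiation up to linear combinations. *)
Definition flat (j : nat) (s : R) : R :=
  if 0 < s then s^-1 ^+ j * expR (- s^-1) else 0.

Lemma flat_ge0 j s : 0 <= flat j s.
Proof.
rewrite /flat; case: ifPn => // s0.
by rewrite mulr_ge0 ?expR_ge0// exprn_ge0// invr_ge0 ltW.
Qed.

(** This quadratic bound gives the derivative at 0. It is the inequality [exp y >= (y / n)^n] with
    [y = 1/s] and [n = j + 2]. *)
Lemma flat_bound j : exists2 C : R, 0 <= C & forall s, flat j s <= C * s ^+ 2.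
Proof.
pose n : R := j.+2%:R; have n0 : 0 < n by rewrite ltr0n.
exists (n ^+ j.+2); first by rewrite exprn_ge0// ltW.
move=> s; rewrite /flat; case: ifPn => [s0|_]; last first.
  by rewrite mulr_ge0 ?sqr_ge0// exprn_ge0// ltW.
rewrite -[s in s ^+ 2]invrK; move: s0; rewrite -invr_gt0; move: (s^-1) => y y0.
have : (y / n) ^+ j.+2 <= expR y.
  have -> : expR y = expR (y / n) ^+ j.+2.
    by rewrite -expRM_natl mulrC divfK// gt_eqF.
  rewrite lerXn2r ?nnegrE ?expR_ge0 ?divr_ge0 ?ltW//.
  by rewrite (lt_le_trans _ (expR_ge1Dx _))// ltrDr.
rewrite expr_div_n ler_pdivrMr ?exprn_gt0// => h.
rewrite expRN ler_pdivrMr ?expR_gt0// exprVn.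
rewrite mulrAC ler_pdivlMr ?exprn_gt0// -exprD addn2.
by rewrite mulrC in h; exact: h.
Qed.

Lemma is_derive_flat j (s : R) :
  is_derive s (1 : R) (flat j) (flat j.+2 s - j%:R * flat j.+1 s).
Proof.
have [s0|s0|<-] := ltgtP 0 s.
- have sn0 : s != 0 by rewrite gt_eqF.
  apply: (@near_eq_is_derive _ _ _ (fun s : R => s^-1 ^+ j * expR (- s^-1))).
    have : \forall y \near s, 0 < y by exact: lt_nbhsr.
    by apply: filterS => y y0; rewrite /flat y0.
  have dV : is_derive s (1 : R) (fun y : R => y^-1) (- s ^- 2).
    by apply: is_derive_eq (is_deriveV sn0 (is_derive_id s 1)) _; rewrite /GRing.scale/= mulr1.
  have dX := is_deriveX j dV; rewrite exprfctE in dX.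
  have dE : is_derive s (1 : R) (expR \o (fun y : R => - y^-1)) (expR (- s^-1) * s ^- 2).
    apply: is_derive1_comp.
    by apply: is_derive_eq (is_deriveN dV) _; rewrite opprK.
  apply: is_derive_eq (is_deriveM dX dE) _.
  rewrite /flat s0 /GRing.scale/= expr2 invfM.
  by case: j dX => [|j] dX /=; rewrite ?expr0 ?exprS; ring.
- apply: (@near_eq_is_derive _ _ _ (cst 0)).
    have : \forall y \near s, y < 0 by exact: lt_nbhsl.
    by apply: filterS => y y0; rewrite /flat ltNge ltW.
  rewrite /flat !ltNge (ltW s0)/= mulr0 subr0; exact: is_derive_cst.
- have [C C0 fC] := flat_bound j.
  have cv : (fun h : R => h^-1 *: (flat j (h *: 1 + 0) - flat j 0)) @ 0^' --> (0 : R).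
    apply/cvgr0Pnorm_le => e e0; near=> h.
    have h0 : h != 0 by near: h; exact: nbhs_dnbhs_neq.
    rewrite {2}/flat ltxx subr0 /GRing.scale/= mulr1 addr0 normrM normfV.
    rewrite ler_pdivrMl ?normr_gt0// (ger0_norm (flat_ge0 _ _)).
    apply: le_trans (fC h) _; rewrite -real_normK ?num_real// expr2 mulrCA.
    rewrite ler_pM2l ?normr_gt0//.
    have : `|h| < e / (C + 1) by near: h; apply: dnbhs0_lt; rewrite divr_gt0 ?ltr_wpDl.
    rewrite ltr_pdivlMr ?ltr_wpDl// mulrDr mulr1 mulrC => hC.
    by rewrite (le_trans _ (ltW hC))// lerDl.
  rewrite /flat ltxx mulr0 subr0.
  by apply: DeriveDef; [exact: (cvgP _ cv)|exact: (cvg_lim _ cv)].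
Unshelve. all: by end_near. Qed.
End FlatFunction.

Section SmoothAlgebra.
Context {R : realType} {X : normedModType R}.

(* A class of functions stable under directional derivatives, hence smooth. *)
Inductive flat_algebra : (X -> R) -> Prop :=
| flat_cst (c : R) : flat_algebra (fun=> c)
| flat_linear (l : X -> R) : (forall z, is_diff z l l) -> flat_algebra l
| flat_add (f g : X -> R) :
    flat_algebra f -> flat_algebra g -> flat_algebra (fun z => f z + g z)
| flat_mul (f g : X -> R) :
    flat_algebra f -> flat_algebra g -> flat_algebra (fun z => f z * g z)
| flat_comp (j : nat) (g : X -> R) :
    flat_algebra g -> flat_algebra (fun z => flat j (g z)).

Lemma flat_algebra_diff f : flat_algebra f ->
  (forall z, differentiable f z) /\ forall v, flat_algebra (fun z => 'D_v f z).
Proof.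
elim=> {f} [c|l dl|f g _ [df f'] _ [dg g']|f g hf [df f'] hg [dg g']|j g hg [dg g']].
- split=> [z|v]; first exact: differentiable_cst.
  rewrite (_ : 'D_v _ = fun=> 0); first exact: flat_cst.
  by apply/funext => z; rewrite derive_cst.
- split=> [z|v]; first by case: (dl z).
  rewrite (_ : 'D_v _ = fun=> l v); first exact: flat_cst.
  by apply/funext => z; have [dlz lE] := dl z; rewrite deriveE// lE.
- split=> [z|v]; first exact: differentiableD.
  rewrite (_ : 'D_v _ = fun z => 'D_v f z + 'D_v g z); first exact: flat_add.
  by apply/funext => z; rewrite deriveD//; exact: diff_derivable.
- split=> [z|v]; first exact: differentiableM.
  rewrite (_ : 'D_v _ = fun z => f z * 'D_v g z + g z * 'D_v f z).
    by apply: flat_add; exact: flat_mul.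
  by apply/funext => z; rewrite deriveM//; exact: diff_derivable.
- have dflat s : differentiable (flat j : R -> R) s.
    by apply/derivable1_diffP; case: (is_derive_flat j s).
  split=> [z|v]; first exact: (differentiable_comp (dg z) (dflat (g z))).
  rewrite (_ : 'D_v _ =
      fun z => (flat j.+2 (g z) + (- j%:R) * flat j.+1 (g z)) * 'D_v g z).
    apply: flat_mul => //; apply: flat_add; first exact: flat_comp.
    by apply: flat_mul; [exact: flat_cst|exact: flat_comp].
  apply/funext => z; rewrite deriveE; last exact: (differentiable_comp (dg z) (dflat (g z))).
  rewrite (_ : (fun z => flat j (g z)) = flat j \o g)// diff_comp//= diff1E// -deriveE//.
  by rewrite derive1E (@derive_val _ _ _ _ _ _ _ (is_derive_flat j (g z))) mulNr [RHS]mulrC.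
Qed.

Lemma flat_algebra_smooth f : flat_algebra f -> smooth f.
Proof.
move=> hf n; elim: n f hf => [|n IH] f hf /=.
  by move=> z; apply: differentiable_continuous; exact: (flat_algebra_diff hf).1.
have [df f'] := flat_algebra_diff hf.
by split => // v; exact: IH.
Qed.

Lemma flat_prod (J : Type) (s : seq J) (f : J -> X -> R) :
  (forall j, flat_algebra (f j)) -> flat_algebra (fun z => \prod_(j <- s) f j z).
Proof.
move=> hf; elim: s => [|j s IH].
  by under eq_fun do rewrite big_nil; exact: flat_cst.
by under eq_fun do rewrite big_cons; exact: flat_mul.
Qed.
End SmoothAlgebra.

Section Bumps.
Context {R : realType} {X : normedModType R} {I : finType} (co : I -> X -> R).
Hypothesis coP : coordinates co.
Local Notation boxp := (I -> R * R).
Implicit Types (m : nat) (p : boxp) (l : seq boxp).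

(** Since [flat 0 (m.+1 * s)] equals [exp(-1/((m+1)s))] for [s > 0], it tends to the indicator of
    [0 < s]. The bumps are thus smooth, bounded by 1 and converge pointwise to the indicator of the
    open box. *)
Definition bump m p (z : X) : R :=
  \prod_(i <- enum I) (flat 0 (m.+1%:R * ((p i).2 - (co i z - (p i).1))) *
              flat 0 (m.+1%:R * ((p i).2 + (co i z - (p i).1)))).

Definition bumps m l (z : X) : R := \prod_(p <- l) bump m p z.

Definition boxes l : set X := \big[setI/setT]_(p <- l) box co p.

Definition rat_param (q : {ffun I -> rat * rat}) : boxp :=
  fun i => (ratr (q i).1, ratr (q i).2).

Lemma flat_algebra_bumps m l : flat_algebra (bumps m l).
Proof.
apply: flat_prod => p; apply: flat_prod => i.
have dl z : is_diff z (co i) (co i) by case: coP => /(_ i z).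
have Fco : flat_algebra (fun z => co i z - (p i).1).
  by apply: flat_add; [exact: flat_linear|exact: flat_cst].
have FN : flat_algebra (fun z => (p i).2 - (co i z - (p i).1)).
  rewrite (_ : (fun z => _) = fun z => (p i).2 + (-1) * (co i z - (p i).1)).
    by apply: flat_add; [|apply: flat_mul => //]; exact: flat_cst.
  by apply/funext => z; rewrite mulN1r.
apply: flat_mul; apply: flat_comp; apply: flat_mul => //; try exact: flat_cst.
by apply: flat_add => //; exact: flat_cst.
Qed.

Lemma flat0_le1 (s : R) : flat 0 s <= 1.
Proof.
rewrite /flat; case: ifPn => // s0; rewrite expr0 mul1r.
by rewrite -[leRHS]expR0 ler_expR oppr_le0 invr_ge0 ltW.
Qed.

Lemma bumps_ge0 m l z : 0 <= bumps m l z.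
Proof.
by apply: prodr_ge0 => p _; apply: prodr_ge0 => i _; rewrite mulr_ge0// flat_ge0.
Qed.

Lemma bumps_le1 m l z : bumps m l z <= 1.
Proof.
have prod_le1 (J : Type) (s : seq J) (f : J -> R) :
    (forall j, 0 <= f j <= 1) -> 0 <= \prod_(j <- s) f j <= 1.
  move=> f01; elim: s => [|j s /andP[IH0 IH1]]; first by rewrite big_nil ler01 lexx.
  have /andP[f0 f1] := f01 j.
  by rewrite big_cons mulr_ge0//= mulr_ile1.
apply: (andP (prod_le1 _ _ _ _)).2 => p; apply: prod_le1 => i.
by rewrite mulr_ge0 ?flat_ge0//= mulr_ile1 ?flat_ge0 ?flat0_le1.
Qed.

Lemma flat0_cvg (s : R) : flat 0 (m.+1%:R * s) @[m --> \oo] --> ((0 < s)%R%:R : R).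
Proof.
have [s0|s0] := ltP 0 s; last first.
  rewrite (_ : (fun m => _) = fun=> 0); first exact: cvg_cst.
  by apply/funext => m; rewrite /flat ltNge mulr_ge0_le0.
rewrite (_ : (fun m => _) = fun m => expR (- (m.+1%:R^-1 * s^-1))).
  have c0 : - (m.+1%:R^-1 * s^-1) @[m --> \oo] --> - (0 * s^-1).
    by apply: cvgN; apply: cvgMl; exact: cvg_harmonic.
  have : expR (- (m.+1%:R^-1 * s^-1)) @[m --> \oo] --> expR (- (0 * s^-1)).
    by apply: continuous_cvg c0; exact: continuous_expR.
  by rewrite mul0r oppr0 expR0.
by apply/funext => m; rewrite /flat mulr_gt0// expr0 mul1r invfM.
Qed.

Lemma boxes_cons p l : boxes (p :: l) = box co p `&` boxes l.
Proof. by rewrite /boxes big_cons. Qed.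

Lemma boxes_cat l1 l2 : boxes (l1 ++ l2) = boxes l1 `&` boxes l2.
Proof. by rewrite /boxes big_cat. Qed.

Lemma bump_cvg p z : bump m p z @[m --> \oo] --> (\1_(box co p) z : R).
Proof.
have prod_cvg (J : eqType) (s : seq J) (f : J -> nat -> R) (P : pred J) :
    (forall j, f j m @[m --> \oo] --> ((P j)%:R : R)) ->
    \prod_(j <- s) f j m @[m --> \oo] --> ((all P s)%:R : R).
  move=> fP; elim: s => [|j s IH] /=.
    by under eq_fun do rewrite big_nil; exact: cvg_cst.
  under eq_fun do rewrite big_cons.
  by rewrite -mulnb natrM; apply: cvgM.
have /= := prod_cvg _ (enum I) (fun i m => flat 0 (m.+1%:R * ((p i).2 - (co i z - (p i).1))) *
              flat 0 (m.+1%:R * ((p i).2 + (co i z - (p i).1))))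
  (fun i => `|co i z - (p i).1| < (p i).2)%R.
have -> : all (fun i => `|co i z - (p i).1| < (p i).2) (enum I) = (z \in box co p).
  apply/allP/idP => [h|/set_mem zp i _]; last exact: zp.
  by apply/mem_set => i; apply: h; rewrite mem_enum.
rewrite indicE; apply => i.
set u := co i z - _; set r := (p i).2.
have -> : (`|u| < r) = (0 < r - u) && (0 < r + u).
  by rewrite ltr_norml andbC subr_gt0 -[- _ < _]subr_gt0 opprK [u + r]addrC.
rewrite -mulnb natrM.
by apply: cvgM; exact: flat0_cvg.
Qed.

Lemma bumps_cvg l z : bumps m l z @[m --> \oo] --> (\1_(boxes l) z : R).
Proof.
elim: l => [|p l IH].
  rewrite /bumps /boxes big_nil indicT; under eq_fun do rewrite big_nil.
  exact: cvg_cst.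
rewrite boxes_cons indicI /bumps; under eq_fun do rewrite big_cons.
by apply: cvgM => //; exact: bump_cvg.
Qed.

Lemma bumps_support m l z : ~ boxes l z -> bumps m l z = 0.
Proof.
elim: l => [|p l IH]; first by rewrite /boxes big_nil => /(_ Logic.I).
rewrite boxes_cons /bumps big_cons => zl.
have [zp|zp] := pselect (box co p z).
  by rewrite (_ : \prod_(_ <- _) _ = 0) ?mulr0//; apply: IH => ?; apply: zl.
have [i zpi] : exists i, ~ (`|co i z - (p i).1| < (p i).2) by exact/existsNP.
rewrite /bump (big_rem i) ?mem_enum//=; set u := co i z - _.
move/negP: zpi; rewrite -leNgt ler_normr -subr_le0 -[X in _ || X]subr_le0 opprK.
have flat_eq0 (s : R) : s <= 0 -> flat 0 (m.+1%:R * s) = 0.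
  by move=> s0; rewrite /flat ltNge mulr_ge0_le0.
by move=> /orP[/flat_eq0->|/flat_eq0->]; rewrite ?(mul0r, mulr0).
Qed.

Lemma boxes_open l : open (boxes l).
Proof.
rewrite /boxes; elim: l => [|p l IH]; first by rewrite big_nil; exact: openT.
by rewrite big_cons; apply: openI => //; exact: box_open.
Qed.

Lemma measurable_boxes l : measurable (boxes l : set (borel X)).
Proof. by apply: open_borel; exact: boxes_open. Qed.

Lemma continuous_bumps m l : continuous (bumps m l).
Proof.
move=> z; apply: differentiable_continuous.
exact: (flat_algebra_diff (flat_algebra_bumps m l)).1.
Qed.
End Bumps.

Section BorelContinuous.
Context {R : realType} {X Y : normedModType R}.

Lemma continuous_borel (f : X -> Y) (D : set (borel X)) :
  continuous f -> measurable_fun D (f : borel X -> borel Y).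
Proof.
move=> cf; apply: (@measurable_funS _ _ (borel X) (borel Y) setT) => //.
apply: (@measurability _ _ (borel X) (borel Y) setT f open) => // _ [U oU <-].
by rewrite setTI; apply: open_borel; apply: open_comp => // z _; exact: cf.
Qed.

Lemma open_measurable_borel (f : X -> R) (D : set (borel X)) :
  measurable D -> (forall U : set R, open U -> measurable (D `&` f @^-1` U)) ->
  measurable_fun D (f : borel X -> R).
Proof.
move=> mD h; apply: (measurability _ (RGenOpens.measurableE R)).
by move=> _ [U oU <-]; apply: h; case: oU => a [b ->]; exact: interval_open.
Qed.

Lemma continuous_borel_real (f : X -> R) (D : set (borel X)) :
  continuous f -> measurable_fun D (f : borel X -> R).
Proof.
move=> cf; apply: (@measurable_funS _ _ (borel X) R setT) => //.
apply: open_measurable_borel => // U oU.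
by rewrite setTI; apply: open_borel; apply: open_comp => // z _; exact: cf.
Qed.

End BorelContinuous.
Section BumpUnique.
Context {R : realType} {X : normedModType R} {I : finType} (co : I -> X -> R).
Hypothesis coP : coordinates co.
Local Notation boxp := (I -> R * R).

(** By dominated convergence the two measures agree on finite intersections of rational boxes with
    [box co p]. Finite intersections of rational boxes form a pi-system generating the Borel sets.
    The box [p] heads every list so that all masses are finite. *)
Lemma bumps_measure_unique (m1 m2 : {measure set (borel X) -> \bar R}) (p : boxp) :
  (m1 (box co p) < +oo)%E -> (m2 (box co p) < +oo)%E ->
  (forall m l, (\int[m1]_(z in box co p) (bumps co m (p :: map (@rat_param R I) l) z)%:E =
                \int[m2]_(z in box co p) (bumps co m (p :: map (@rat_param R I) l) z)%:E)%E) ->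
  forall A : set (borel X), measurable A -> A `<=` box co p -> m1 A = m2 A.
Proof.
move=> m1p m2p m12.
have mp : measurable (box co p : set (borel X)) by apply: open_borel; exact: box_open.
have cvb (m : {measure set (borel X) -> \bar R}) l : (m (box co p) < +oo)%E ->
    (\int[m]_(z in box co p) (bumps co k (p :: l) z)%:E @[k --> \oo] -->
     m (boxes co (p :: l)))%E.
  move=> mpoo.
  have mb := measurable_boxes coP (p :: l).
  have -> : m (boxes co (p :: l)) =
      (\int[m]_(z in box co p) (\1_(boxes co (p :: l)) z)%:E)%E.
    rewrite integral_indic//; congr (m _).
    by rewrite boxes_cons; apply/seteqP; split=> z /=; tauto.
  apply: (@dominated_cvg _ _ _ m _ mp _ _ (cst 1%E)) => //.
  - move=> k; apply/measurable_EFinP; apply: continuous_borel_real.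
    exact: continuous_bumps.
  - move=> z _; apply: cvg_EFin; first exact: nearW.
    exact: bumps_cvg.
  - apply/integrableP; split; first exact: measurable_cst.
    under eq_integral do rewrite abse_EFin normr1.
    by rewrite integral_cst// mul1e.
  - move=> k z _; rewrite abse_EFin lee_fin ger0_norm; first exact: bumps_le1.
    exact: bumps_ge0.
move=> A mA Ap.
have : mrestr m1 mp A = mrestr m2 mp A.
  apply: (@measure_unique _ R (borel X) [set boxes co (map (@rat_param R I) l) | l in setT] (fun=> setT)) => //.
  - apply/seteqP; split; last first.
      apply: smallest_sub; first exact: sigma_algebra_measurable.
      by move=> _ [l _ <-]; exact: measurable_boxes.
    apply: subset_trans (borel_rat_boxes coP) _; apply: sub_smallest2r.
      exact: smallest_sigma_algebra.
    move=> _ [q _ <-]; exists [:: q] => //.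
    by rewrite /= boxes_cons /boxes big_nil setIT.
  - by move=> _ _ [l1 _ <-] [l2 _ <-]; exists (l1 ++ l2) => //; rewrite map_cat boxes_cat.
  - by move=> _; exists [::] => //; rewrite /boxes big_nil.
  - by rewrite bigcup_const//; exists 0%N.
  - move=> _ [l _ <-]; rewrite /= /mrestr setIC -boxes_cons.
    apply: (cvg_unique _ (cvb m1 _ m1p)) => //.
    by have := cvb m2 (map (@rat_param R I) l) m2p; rewrite (funext (fun k => m12 k l)).
  - by move=> _; rewrite /= /mrestr setTI.
by rewrite /mrestr !setIidl.
Qed.
End BumpUnique.

(** * Slices of a family of measures *)

Section FiniteKernel.
Context {R : realType} {d d' : measure_display}.
Context {X : measurableType d} {Y : measurableType d'} (k : R.-ker X ~> Y).
Hypothesis kfin : forall x, (k x setT < +oo)%E.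
Local Open Scope ereal_scope.

Lemma kernel_fin_num x (B : set Y) : measurable B -> k x B \is a fin_num.
Proof.
move=> mB; rewrite ge0_fin_numE//; apply: le_lt_trans (kfin x).
by apply: le_measure; rewrite ?inE.
Qed.

(** Finiteness is only asked for each [x] separately: the masses of the slices are integrable in
    time, not bounded. *)
Lemma measurable_kernel_xsection (A : set (X * Y)) :
  measurable A -> measurable_fun setT (fun x => k x (xsection A x)).
Proof.
move=> mA.
have /(_ _ A mA)[|_ +] := @measurable_prod_subset_xsection_kernel _ _ X Y R k setT measurableT.
  move=> x; exists (fine (k x setT) + 1)%R => B mB.
  rewrite /mrestr setIT EFinD fineK ?kernel_fin_num//.
  apply: (@le_lt_trans _ _ (k x setT)); first by apply: le_measure; rewrite ?inE.
  by rewrite lteDl ?kernel_fin_num// lte01.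
rewrite (_ : (fun x => mrestr (k x) measurableT (xsection A x)) =
  (fun x => k x (xsection A x)))//.
by apply/funext => x; rewrite /mrestr setIT.
Qed.

Lemma measurable_kernel_integral (f : X * Y -> \bar R) :
  (forall z, 0 <= f z) -> measurable_fun setT f ->
  measurable_fun setT (fun x => \int[k x]_y f (x, y)).
Proof.
move=> f0 mf; pose f_ := nnsfun_approx measurableT mf.
apply: (@measurable_fun_xsection_integral _ _ _ _ _ f k f_).
- by move=> a b ab; exact/nd_nnsfun_approx.
- by move=> z; exact/cvg_nnsfun_approx.
- by move=> n r; apply: measurable_kernel_xsection.
Qed.

End FiniteKernel.

Section KernelMeasure.
Context {R : realType} {d d' : measure_display}.
Context {X : measurableType d} {Y : measurableType d'} (k : R.-ker X ~> Y).
Hypothesis kfin : forall x, (k x setT < +oo)%E.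
Context (m : {measure set X -> \bar R}).
Local Open Scope ereal_scope.

(** The finiteness proof is an argument of the definition so that the measure structure below, whose
    countable additivity rests on it, can be recovered from the term. *)
Definition kernel_measure (_ : forall x, k x setT < +oo) (A : set (X * Y)) : \bar R :=
  \int[m]_x k x (xsection A x).

Local Notation km := (kernel_measure kfin).

Lemma kernel_measure0 : km set0 = 0.
Proof. by apply: integral0_eq => x _; rewrite xsection0 measure0. Qed.

Lemma kernel_measure_ge0 A : 0 <= km A.
Proof. exact: integral_ge0. Qed.

Lemma kernel_measure_semi_sigma_additive : semi_sigma_additive km.
Proof.
move=> F mF tF mUF.
have -> : km (\bigcup_n F n) = \sum_(n <oo) km (F n).
  rewrite /kernel_measure -integral_nneseries//; last first.
    by move=> n; exact: measurable_kernel_xsection.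
  apply: eq_integral => x _; rewrite xsection_bigcup.
  apply: measure_semi_bigcup => //.
  - by move=> n; exact: measurable_xsection.
  - exact: trivIset_xsection.
  - by apply: bigcupT_measurable => n; exact: measurable_xsection.
by apply: is_cvg_nneseries => n _ _; exact: kernel_measure_ge0.
Qed.

HB.instance Definition _ := isMeasure.Build _ _ _ km
  kernel_measure0 kernel_measure_ge0 kernel_measure_semi_sigma_additive.

Lemma integral_kernel_measure (f : X * Y -> \bar R) :
  (forall z, 0 <= f z) -> measurable_fun setT f ->
  \int[km]_z f z = \int[m]_x \int[k x]_y f (x, y).
Proof.
move=> f0 mf.
have indic (A : set (X * Y)) : measurable A ->
    \int[km]_z (\1_A z)%:E = \int[m]_x \int[k x]_y (\1_A (x, y))%:E.
  move=> mA; rewrite integral_indic// setIT; apply: eq_integral => x _.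
  rewrite (_ : (fun y => _) = (fun y => (\1_(xsection A x) y)%:E)); last first.
    by apply/funext => y; rewrite !indicE mem_xsection.
  by rewrite integral_indic ?setIT//; exact: measurable_xsection.
have mindic (A : set (X * Y)) (r : R) : measurable A ->
    measurable_fun setT (fun z => (r * \1_A z)%:E).
  move=> mA; apply/measurable_EFinP; apply: measurable_funM; first exact: measurable_cst.
  exact: measurable_indic.
have sfun (h : {nnsfun (X * Y) >-> R}) :
    \int[km]_z (h z)%:E = \int[m]_x \int[k x]_y (h (x, y))%:E.
  pose F r z := (r * \1_(h @^-1` [set r]) z)%:E.
  have mF r : measurable_fun setT (F r) by exact: mindic.
  have F0 r z : 0 <= F r z by rewrite /F EFinM nnfun_muleindic_ge0.
  have hF z : (h z)%:E = \sum_(r \in range h) F r z.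
    by rewrite fimfunE -fsumEFin.
  transitivity (\sum_(r \in range h) \int[km]_z F r z).
    by rewrite -ge0_integral_fsum//; apply: eq_integral => z _; exact: hF.
  transitivity (\int[m]_x \sum_(r \in range h) \int[k x]_y F r (x, y)); last first.
    apply: eq_integral => x _; rewrite -ge0_integral_fsum//.
      by apply: eq_integral => y _; rewrite hF.
    by move=> r; exact: measurableT_comp.
  rewrite ge0_integral_fsum//; last 2 first.
    - by move=> r; exact: (measurable_kernel_integral kfin (F0 r) (mF r)).
    - by move=> r x _; apply: integral_ge0.
  apply: eq_fsbigr => r /set_mem[z _ hzr].
  have r0 : (0 <= r)%R by rewrite -hzr.
  pose A := h @^-1` [set r].
  have mA : measurable A.
    rewrite -[A]setTI; have mh : measurable_fun setT h by [].
    exact: (mh measurableT _ (measurable_set1 r)).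
  transitivity (r%:E * \int[km]_z (\1_A z)%:E).
    by rewrite -ge0_integralZl//; apply/measurable_EFinP; exact: measurable_indic.
  rewrite indic//.
  have mk : measurable_fun setT
      (fun x => \int[k x]_y (\1_A (x, y))%:E).
    apply: (@measurable_kernel_integral _ _ _ _ _ k kfin (fun z => (\1_A z)%:E)).
      by move=> w; rewrite lee_fin.
    by apply/measurable_EFinP; exact: measurable_indic.
  rewrite -ge0_integralZl//; last by move=> x _; apply: integral_ge0 => y _; rewrite lee_fin.
  apply: eq_integral => x _; rewrite -ge0_integralZl//.
  apply/measurable_EFinP.
  rewrite (_ : (fun y => \1_A (x, y)) = \1_(xsection A x)).
    by apply: measurable_indic; exact: measurable_xsection.
  by apply/funext => y; rewrite !indicE mem_xsection.
pose f_ := nnsfun_approx measurableT mf.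
have fE z : f z = limn (fun n => (f_ n z)%:E).
  by apply/esym/cvg_lim => //; exact: cvg_nnsfun_approx.
have nd z : nondecreasing_seq (fun n => (f_ n z)%:E).
  by move=> a b ab; rewrite lee_fin; exact/lefP/nd_nnsfun_approx.
have mf_ n : measurable_fun setT (fun z => (f_ n z)%:E) by exact/measurable_EFinP.
have mfx_ n x : measurable_fun setT (fun y => (f_ n (x, y))%:E).
  exact: (measurableT_comp (mf_ n)).
transitivity (\int[km]_z limn (fun n => (f_ n z)%:E)).
  by apply: eq_integral => z _; exact: fE.
rewrite monotone_convergence//; last by move=> n z _; rewrite lee_fin.
rewrite (funext (fun n => sfun (f_ n))) -monotone_convergence//; last 3 first.
- move=> n; apply: (@measurable_kernel_integral _ _ _ _ _ k kfin (fun z => (f_ n z)%:E)) => //.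
  by move=> z; rewrite lee_fin.
- by move=> n x _; apply: integral_ge0 => y _; rewrite lee_fin.
- move=> x _ a b ab; apply: ge0_le_integral => //; last by move=> y _; exact: nd.
  by move=> y _; rewrite lee_fin.
apply: eq_integral => x _; rewrite -monotone_convergence//.
- by apply: eq_integral => y _; rewrite fE.
- by move=> n y _; rewrite lee_fin.
Qed.
End KernelMeasure.

Lemma integral_mrestr_sub d (T : measurableType d) (R : realType)
    (m : {measure set T -> \bar R}) (D : set T) (mD : measurable D) (f : T -> \bar R) :
  (\int[mrestr m mD]_(x in D) f x = \int[m]_(x in D) f x)%E.
Proof.
by apply: eq_measure_integral => A mA AD; rewrite /= /mrestr setIidl.
Qed.

Lemma ge0_integral_mrestr d (T : measurableType d) (R : realType)
    (m : {measure set T -> \bar R}) (D : set T) (mD : measurable D) (f : T -> \bar R) :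
  (forall x, 0 <= f x)%E -> measurable_fun setT f ->
  (\int[mrestr m mD]_x f x = \int[m]_(x in D) f x)%E.
Proof.
move=> f0 mf; rewrite -(integral_mrestr_sub m mD).
rewrite (@ge0_negligible_integral _ _ _ (mrestr m mD) setT (~` D))//.
- by rewrite setTD setCK.
- exact: measurableC.
- by rewrite /= /mrestr setICl measure0.
Qed.

(** * Measurable families of signed measures *)

Section LBMFamily.
Context {R : realType} {X : normedModType R} {I : finType} (co : I -> X -> R).
Hypothesis coP : coordinates co.
Context {d : measure_display} {L : measurableType d}.
Implicit Types (nus : L -> lbmeasure X) (B D : set X) (J : set L).

Definition lbm_family nus :=
  forall B, bounded_borel B -> measurable_fun setT (fun t => nus t B).

Lemma lbm_family_opp nus : lbm_family nus -> lbm_family (fun t => lbm_opp (nus t)).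
Proof. by move=> mnu B bB; apply: measurableT_comp => //; exact: mnu. Qed.

Lemma measurable_lbm_pos nus B : lbm_family nus -> bounded_borel B ->
  measurable_fun setT (fun t => lbm_pos (nus t) B).
Proof.
move=> mnu bB.
(* An enumeration of the countable family. Codes that decode to nothing give [set0], whose value 0
   does not alter the supremum. *)
pose S n := if unpickle n is Some s then nor_box co s else set0.
have mS n : borel_set (S n).
  rewrite /S; case: unpickle => [s|]; first exact: measurable_nor_box.
  exact: measurable0.
rewrite (_ : (fun t => _) = (fun t => esups (fun n => (nus t (B `&` S n))%:E) 0)).
  apply: measurable_fun_esups => n; apply/measurable_EFinP; apply: mnu.
  exact: bounded_borelI.
apply/funext => t; rewrite (lbm_pos_nor_box coP _ bB) /esups/=.
apply/eqP; rewrite eq_le; apply/andP; split; apply: ge_ereal_sup.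
  move=> _ [s _ <-]; apply: ereal_sup_ubound; exists (pickle s) => //=.
  by rewrite /S pickleK.
move=> _ [n _ <-]; rewrite -(lbm_pos_nor_box coP _ bB).
by apply: lbm_pos_ge; [exact: bounded_borelI|exact: subIsetl].
Qed.

Section PosKernel.
Context (nus : L -> lbmeasure X) (nusP : lbm_family nus) (B : set X)
  (bB : bounded_borel B).

Let mB : measurable (B : set (borel X)) := bB.1.

(** Restriction to the bounded set [B] makes the kernel finite. The two proofs are arguments so that
    the kernel structure can be attached to the term. *)
Definition pos_kernel (_ : coordinates co) (_ : lbm_family nus) (t : L) :
  {measure set (borel X) -> \bar R} := mrestr (lbm_pos (nus t)) mB.

Let measurable_pos_kernel (U : set (borel X)) :
  measurable U -> measurable_fun setT (pos_kernel coP nusP ^~ U).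
Proof.
by move=> mU; apply: measurable_lbm_pos => //; rewrite setIC; exact: bounded_borelI.
Qed.

HB.instance Definition _ := isKernel.Build _ _ L (borel X) R (pos_kernel coP nusP)
  measurable_pos_kernel.

Lemma pos_kernel_finite t : (pos_kernel coP nusP t setT < +oo)%E.
Proof.
by rewrite /= /mrestr setTI -ge0_fin_numE ?lbm_pos_ge0//; exact: lbm_pos_finite.
Qed.

End PosKernel.

Lemma measurable_lbm_pos_integral nus D (bD : bounded_borel D) J
    (f : L * borel X -> \bar R) :
  lbm_family nus -> measurable J -> (forall z, 0 <= f z)%E ->
  measurable_fun (J `*` D : set (L * borel X)) f ->
  measurable_fun J (fun t => \int[lbm_pos (nus t)]_(x in D) f (t, x))%E.
Proof.
move=> nusP mJ f0 mf; have mD : measurable (D : set (borel X)) by case: bD.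
have mJD : measurable (J `*` D : set (L * borel X)) by exact: measurableX.
pose g := f \_ (J `*` D : set (L * borel X)).
have mg : measurable_fun setT g := (measurable_restrictT f mJD).1 mf.
have g0 z : (0 <= g z)%E by rewrite /g patchE; case: ifP.
apply: (eq_measurable_fun (fun t => \int[pos_kernel bD coP nusP t]_x g (t, x))%E).
  move=> t /set_mem Jt; rewrite -(integral_mrestr_sub _ bD.1) [RHS]integral_mkcond.
  apply: eq_integral => x _; rewrite /g !patchE in_setX (mem_set Jt)//.
apply: measurable_funTS; apply: (measurable_kernel_integral (k := pos_kernel bD coP nusP)) => //.
exact: pos_kernel_finite.
Qed.

Lemma measurable_lbm_integral nus D (bD : bounded_borel D) J
    (f : L * borel X -> R) :
  lbm_family nus -> measurable J ->
  measurable_fun (J `*` D : set (L * borel X)) f ->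
  measurable_fun J (fun t => lbm_integral (nus t) D (fun x => f (t, x))).
Proof.
move=> nusP mJ mf.
have mI nus' : lbm_family nus' ->
    measurable_fun J (fun t => \int[lbm_pos (nus' t)]_(x in D) f (t, x)).
  move=> nus'P; rewrite /Rintegral.
  apply: (measurableT_comp (f := fine)); first exact: fine_measurable.
  rewrite (_ : (fun t => _) = (fun t =>
     \int[lbm_pos (nus' t)]_(x in D) (fun z => (f z)%:E)^\+ (t, x) -
     \int[lbm_pos (nus' t)]_(x in D) (fun z => (f z)%:E)^\- (t, x))%E); last first.
    apply/funext => t; rewrite [LHS]integralE; congr (_ - _)%E;
      by apply: eq_integral => x _; rewrite ?funeposE ?funenegE.
  have mfE : measurable_fun (J `*` D : set (L * borel X)) (fun z => (f z)%:E).
    exact/measurable_EFinP.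
  apply: emeasurable_funB.
  - by apply: measurable_lbm_pos_integral => //; exact: measurable_funepos.
  - by apply: measurable_lbm_pos_integral => //; exact: measurable_funeneg.
apply: measurable_funB; first exact: mI.
exact: (mI _ (lbm_family_opp nusP)).
Qed.

End LBMFamily.

Section SliceMeasure.
Context {R : realType} {d : nat}.
Local Notation E := 'rV[R]_d.
Local Notation L := (lebesgueType R).

(** Transports measures from the product sigma-algebra with Lebesgue measurable times, where kernels
    are integrated, to the Borel sigma-algebra of R^d x R, where [mu] is given. *)
Definition swap_time (z : L * borel E) : borel (E * R)%type := (z.2, z.1).

Lemma lebesgue_type_borel (A : set R) : measurable A -> measurable (A : set L).
Proof. exact: sub_caratheodory. Qed.

Lemma measurable_swap_time : measurable_fun setT swap_time.
Proof.
have coX := @coordinates_spacetime R d.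
apply: (@measurability _ _ _ (borel (E * R)%type) _ _ (range (rat_box (@co_spacetime R d)))).
  apply/seteqP; split; first exact: borel_rat_boxes.
  apply: smallest_sub; first exact: sigma_algebra_measurable.
  by move=> _ [q _ <-]; exact: measurable_rat_box.
move=> _ [_ [q _ <-] <-]; rewrite setTI.
pose qE : {ffun 'I_d -> rat * rat} := [ffun i => q (Some i)].
pose c : R := ratr (q None).1; pose r : R := ratr (q None).2.
rewrite (_ : _ @^-1` _ = (`]c - r, c + r[%classic : set L) `*`
    (rat_box (@co_space R d) qE : set (borel E))).
  apply: measurableX; first by apply: lebesgue_type_borel.
  by apply: measurable_rat_box; exact: coordinates_space.
apply/seteqP; split=> -[t x] /=.
  move=> h; split; last by move=> i /=; rewrite ffunE; exact: (h (Some i)).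
  by rewrite in_itv/=; have /= := h None; rewrite -/c -/r ltr_distl.
rewrite in_itv/= -ltr_distl => -[h1 h2] [i|]; last exact: h1.
by have := h2 i; rewrite /= ffunE.
Qed.

Lemma measurable_slice (A : set (borel (E * R)%type)) (t : R) :
  measurable A -> measurable (ysection A t : set (borel E)).
Proof.
move=> mA; have := measurable_swap_time measurableT mA; rewrite setTI.
move=> /(@measurable_xsection _ _ L (borel E) _ t).
by rewrite (_ : xsection _ _ = ysection A t)//; apply/seteqP; split=> x; rewrite /xsection/ysection/= !inE.
Qed.

Context (nus : L -> lbmeasure E) (nusP : lbm_family nus).
Context (D : set E) (bD : bounded_borel D) (J : set L) (mJ : measurable J).

(* The measure with slices [mu_t^+] restricted to [D], for [t] in [J]. *)
Definition slice_measure : {measure set (borel (E * R)%type) -> \bar R} :=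
  measure_function_pushforward__canonical__measure_function_Measure
    (kernel_measure (k := pos_kernel bD (@coordinates_space R d) nusP) (mrestr leb mJ) (pos_kernel_finite (@coordinates_space R d) nusP bD)) measurable_swap_time.

Let mD : measurable (D : set (borel E)) := bD.1.

Lemma preimage_swap_time (A : set (borel (E * R)%type)) :
  measurable A -> measurable (swap_time @^-1` A).
Proof. by move=> mA; have := measurable_swap_time measurableT mA; rewrite setTI. Qed.

Lemma xsection_swap_time (A : set (E * R)) t :
  xsection (swap_time @^-1` A) t = ysection A t.
Proof. by apply/seteqP; split=> x; rewrite /xsection/ysection/= !inE. Qed.

Lemma measurable_slice_pos (A : set (borel (E * R)%type)) : measurable A ->
  measurable_fun setT (fun t : L => lbm_pos (nus t) (ysection A t `&` D)).
Proof.
move=> mA; have := measurable_kernel_xsection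
  (pos_kernel_finite (@coordinates_space R d) nusP bD) (preimage_swap_time mA).
by apply: eq_measurable_fun => t _; rewrite /= /mrestr xsection_swap_time.
Qed.

Lemma slice_measureE (A : set (borel (E * R)%type)) : measurable A ->
  slice_measure A = (\int[leb]_(t in J) lbm_pos (nus t) (ysection A t `&` D))%E.
Proof.
move=> mA; rewrite /slice_measure/= /pushforward /kernel_measure.
rewrite ge0_integral_mrestr; last 2 first.
- by [].
- exact: (measurable_kernel_xsection (pos_kernel_finite _ nusP bD) (preimage_swap_time mA)).
by apply: eq_integral => t _; rewrite /= /mrestr xsection_swap_time.
Qed.

Lemma integral_slice_measure (f : borel (E * R)%type -> \bar R) :
  (forall z, 0 <= f z)%E -> measurable_fun setT f ->
  (\int[slice_measure]_z f z =
   \int[leb]_(t in J) \int[lbm_pos (nus t)]_(x in D) f (x, t))%E.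
Proof.
move=> f0 mf; rewrite ge0_integral_pushforward//; last exact: measurable_swap_time.
rewrite preimage_setT.
have mfs : measurable_fun setT (f \o swap_time).
  by apply: measurableT_comp => //; exact: measurable_swap_time.
rewrite integral_kernel_measure; [|by move=> z; exact: f0|exact: mfs].
rewrite ge0_integral_mrestr; last 2 first.
- by move=> t; apply: integral_ge0 => x _; exact: f0.
- apply: (@measurable_kernel_integral _ _ _ _ _ _ (pos_kernel_finite _ nusP bD) (f \o swap_time)).
  + by move=> z; exact: f0.
  + exact: mfs.
apply: eq_integral => t _; rewrite ge0_integral_mrestr; first by [].
- by move=> x; exact: f0.
- exact: (measurableT_comp mfs (@pair1_measurable _ _ L (borel E) t)).
Qed.

End SliceMeasure.

(** * Disintegration *)

Section SliceComparison.
Context {R : realType} {d : nat}.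
Local Notation E := 'rV[R]_d.
Local Notation L := (lebesgueType R).

(** Sets of times defined through the slices are only Lebesgue measurable, whereas a subset of R^d x
    R must be Borel before [mu] is evaluated on it; a null set of times makes up the difference. *)
Lemma lebesgue_type_borel_approx (A : set L) : measurable A ->
  exists B : set R, measurable B /\ {ae leb, forall t : L, A t <-> B t}.
Proof.
move=> mA.
have : (completed_algebra_gen (@lebesgue_measure R)).-sigma.-measurable A.
  by rewrite completed_caratheodory_measurable.
rewrite g_sigma_completed_algebra_genE => -[B mB [N [M [mM M0 NM]] BNA]].
exists B; split => //; exists M; split => //; first exact: lebesgue_type_borel.
move=> t /= nAB; apply: NM; apply: contrapT => nN; apply: nAB.
by rewrite -BNA; split=> [[//|/nN]|Bt] //; left.
Qed.

Context (nus : L -> lbmeasure E) (nusP : lbm_family nus).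
Context (D : set E) (bD : bounded_borel D) (J : set L) (mJ : measurable J).
Implicit Types A C Q : set (borel (E * R)%type).

Lemma ysection_bounded A (t : R) : measurable A -> ysection A t `<=` D ->
  bounded_borel (ysection A t).
Proof.
by move=> mA AD; apply: (bounded_borelS _ AD bD); exact: measurable_slice.
Qed.

Lemma measurable_slice_lbm A : measurable A -> (forall t : R, ysection A t `<=` D) ->
  measurable_fun setT (fun t : L => nus t (ysection A t)).
Proof.
move=> mA AD.
rewrite (_ : (fun t => _) = (fun t : L => fine (lbm_pos (nus t) (ysection A t `&` D)) -
    fine (lbm_pos (lbm_opp (nus t)) (ysection A t `&` D)))); last first.
  by apply/funext => t; rewrite setIidl// (lbm_jordan_fine _ (ysection_bounded mA (AD t))).
apply: measurable_funB; (apply: (measurableT_comp (f := fine)); first exact: fine_measurable).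
  exact: (measurable_slice_pos nusP bD mA).
exact: (measurable_slice_pos (lbm_family_opp nusP) bD mA).
Qed.

Lemma slice_lbm_le A (t : L) : measurable A -> ysection A t `<=` D ->
  (`|nus t (ysection A t)|%:E <= lbm_tv (nus t) D)%E.
Proof.
move=> mA AD; have bA := ysection_bounded mA AD.
rewrite lbm_tvE -abse_EFin (lbm_jordan _ bA).
apply: le_trans (lee_abs_sub _ _) _.
rewrite !gee0_abs ?lbm_pos_ge0// leeD//.
  by apply: (le_measure (lbm_pos (nus t))); rewrite ?inE//; [exact: bA.1|exact: bD.1].
by apply: (le_measure (lbm_neg (nus t))); rewrite ?inE//; [exact: bA.1|exact: bD.1].
Qed.

Hypothesis nus_int : leb.-integrable J (fun t => lbm_tv (nus t) D).

Lemma integrable_slice_lbm A : measurable A -> (forall t : R, ysection A t `<=` D) ->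
  leb.-integrable J (fun t => (nus t (ysection A t))%:E).
Proof.
move=> mA AD; apply: (le_integrable mJ _ _ nus_int).
  apply/measurable_EFinP; apply: measurable_funTS; exact: measurable_slice_lbm.
move=> t _; rewrite abse_EFin [leRHS]gee0_abs//; exact: slice_lbm_le.
Qed.

Context (mu : lbmeasure (E * R)%type) (Q : set (borel (E * R)%type)).
Hypothesis bQ : bounded_borel (Q : set (E * R)).
Hypothesis QD : forall t : R, ysection Q t `<=` D.
Hypothesis mu_slice : forall A, measurable A -> A `<=` Q ->
  mu A = \int[leb]_(t in J) nus t (ysection A t).

Lemma ysection_sub A (t : R) : A `<=` Q -> ysection A t `<=` D.
Proof.
by move=> AQ x xA; apply: (@QD t); move: xA; rewrite /ysection/= !inE; exact: AQ.
Qed.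

(* Glue the slices of [C1] and [C2] along the set of times where
   [nus t] prefers the former. *)
Lemma slice_glue C1 C2 : measurable C1 -> measurable C2 -> C1 `<=` Q -> C2 `<=` Q ->
  exists C, [/\ measurable C, C `<=` C1 `|` C2 & {ae leb, forall t : L,
    nus t (ysection C t) = Num.max (nus t (ysection C1 t)) (nus t (ysection C2 t))}].
Proof.
move=> mC1 mC2 C1Q C2Q.
pose g (C : set (borel (E * R)%type)) (t : L) := nus t (ysection C t).
have mg C : measurable C -> C `<=` Q -> measurable_fun setT (g C).
  by move=> mC CQ; apply: measurable_slice_lbm => // t; exact: ysection_sub.
have [B [mB BE]] : exists B : set R, measurable B /\
    {ae leb, forall t : L, g C2 t <= g C1 t <-> B t}.
  apply: lebesgue_type_borel_approx.
  have := measurable_fun_ler (mg _ mC2 C2Q) (mg _ mC1 C1Q).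
  by move=> /(_ measurableT [set true]); rewrite setTI; apply.
have mB' : measurable ([set z | B z.2] : set (borel (E * R)%type)).
  have csnd : continuous (snd : E * R -> R) by move=> z; exact: cvg_snd.
  by have := continuous_borel_real (D := setT) csnd measurableT mB; rewrite setTI.
exists ((C1 `&` [set z | B z.2]) `|` (C2 `\` [set z | B z.2])); split.
- by apply: measurableU; [exact: measurableI|exact: measurableD].
- by move=> z [[]|[]]; [left|right].
apply: filterS BE => t tB.
have [Bt|nBt] := pselect (B t).
  rewrite (_ : ysection _ t = ysection C1 t).
    by have /max_idPl -> := tB.2 Bt.
  by apply/seteqP; split=> x; rewrite /ysection/= !inE/=; tauto.
rewrite (_ : ysection _ t = ysection C2 t).
  have /negP : ~ (g C2 t <= g C1 t) by move=> /tB.1.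
  by rewrite -ltNge => /ltW/max_idPr ->.
by apply/seteqP; split=> x; rewrite /ysection/= !inE/=; tauto.
Qed.

(** The maximum [h n] of 0 and of the values of [nus t] on the first [n] candidates is attained, for
    almost every [t], by the slices of one Borel set [C] in [A]. Its integral is therefore
    [mu C <= mu^+ A], and [h n] increases to the upper variation of the slice. *)
Lemma slice_measure_le A : measurable A -> A `<=` Q ->
  (slice_measure nusP bD mJ A <= lbm_pos mu A)%E.
Proof.
move=> mA AQ; have coP := @coordinates_space R d.
have bA : bounded_borel (A : set (E * R)) by exact: (bounded_borelS mA AQ bQ).
pose S n : set E := if unpickle n is Some s then nor_box (@co_space R d) s else set0.
have mS n : measurable (S n : set (borel E)).
  rewrite /S; case: unpickle => [s|]; last exact: measurable0.
  exact: measurable_nor_box.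
pose AS n : set (borel (E * R)%type) := A `&` [set z | S n z.1].
have mAS n : measurable (AS n).
  apply: measurableI => //.
  have cfst : continuous (fst : E * R -> E) by move=> z; exact: cvg_fst.
  by have := continuous_borel (D := setT) cfst measurableT (mS n); rewrite setTI.
have ASA n : AS n `<=` A by move=> z [].
have yAS n t : ysection (AS n) t = ysection A t `&` S n.
  by apply/seteqP; split=> x; rewrite /ysection/= !inE.
pose h := fix h n (t : L) : R := if n is m.+1 then
  Num.max (h m t) (nus t (ysection (AS m) t)) else 0.
have hC n : exists C, [/\ measurable C, C `<=` A & {ae leb, forall t : L,
    nus t (ysection C t) = h n t}].
  elim: n => [|n [C [mC CA CE]]].
    exists set0; split => //.
    by apply: aeW => t; rewrite ysection0 lbm_set0.
  have [C' [mC' C'CA C'E]] := slice_glue mC (mAS n) (subset_trans CA AQ)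
    (subset_trans (ASA n) AQ).
  exists C'; split => //.
    by move=> z /C'CA[/CA|/ASA].
  by apply: filterS2 C'E CE => t -> ->.
have bAt (t : R) : bounded_borel (ysection A t).
  by apply: ysection_bounded => //; exact: ysection_sub.
have h0 n t : 0 <= h n t.
  by elim: n => //= n IH; rewrite le_max IH.
have h_le n t : ((h n t)%:E <= lbm_pos (nus t) (ysection A t `&` D))%E.
  rewrite setIidl; last exact: ysection_sub.
  elim: n => [|n IH]; first exact: lbm_pos_ge0.
  rewrite /= EFin_max ge_max IH/= yAS; apply: lbm_pos_ge; last exact: subIsetl.
  exact: (bounded_borelI (bAt t) (mS n)).
have mh n : measurable_fun setT (h n).
  elim: n => [|n IH]; first exact: measurable_cst.
  apply: measurable_maxr; first exact: IH.
  apply: (measurable_slice_lbm (mAS n)) => t.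
  by apply: ysection_sub; exact: (subset_trans (ASA n)).
have ndh t : nondecreasing_seq (fun n => (h n t)%:E).
  by apply/nondecreasing_seqP => n; rewrite lee_fin /= le_max lexx.
rewrite slice_measureE//.
rewrite (eq_integral (fun t => limn (fun n => (h n t)%:E))); last first.
  move=> t _; apply/esym/cvg_lim => //.
  rewrite (_ : lbm_pos _ _ = ereal_sup (range (fun n => (h n t)%:E))).
    exact: ereal_nondecreasing_cvgn.
  apply/eqP; rewrite eq_le; apply/andP; split; last first.
    by apply: ge_ereal_sup => _ [n _ <-]; exact: h_le.
  rewrite setIidl; last exact: ysection_sub.
  rewrite (lbm_pos_nor_box coP _ (bAt t)); apply: ge_ereal_sup => _ [s _ <-].
  apply: le_trans (ereal_sup_ubound _); last by exists (pickle s).+1.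
  by rewrite lee_fin /= yAS /S pickleK le_max lexx orbT.
have mhE n : measurable_fun J (fun t => (h n t)%:E).
  by apply/measurable_EFinP; exact: measurable_funTS.
have h0E n t : J t -> (0 <= (h n t)%:E)%E by rewrite lee_fin.
have ndhE t : J t -> nondecreasing_seq (fun n => (h n t)%:E) by move=> _; exact: ndh.
rewrite (monotone_convergence leb mJ mhE h0E ndhE).
apply: lime_le.
  apply: ereal_nondecreasing_is_cvgn => m n mn.
  by apply: (ge0_le_integral leb mJ (h0E m) (mhE m) (mhE n)) => t _; exact: ndh.
apply: nearW => n; have [C [mC CA CE]] := hC n.
have CQ := subset_trans CA AQ.
apply: le_trans (lbm_pos_ge mu (bounded_borelS mC CA bA) CA).
have iC := integrable_slice_lbm mC (fun t => @ysection_sub C t CQ).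
rewrite (mu_slice mC CQ) /Rintegral fineK; last exact: (integrable_fin_num mJ iC).
suff -> : (\int[leb]_(t in J) (h n t)%:E = \int[leb]_(t in J) (nus t (ysection C t))%:E)%E.
  exact: lexx.
apply: (ae_eq_integral _ _ mJ (mhE n) (measurable_int leb iC)).
by apply: filterS CE => t /= <-.
Qed.
End SliceComparison.

Lemma subr_eq_swap (V : zmodType) (a b c e : V) : a - b = c - e -> c + b = e + a.
Proof. by move=> /eqP; rewrite subr_eq addrAC eq_sym subr_eq => /eqP ->; rewrite addrC. Qed.

Lemma continuous_pair_cst (U V : topologicalType) (v : V) : continuous (fun u : U => (u, v)).
Proof. move=> x; apply: (cvg_pair (f := id) (g := fun=> v)); first exact: cvg_id. exact: cvg_cst. Qed.

Lemma lbm_tv_opp (R : realType) (X : normedModType R) (mu : lbmeasure X) (A : set (borel X)) :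
  lbm_tv (lbm_opp mu) A = lbm_tv mu A.
Proof.
rewrite !lbm_tvE addeC; congr (_ + _)%E.
rewrite /lbm_neg /lbm_pos; congr ereal_sup; apply: eq_imagel => B _ /=.
by rewrite opprK.
Qed.

Section ClosedBox.
Context {R : realType} {X : normedModType R} {I : finType} (co : I -> X -> R).
Hypothesis coP : coordinates co.

Definition closed_box (p : I -> R * R) : set X :=
  [set z | forall i, `|co i z - (p i).1| <= (p i).2].

Lemma closed_box_closed p : closed (closed_box p).
Proof.
rewrite (_ : closed_box p = \bigcap_(i in setT)
    (fun z => `|co i z - (p i).1|) @^-1` [set r | r <= (p i).2]); last first.
  by apply/seteqP; split=> z h i; [move=> _|]; exact: (h i).
apply: closed_bigI => i _; apply: closed_comp; last exact: closed_le.
move=> y _; apply: (@continuous_comp _ _ _ (fun y => co i y - (p i).1) (fun r => `|r|)).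
  by apply: continuousB; [exact: (coordinate_continuous coP)|exact: cst_continuous].
exact: norm_continuous.
Qed.

Lemma closed_box_compact p : compact (closed_box p).
Proof.
pose M := \sum_i (`|(p i).1| + `|(p i).2|).
have M0 : 0 <= M by rewrite sumr_ge0.
have [_ _ /(_ _ M0) cM] := coP.
apply: (subclosed_compact (@closed_box_closed p) cM) => z zp i.
rewrite -[X in `|X| <= _](subrK (p i).1).
apply: le_trans (ler_normD _ _) _; rewrite addrC /M (bigD1 i)//= -addrA.
rewrite lerD2l (le_trans (zp i))// (le_trans (ler_norm _))// lerDl.
by rewrite sumr_ge0.
Qed.

Lemma bumps_supp_sub m p l :
  closure [set z | bumps co m (p :: l) z != 0] `<=` closed_box p.
Proof.
rewrite [X in _ `<=` X]((closure_id _).1 (@closed_box_closed p)).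
apply: closure_subset => z /= zn0 i; apply: ltW.
suff : boxes co (p :: l) z by rewrite boxes_cons => -[+ _]; exact.
by apply: contrapT => /bumps_support z0; rewrite z0 eqxx in zn0.
Qed.

End ClosedBox.

(** * A measure and its slices inside the open strip *)

Section PatchedFamily.
Context {R : realType} {d : nat} (T : R).
Local Notation E := 'rV[R]_d.
Local Notation L := (lebesgueType R).
Context (mu : lbmeasure (E * R)%type) (mus : R -> lbmeasure E).

(* [lbm_sub m m] is the zero measure. *)
Definition patched (t : L) : lbmeasure E :=
  if t \in `[0, T] then mus t else lbm_sub (mus 0) (mus 0).

Hypothesis mu_mus : given_by T mu mus.

Let J : set L := `[0, T].

Lemma measurable_J : measurable J.
Proof. by apply: lebesgue_type_borel; exact: measurable_itv. Qed.

Lemma lbm_family_patched : lbm_family patched.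
Proof.
move=> B bB; rewrite (_ : (fun t => _) = (fun t => mus t B) \_ J); last first.
  apply/funext => t; rewrite /patched patchE /J mem_setE.
  by case: ifP => // _; rewrite /= subrr.
have [mB _ _] := mu_mus.
by apply: (measurable_restrictT _ measurable_J).1; exact: mB.
Qed.

Lemma patchedE t : J t -> patched t = mus t.
Proof. by rewrite /J /= /patched => ->. Qed.

Lemma integrable_patched_tv D : bounded_borel D ->
  leb.-integrable J (fun t => lbm_tv (patched t) D).
Proof.
move=> bD; have [mD [K cK DK]] := bD; have [_ /(_ K cK) iK _] := mu_mus.
apply: (le_integrable measurable_J _ _ iK).
  apply: measurable_funTS.
  rewrite (_ : (fun t => _) = (fun t => lbm_pos (patched t) D +
      lbm_pos (lbm_opp (patched t)) D)%E); last by apply/funext => t; rewrite lbm_tvE.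
  apply: emeasurable_funD.
    exact: (measurable_lbm_pos (@coordinates_space R d) lbm_family_patched bD).
  exact: (measurable_lbm_pos (@coordinates_space R d) (lbm_family_opp lbm_family_patched) bD).
move=> t Jt; rewrite patchedE// !gee0_abs//.
apply: (le_measure (lbm_tv (mus t))) => //; rewrite inE//.
exact: (compact_bounded_borel cK).1.
Qed.

Section InsideStrip.
Context (q : 'I_d -> R * R) (c r : R).
Hypotheses (cr0 : 0 < c - r) (crT : c + r < T).

Let p (i : option 'I_d) : R * R := if i is Some j then q j else (c, r).
Let D : set E := box (@co_space R d) q.
Let Q : set (E * R) := box (@co_spacetime R d) p.
Let coE := @coordinates_space R d.
Let coX := @coordinates_spacetime R d.
Let bD : bounded_borel D := box_bounded_borel coE q.
Let bQ : bounded_borel Q := box_bounded_borel coX p.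

Lemma ysection_strip_box (t : R) : ysection Q t `<=` D.
Proof.
by move=> x; rewrite /ysection/= inE => h j; exact: (h (Some j)).
Qed.

Lemma strip_box_time x t : Q (x, t) -> 0 < t < T.
Proof.
move=> /(_ None) /=; rewrite ltr_distl => /andP[h1 h2].
by rewrite (lt_trans cr0 h1) (lt_trans h2 crT).
Qed.

Lemma test_function_bumps m l :
  test_function T (bumps (@co_spacetime R d) m (p :: l)).
Proof.
have cs := bumps_supp_sub coX (m := m) (p := p) (l := l).
split.
- exact/flat_algebra_smooth/flat_algebra_bumps.
- apply: subclosed_compact cs; first exact: closed_closure.
  exact: closed_box_compact.
- move=> [x t] /cs /(_ None) /=; rewrite ler_distl => /andP[h1 h2]; split => //=.
  by rewrite in_itv/= (lt_le_trans cr0 h1) (le_lt_trans h2 crT).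
Qed.

Let nusP := lbm_family_patched.
Let Lp := slice_measure nusP bD measurable_J.
Let Ln := slice_measure (lbm_family_opp nusP) bD measurable_J.

Lemma bumps_outside m l (z : E * R) :
  ~ Q z -> bumps (@co_spacetime R d) m (p :: l) z = 0.
Proof. by move=> nQ; apply: bumps_support; rewrite boxes_cons => -[]. Qed.

Lemma integral_slice_bumps (nus : L -> lbmeasure E) (fP : lbm_family nus) m l :
  (\int[slice_measure fP bD measurable_J]_(z in Q)
      (bumps (@co_spacetime R d) m (p :: l) z)%:E =
   \int[leb]_(t in J) \int[lbm_pos (nus t)]_(x in D)
      (bumps (@co_spacetime R d) m (p :: l) (x, t))%:E)%E.
Proof.
rewrite -(@integral_slice_measure _ _ _ fP _ bD _ measurable_J
  (fun z => (bumps (@co_spacetime R d) m (p :: l) z)%:E)).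
- rewrite integral_mkcond; apply: eq_integral => z _; rewrite patchE.
  by case: ifPn => // /negP zQ; rewrite bumps_outside// => /mem_set.
- by move=> z; rewrite lee_fin bumps_ge0.
- by apply/measurable_EFinP; apply: continuous_borel_real; exact: continuous_bumps.
Qed.

Lemma slice_measure_fin (nus : L -> lbmeasure E) (fP : lbm_family nus) (A : set (borel (E * R)%type)) :
  measurable A -> leb.-integrable J (fun t => lbm_tv (nus t) D) ->
  (slice_measure fP bD measurable_J A < +oo)%E.
Proof.
move=> mA /integrableP[mtv tvoo]; rewrite slice_measureE//; apply: le_lt_trans tvoo.
apply: (ge0_le_integral leb measurable_J).
- by move=> t _; exact: lbm_pos_ge0.
- by apply: measurable_funTS; exact: (measurable_slice_pos fP bD mA).
- exact: (measurableT_comp (@abse_measurable R setT) mtv).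
- move=> t _; rewrite gee0_abs// lbm_tvE.
  apply: (@le_trans _ _ (lbm_pos (nus t) D)); last by rewrite leeDl// lbm_pos_ge0.
  apply: (le_measure (lbm_pos (nus t))); rewrite ?inE//; last exact: bD.1.
  by apply: measurableI; [exact: measurable_slice|exact: bD.1].
Qed.

Lemma integrable_slice_bumps (nus : L -> lbmeasure E) (fP : lbm_family nus) m l :
  leb.-integrable J (fun t => lbm_tv (nus t) D) ->
  leb.-integrable J (fun t => \int[lbm_pos (nus t)]_(x in D)
      (bumps (@co_spacetime R d) m (p :: l) (x, t))%:E)%E.
Proof.
move=> itv; have mJ := measurable_J.
have mb : measurable_fun setT (fun z : L * borel E =>
    (bumps (@co_spacetime R d) m (p :: l) (swap_time z))%:E).
  apply/measurable_EFinP; apply: measurableT_comp; last exact: measurable_swap_time.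
  by apply: continuous_borel_real; exact: continuous_bumps.
apply: (le_integrable mJ _ _ itv).
  apply: (measurable_lbm_pos_integral coE bD fP mJ
    (f := fun z : L * borel E => (bumps (@co_spacetime R d) m (p :: l) (swap_time z))%:E)).
    by move=> z; rewrite lee_fin bumps_ge0.
  exact: measurable_funTS.
move=> t _; rewrite [leRHS]gee0_abs// gee0_abs; last first.
  by apply: integral_ge0 => x _; rewrite lee_fin bumps_ge0.
apply: (@le_trans _ _ (\int[lbm_pos (nus t)]_(x in D) (cst 1 x))%E).
  apply: (ge0_le_integral (lbm_pos (nus t)) bD.1).
  - by move=> x _; rewrite lee_fin bumps_ge0.
  - by apply: measurable_funTS; exact: (measurableT_comp mb (@pair1_measurable _ _ L (borel E) t)).
  - exact: measurable_cst.
  - by move=> x _; rewrite lee_fin bumps_le1.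
by rewrite integral_cst ?mul1e ?lbm_tvE ?leeDl ?lbm_pos_ge0//; exact: bD.1.
Qed.

(** The bumps have the same integral with respect to [mu] and to the slices. Negative parts are
    moved across so that both sides are positive measures finite on [Q], to which uniqueness
    applies. The closed time interval of the box has to lie in []0, T[] for the bumps to be test
    functions. *)
Lemma strip_identity (A : set (borel (E * R)%type)) : measurable A -> A `<=` Q ->
  (Lp A + lbm_neg mu A = Ln A + lbm_pos mu A)%E.
Proof.
move=> mA AQ; have mJ := measurable_J.
have mQ : measurable (Q : set (borel (E * R)%type)) := bQ.1.
have ip := integrable_patched_tv bD.
have iN : leb.-integrable J (fun t => lbm_tv (lbm_opp (patched t)) D).
  by apply: eq_integrable ip => // t _; rewrite lbm_tv_opp.
have posQ := lbm_pos_finite mu bQ; have negQ := lbm_neg_finite mu bQ.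
have LpQ := slice_measure_fin nusP mQ ip.
have LnQ := slice_measure_fin (lbm_family_opp nusP) mQ iN.
suff : measure_add Lp (lbm_neg mu) A = measure_add Ln (lbm_pos mu) A.
  by rewrite !measure_addE.
apply: (@bumps_measure_unique _ _ _ (@co_spacetime R d) coX _ _ p _ _ _ A mA AQ).
- rewrite [X in (X < _)%E]measure_addE lte_add_pinfty//.
  by rewrite -ge0_fin_numE ?lbm_pos_ge0.
- rewrite [X in (X < _)%E]measure_addE lte_add_pinfty//.
  by rewrite -ge0_fin_numE ?lbm_pos_ge0.
move=> m l0; set l := map _ l0; set b := bumps _ m (p :: l).
have b0 z : (0 <= (b z)%:E)%E by rewrite lee_fin bumps_ge0.
have mb (S : set (borel (E * R)%type)) : measurable_fun S (fun z => (b z)%:E).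
  by apply/measurable_EFinP; apply: continuous_borel_real; exact: continuous_bumps.
rewrite [LHS](ge0_integral_measure_add Lp (lbm_neg mu) mQ (fun z _ => b0 z) (mb Q)).
rewrite [RHS](ge0_integral_measure_add Ln (lbm_pos mu) mQ (fun z _ => b0 z) (mb Q)).
rewrite /Lp /Ln !integral_slice_bumps.
set Ip := fun t : L => (\int[lbm_pos (patched t)]_(x in D) (b (x, t))%:E)%E.
set In := fun t : L => (\int[lbm_pos (lbm_opp (patched t))]_(x in D) (b (x, t))%:E)%E.
have iIp : leb.-integrable J Ip := integrable_slice_bumps nusP m l ip.
have iIn : leb.-integrable J In := integrable_slice_bumps (lbm_family_opp nusP) m l iN.
have bfin (m' : {measure set (borel (E * R)%type) -> \bar R}) : (m' Q < +oo)%E ->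
    (\int[m']_(z in Q) (b z)%:E)%E \is a fin_num.
  move=> m'Q; rewrite ge0_fin_numE; last by apply: integral_ge0 => z _; exact: b0.
  apply: (@le_lt_trans _ _ (\int[m']_(z in Q) (cst 1 z))%E).
    apply: (ge0_le_integral m' mQ (fun z _ => b0 z) (mb Q)); first exact: measurable_cst.
    by move=> z _; rewrite lee_fin bumps_le1.
  by rewrite integral_cst ?mul1e.
have sfin (nu : lbmeasure E) t :
    (\int[lbm_pos nu]_(x in D) (b (x, t))%:E)%E \is a fin_num.
  rewrite ge0_fin_numE; last by apply: integral_ge0 => x _; exact: b0.
  apply: (@le_lt_trans _ _ (\int[lbm_pos nu]_(x in D) (cst 1 x))%E).
    apply: (ge0_le_integral (lbm_pos nu) bD.1).
    - by move=> x _; exact: b0.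
    - apply/measurable_EFinP; apply: continuous_borel_real => x.
      apply: (@continuous_comp _ _ _ (fun x : E => (x, t)) b); last exact: continuous_bumps.
      exact: continuous_pair_cst.
    - exact: measurable_cst.
    - by move=> x _; rewrite lee_fin bumps_le1.
  rewrite integral_cst ?mul1e; last exact: bD.1.
  by rewrite -ge0_fin_numE ?lbm_pos_ge0//; exact: lbm_pos_finite.
have posf : (\int[lbm_pos mu]_(z in Q) (b z)%:E)%E \is a fin_num.
  by apply: bfin; rewrite -ge0_fin_numE ?lbm_pos_ge0.
have negf : (\int[lbm_neg mu]_(z in Q) (b z)%:E)%E \is a fin_num.
  by apply: bfin; rewrite -ge0_fin_numE ?lbm_pos_ge0.
have [_ _ /(_ b (test_function_bumps m l))] := mu_mus.
rewrite (@lbm_integral_support _ _ _ (Q : set (borel (E * R)%type)))//; last 2 first.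
- move=> [x t] /strip_box_time/andP[t0 tT]; split => //=.
  by rewrite in_itv/= !ltW.
- by move=> z _ nQ; exact: bumps_outside.
have fineI (I : L -> \bar R) : (forall t, I t \is a fin_num) -> leb.-integrable J I ->
    leb.-integrable J (EFin \o (fun t => fine (I t))).
  by move=> fI; apply: eq_integrable => // t _ /=; rewrite fineK.
have -> : \int[leb]_(t in J) lbm_integral (mus t) setT (fun x => b (x, t)) =
    \int[leb]_(t in J) (fine (Ip t) - fine (In t)).
  apply: eq_Rintegral => t /set_mem Jt; rewrite -patchedE//.
  rewrite (@lbm_integral_support _ _ _ (D : set (borel E)))//; first exact: bD.1.
  move=> x _ nD; apply: bumps_outside => Qx; apply: nD.
  by apply: (@ysection_strip_box t); rewrite /ysection/= inE.
rewrite RintegralB ?fineI//; last 2 first.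
- by move=> t; exact: sfin.
- by move=> t; exact: sfin.
have RI (I : L -> \bar R) : (forall t, I t \is a fin_num) ->
    \int[leb]_(t in J) fine (I t) = fine (\int[leb]_(t in J) I t)%E.
  by move=> fI; congr fine; apply: eq_integral => t _; rewrite fineK.
rewrite !RI; [|by move=> t; exact: sfin..].
rewrite -[in X in _ -> X](fineK posf) -[in X in _ -> X](fineK negf).
have ipf : (\int[leb]_(t in J) Ip t)%E \is a fin_num := integrable_fin_num mJ iIp.
have inf : (\int[leb]_(t in J) In t)%E \is a fin_num := integrable_fin_num mJ iIn.
rewrite -[in X in _ -> X](fineK ipf) -[in X in _ -> X](fineK inf).
move=> h; apply: (congr1 EFin (subr_eq_swap h)).
Qed.

End InsideStrip.
End PatchedFamily.

Lemma borel_setX (R : realType) (X : normedModType R) (A : set (borel X)) (B : set R) :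
  measurable A -> measurable B -> measurable (A `*` B : set (borel (X * R)%type)).
Proof.
move=> mA mB.
have cfst : continuous (fst : X * R -> X) by move=> z; exact: cvg_fst.
have csnd : continuous (snd : X * R -> R) by move=> z; exact: cvg_snd.
have := measurableI _ _ (continuous_borel (D := setT) cfst measurableT mA)
  (continuous_borel_real (D := setT) csnd measurableT mB).
by rewrite !setTI.
Qed.

Lemma symmetric_itv_exhaustion (R : realType) (T : R) : 0 < T -> forall t,
  (exists n, `|t - T / 2| < T / 2 * (1 - n.+1%:R^-1)) <-> 0 < t < T.
Proof.
move=> T0 t; have T2 : 0 < T / 2 by rewrite divr_gt0.
split=> [[n]|/andP[t0 tT]].
  have Tn : 0 < T / 2 * n.+1%:R^-1 by rewrite mulr_gt0// invr_gt0.
  rewrite mulrBr mulr1 ltr_distl; move: (T / 2 * _) Tn => y y0 /andP[h1 h2].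
  by apply/andP; split; lra.
pose e := Num.min t (T - t); have e0 : 0 < e by rewrite lt_min t0 subr_gt0.
have [n] := ltr_add_invr (y := 0) (x := e / (T / 2)) (divr_gt0 e0 T2).
rewrite add0r ltr_pdivlMr// mulrC => nP; exists n.
rewrite mulrBr mulr1 ltr_distl; move: (T / 2 * _) nP => y.
by rewrite lt_min => /andP[h1 h2]; apply/andP; split; lra.
Qed.

Section Disintegration.
Context {R : realType} {d : nat} (T : R).
Local Notation E := 'rV[R]_d.
Local Notation L := (lebesgueType R).
Context (mu : lbmeasure (E * R)%type) (mus : R -> lbmeasure E).
Hypothesis mu_mus : given_by T mu mus.
Hypothesis T0 : 0 < T.

Let J : set L := `[0, T].
Let mJ : measurable J := measurable_J T.
Let coE := @coordinates_space R d.
Context (q : 'I_d -> R * R).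
Let D : set E := box (@co_space R d) q.
Let bD : bounded_borel D := box_bounded_borel coE q.
Let fP := lbm_family_patched mu_mus.
Let foP := lbm_family_opp fP.
Let Lp := slice_measure fP bD mJ.
Let Ln := slice_measure foP bD mJ.
Let ip := integrable_patched_tv mu_mus bD.

Lemma integrable_patched_tv_opp :
  leb.-integrable J (fun t => lbm_tv (lbm_opp (patched T mus t)) D).
Proof. by apply: (eq_integrable mJ _ _ _ ip) => t _; rewrite lbm_tv_opp. Qed.

Lemma integrable_slice_pos (nus : L -> lbmeasure E) (nusP : lbm_family nus)
    (A : set (borel (E * R)%type)) : measurable A ->
  leb.-integrable J (fun t => lbm_tv (nus t) D) ->
  leb.-integrable J (fun t => lbm_pos (nus t) (ysection A t `&` D)).
Proof.
move=> mA itv; apply: (le_integrable mJ _ _ itv).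
  by apply: measurable_funTS; exact: (measurable_slice_pos nusP bD mA).
move=> t _; rewrite !gee0_abs ?lbm_pos_ge0// lbm_tvE.
apply: (@le_trans _ _ (lbm_pos (nus t) D)); last by rewrite leeDl// lbm_pos_ge0.
apply: (le_measure (lbm_pos (nus t))); rewrite ?inE//; last exact: bD.1.
by apply: measurableI; [exact: measurable_slice|exact: bD.1].
Qed.

(** Time intervals centred at [T / 2], with closure inside []0, T[] and increasing to it; the
    interval for [n = 0] is empty. *)
Definition strip_param (n : nat) (i : option 'I_d) : R * R :=
  if i is Some j then q j else (T / 2, T / 2 * (1 - n.+1%:R^-1)).

Let Q n : set (borel (E * R)%type) := box (@co_spacetime R d) (strip_param n).
Let bQ n : bounded_borel (Q n : set (E * R)) :=
  box_bounded_borel (@coordinates_spacetime R d) (strip_param n).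

Lemma strip_radius n : 0 < T / 2 - T / 2 * (1 - n.+1%:R^-1) /\
  T / 2 + T / 2 * (1 - n.+1%:R^-1) < T.
Proof.
have n0 : (0 : R) < n.+1%:R^-1 by rewrite invr_gt0.
have T2 : 0 < T / 2 by rewrite divr_gt0.
have Tn : 0 < T / 2 * n.+1%:R^-1 by rewrite mulr_gt0.
by rewrite mulrBr mulr1; move: (T / 2 * _) Tn => y y0; split; lra.
Qed.

Let ident n := strip_identity mu_mus (q := q) (strip_radius n).1 (strip_radius n).2.

(** The identity of positive measures read as a signed one: all four terms are finite on [A], so the
    negative parts can be moved back. *)
Lemma strip_slice n (A : set (borel (E * R)%type)) : measurable A -> A `<=` Q n ->
  mu A = \int[leb]_(t in J) patched T mus t (ysection A t).
Proof.
move=> mA AQ; have bA : bounded_borel (A : set (E * R)) := bounded_borelS mA AQ (bQ n).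
have yD (t : R) : ysection A t `<=` D.
  by move=> x; rewrite /ysection/= inE => /AQ h j; exact: (h (Some j)).
have byA t : bounded_borel (ysection A t) := ysection_bounded bD mA (yD t).
have := ident mA AQ.
rewrite (slice_measureE fP bD mJ mA) (slice_measureE foP bD mJ mA).
set Ip := (\int[leb]_(t in _) _)%E; set In := (X in _ = (X + _)%E -> _).
have ipf : Ip \is a fin_num := integrable_fin_num mJ (integrable_slice_pos fP mA ip).
have inf : In \is a fin_num :=
  integrable_fin_num mJ (integrable_slice_pos foP mA integrable_patched_tv_opp).
rewrite -(fineK ipf) -(fineK inf) -(fineK (lbm_pos_finite mu bA)) -(fineK (lbm_neg_finite mu bA)).
move=> [h]; rewrite lbm_jordan_fine//.
transitivity (fine Ip - fine In); first by lra.
have fint (nus : L -> lbmeasure E) (nusP : lbm_family nus) :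
    leb.-integrable J (fun t => lbm_tv (nus t) D) ->
    leb.-integrable J (EFin \o (fun t => fine (lbm_pos (nus t) (ysection A t `&` D)))).
  move=> itv; apply: (eq_integrable mJ _ _ _ (integrable_slice_pos nusP mA itv)).
  by move=> t _ /=; rewrite fineK// setIidl//; exact: lbm_pos_finite.
have fE (nus : L -> lbmeasure E) :
    \int[leb]_(t in J) fine (lbm_pos (nus t) (ysection A t `&` D)) =
    fine (\int[leb]_(t in J) lbm_pos (nus t) (ysection A t `&` D))%E.
  congr fine; apply: eq_integral => t _.
  by rewrite fineK// setIidl//; exact: lbm_pos_finite.
rewrite /Ip /In -!fE -RintegralB//; last 2 first.
- exact: fint.
- exact: (fint _ foP integrable_patched_tv_opp).
apply: eq_Rintegral => t _.
by rewrite setIidl// [RHS](lbm_jordan_fine _ (byA t)).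
Qed.

Let QD n (t : R) : ysection (Q n) t `<=` D.
Proof. by move=> x; rewrite /ysection/= inE => h j; exact: (h (Some j)). Qed.

Lemma slice_pos_le_strip n (A : set (borel (E * R)%type)) : measurable A -> A `<=` Q n ->
  (Lp A <= lbm_pos mu A)%E.
Proof.
exact: (@slice_measure_le _ _ _ fP D bD J mJ ip mu (Q n) (bQ n) (@QD n) (@strip_slice n)).
Qed.

Lemma slice_neg_le_strip n (A : set (borel (E * R)%type)) : measurable A -> A `<=` Q n ->
  (Ln A <= lbm_neg mu A)%E.
Proof.
apply: (@slice_measure_le _ _ _ foP D bD J mJ integrable_patched_tv_opp (lbm_opp mu)
  (Q n) (bQ n) (@QD n)) => B mB BQ.
rewrite /= (strip_slice mB BQ) -mulN1r -RintegralZl//; last first.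
  by apply: (integrable_slice_lbm fP bD mJ ip mB) => t; apply: subset_trans (@QD n t);
     move=> x; rewrite /ysection/= !inE; exact: BQ.
by apply: eq_Rintegral => t _; rewrite mulN1r.
Qed.

Lemma bigcup_strip : \bigcup_n Q n = D `*` `]0, T[.
Proof.
apply/seteqP; split=> [[x t] [n _ h]|[x t] [xD tT]].
  split; first by move=> j; exact: (h (Some j)).
  by rewrite /= in_itv/=; apply: (symmetric_itv_exhaustion T0 t).1; exists n; exact: (h None).
have [n nP] := (symmetric_itv_exhaustion T0 t).2 tT.
by exists n => // -[j|]; [exact: xD|exact: nP].
Qed.

Lemma strip_nondecreasing : nondecreasing_seq Q.
Proof.
move=> m n mn; apply/subsetPset => z zm [j|]; first exact: (zm (Some j)).
apply: lt_le_trans (zm None) _; rewrite /= ler_wpM2l ?divr_ge0 ?(ltW T0)//.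
by rewrite lerB// lef_pV2 ?posrE// ler_nat.
Qed.

Lemma measure_strip_le (m1 m2 : {measure set (borel (E * R)%type) -> \bar R}) :
  (forall n (A : set (borel (E * R)%type)), measurable A -> A `<=` Q n -> (m1 A <= m2 A)%E) ->
  forall A : set (borel (E * R)%type), measurable A -> A `<=` D `*` `]0, T[ -> (m1 A <= m2 A)%E.
Proof.
move=> m12 A mA AD.
have mQ n : measurable (Q n) := (bQ n).1.
have AU : A = \bigcup_n (A `&` Q n) by rewrite -setI_bigcupr bigcup_strip setIidl.
have mAQ n : measurable (A `&` Q n) by exact: measurableI.
have cv : m1 (A `&` Q n) @[n --> \oo] --> m1 A.
  rewrite {2}AU; apply: nondecreasing_cvg_mu => //; first by rewrite -AU.
  by move=> i j ij; apply/subsetPset; apply: setIS; apply/subsetPset; exact: strip_nondecreasing.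
rewrite -(cvg_lim _ cv)//; apply: lime_le; first exact: (cvgP _ cv).
apply: nearW => n.
apply: le_trans (m12 n _ (mAQ n) (@subIsetr _ _ _)) _.
by apply: le_measure; rewrite ?inE//; exact: subIsetl.
Qed.

Let S : set (borel (E * R)%type) := D `*` `]0, T[.

Let mS : measurable S.
Proof. by rewrite /S -bigcup_strip; apply: bigcupT_measurable => n; exact: (bQ n).1. Qed.

Lemma slice_integral_le (nus : L -> lbmeasure E) (nusP : lbm_family nus)
    (m : {measure set (borel (E * R)%type) -> \bar R}) (f : borel (E * R)%type -> \bar R) :
  (forall n (A : set (borel (E * R)%type)), measurable A -> A `<=` Q n ->
    (slice_measure nusP bD mJ A <= m A)%E) ->
  (forall z, 0 <= f z)%E -> measurable_fun setT f ->
  (\int[leb]_(t in J) \int[lbm_pos (nus t)]_(x in D) f (x, t) <=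
   \int[m]_(z in S) f z)%E.
Proof.
move=> le_m f0 mf.
pose g := f \_ S.
have g0 z : (0 <= g z)%E by rewrite /g patchE; case: ifP.
have mg : measurable_fun setT g by apply: (measurable_restrictT f mS).1; exact: measurable_funTS.
have mfx (h : borel (E * R)%type -> \bar R) : (forall z, 0 <= h z)%E -> measurable_fun setT h ->
    measurable_fun J (fun t => \int[lbm_pos (nus t)]_(x in D) h (x, t))%E.
  move=> h0 mh; apply: (measurable_lbm_pos_integral coE bD nusP mJ (f := h \o swap_time)).
    by move=> z; exact: h0.
  by apply: measurable_funTS; apply: measurableT_comp => //; exact: measurable_swap_time.
(* Cutting [f] off to the open strip only affects the slices at [t = 0] and [t = T], a null set of
   times. *)
have -> : (\int[leb]_(t in J) \int[lbm_pos (nus t)]_(x in D) f (x, t) =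
    \int[leb]_(t in J) \int[lbm_pos (nus t)]_(x in D) g (x, t))%E.
  apply: (ae_eq_integral _ _ mJ (mfx f f0 mf) (mfx g g0 mg)).
  exists ([set 0; T] : set L); split.
  - by apply: measurableU; apply: lebesgue_type_borel; exact: measurable_set1.
  - have : lebesgue_measure ([set 0; T] : set R) = 0%E.
      exact/countable_lebesgue_measure0/finite_set_countable/finite_set2.
    exact.
  - move=> t /= nt; apply: contrapT => t0T; apply: nt => Jt; apply: eq_integral => x /set_mem xD.
    rewrite /g patchE mem_set//; split => //=; rewrite in_itv/= !lt_neqAle eq_sym.
    move: Jt; rewrite /J/= in_itv/= => /andP[-> ->]; rewrite !andbT.
    by apply/andP; split; apply/eqP => t0; apply: t0T; [left|right].
rewrite -(integral_slice_measure nusP bD mJ g0 mg).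
rewrite /g -integral_mkcond.
apply: le_measure_ge0_integral => // A mA AS.
exact: (measure_strip_le le_m).
Qed.

(** Used to pass integrability with respect to [mu] on to almost all slices. The positive and
    negative parts of the slices are compared separately with those of [mu]. *)
Lemma disintegration_tv_le (f : borel (E * R)%type -> \bar R) :
  (forall z, 0 <= f z)%E -> measurable_fun setT f ->
  (\int[leb]_(t in J) \int[lbm_tv (mus t)]_(x in D) f (x, t) <=
   \int[lbm_tv mu]_(z in (D `*` J : set (E * R))) f z)%E.
Proof.
move=> f0 mf; have mD : measurable (D : set (borel E)) := bD.1.
have mft (t : R) : measurable_fun (D : set (borel E)) (fun x : borel E => f (x, t)).
  apply: measurable_funTS.
  have mfs : measurable_fun setT (f \o swap_time).
    by apply: measurableT_comp => //; exact: measurable_swap_time.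
  exact: (measurableT_comp mfs (@pair1_measurable _ _ L (borel E) t)).
have mfx (nus : L -> lbmeasure E) (nusP : lbm_family nus) :
    measurable_fun J (fun t => \int[lbm_pos (nus t)]_(x in D) f (x, t))%E.
  apply: (measurable_lbm_pos_integral coE bD nusP mJ (f := f \o swap_time)).
    by move=> z; exact: f0.
  by apply: measurable_funTS; apply: measurableT_comp => //; exact: measurable_swap_time.
have If0 (m : {measure set (borel E) -> \bar R}) t :
    (0 <= \int[m]_(x in D) f (x, t))%E.
  by apply: integral_ge0 => x _; exact: f0.
rewrite (eq_integral (fun t => \int[lbm_pos (patched T mus t)]_(x in D) f (x, t) +
    \int[lbm_pos (lbm_opp (patched T mus t))]_(x in D) f (x, t))%E); last first.
  move=> t /set_mem Jt; rewrite -(patchedE mus Jt).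
  exact: (ge0_integral_measure_add (lbm_pos (patched T mus t)) (lbm_neg (patched T mus t)) mD
    (fun x _ => f0 (x, t)) (mft t)).
rewrite (ge0_integralD leb mJ (fun t _ => If0 _ t) (mfx _ fP) (fun t _ => If0 _ t) (mfx _ foP)).
apply: (@le_trans _ _ (\int[lbm_pos mu]_(z in S) f z + \int[lbm_neg mu]_(z in S) f z)%E).
  apply: leeD; first exact: (slice_integral_le slice_pos_le_strip f0 mf).
  exact: (slice_integral_le slice_neg_le_strip f0 mf).
rewrite -(ge0_integral_measure_add (lbm_pos mu) (lbm_neg mu) mS (fun z _ => f0 z)
  (measurable_funTS mf)).
apply: ge0_subset_integral => //.
- by apply: borel_setX; [exact: mD|exact: measurable_itv].
- exact: measurable_funTS.
- move=> [x t] [xD]; rewrite /J/= !in_itv/= => /andP[? ?]; split => //.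
  by apply/andP; split; exact: ltW.
Qed.
End Disintegration.

(** * Differential calculus *)

Section Euclid.
Context {R : realType} {d : nat}.
Local Notation E := 'rV[R]_d.
Implicit Types (x y z : E) (k : R).

Lemma dotpC x y : dotp x y = dotp y x.
Proof. by apply: eq_bigr => i _; rewrite mulrC. Qed.

Lemma dotpDl x y z : dotp (x + y) z = dotp x z + dotp y z.
Proof. by rewrite -big_split; apply: eq_bigr => i _; rewrite /= mxE mulrDl. Qed.

Lemma dotpDr x y z : dotp z (x + y) = dotp z x + dotp z y.
Proof. by rewrite dotpC dotpDl !(dotpC _ z). Qed.

Lemma dotpZl k x z : dotp (k *: x) z = k * dotp x z.
Proof. by rewrite /dotp mulr_sumr; apply: eq_bigr => i _; rewrite mxE mulrA. Qed.

Lemma dotpZr k x z : dotp z (k *: x) = k * dotp z x.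
Proof. by rewrite dotpC dotpZl dotpC. Qed.

Lemma dotpNl x z : dotp (- x) z = - dotp x z.
Proof. by rewrite -scaleN1r dotpZl mulN1r. Qed.

Lemma dotpNr x z : dotp z (- x) = - dotp z x.
Proof. by rewrite dotpC dotpNl dotpC. Qed.

Lemma dotp0l x : dotp 0 x = 0.
Proof. by rewrite -(scale0r x) dotpZl mul0r. Qed.

Lemma dotp0r x : dotp x 0 = 0.
Proof. by rewrite dotpC dotp0l. Qed.

Lemma dotp_mulmx x (A : 'M[R]_d) y : dotp (x *m A) y = dotp x (y *m A^T).
Proof.
rewrite /dotp.
under eq_bigr do rewrite mxE mulr_suml.
under [RHS]eq_bigr do rewrite mxE mulr_sumr.
rewrite exchange_big/=; apply: eq_bigr => i _; apply: eq_bigr => j _.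
by rewrite mxE mulrAC mulrA.
Qed.

Lemma dotp_ge0 x : 0 <= dotp x x.
Proof. by apply: sumr_ge0 => i _; rewrite -expr2 sqr_ge0. Qed.

Lemma enorm_ge0 x : 0 <= enorm x.
Proof. exact: sqrtr_ge0. Qed.

Lemma sqr_enorm x : enorm x ^+ 2 = dotp x x.
Proof. by rewrite sqr_sqrtr ?dotp_ge0. Qed.

Lemma dotp_eq0 x : (dotp x x == 0) = (x == 0).
Proof.
apply/eqP/eqP => [h|->]; last exact: dotp0l.
apply/rowP => i; rewrite mxE; apply/eqP; rewrite -[_ == 0]orbb -mulf_eq0.
move: h => /eqP; rewrite /dotp psumr_eq0; last by move=> j _; rewrite -expr2 sqr_ge0.
by move=> /allP /(_ i); rewrite mem_index_enum => /(_ isT).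
Qed.

Lemma enorm0 : enorm (0 : E) = 0.
Proof. by rewrite /enorm dotp0l sqrtr0. Qed.

Lemma enormZ k x : enorm (k *: x) = `|k| * enorm x.
Proof. by rewrite /enorm dotpZl dotpZr mulrA -expr2 sqrtrM ?sqr_ge0// sqrtr_sqr. Qed.

Lemma enormN x : enorm (- x) = enorm x.
Proof. by rewrite -scaleN1r enormZ normrN normr1 mul1r. Qed.

Lemma enormB x y : enorm (x - y) = enorm (y - x).
Proof. by rewrite -enormN opprB. Qed.

Lemma cauchy_schwarz x y : `|dotp x y| <= enorm x * enorm y.
Proof.
have [->|y0] := eqVneq y 0; first by rewrite dotp0r normr0 mulr_ge0// enorm_ge0.
rewrite -ler_sqr ?nnegrE ?mulr_ge0 ?enorm_ge0// exprMn !sqr_enorm real_normK ?num_real//.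
have yy : 0 < dotp y y by rewrite lt0r dotp_eq0 y0 dotp_ge0.
(* The squared norm of [<y,y> x - <x,y> y] is [<y,y>] times [<x,x><y,y> - <x,y>^2]. *)
have := dotp_ge0 (dotp y y *: x - dotp x y *: y).
rewrite dotpDl !dotpDr !dotpNl !dotpNr !dotpZl !dotpZr (dotpC y x).
move: (dotp x y) (dotp x x) (dotp y y) yy => a p q q0 h.
rewrite -subr_ge0 -(pmulr_rge0 _ q0); move: h; congr (_ <= _); ring.
Qed.

Lemma dotp_le x y : dotp x y <= enorm x * enorm y.
Proof. exact: le_trans (ler_norm _) (cauchy_schwarz _ _). Qed.

Lemma enormD x y : enorm (x + y) <= enorm x + enorm y.
Proof.
rewrite -ler_sqr ?nnegrE ?addr_ge0 ?enorm_ge0// sqrrD !sqr_enorm dotpDl !dotpDr (dotpC y x).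
have := dotp_le x y; rewrite -mulr_natl; move: (dotp x x) (dotp x y) (dotp y y) (enorm x * _) => *; lra.
Qed.

Lemma le_enormD x y : enorm x - enorm y <= enorm (x + y).
Proof. by rewrite lerBlDr -(enormN y) (le_trans _ (enormD _ _))// addrK. Qed.

Lemma coord_le_enorm x i : `|x 0 i| <= enorm x.
Proof.
rewrite -ler_sqr ?nnegrE ?enorm_ge0// sqr_enorm real_normK ?num_real//.
by rewrite /dotp (bigD1 i)//= -expr2 lerDl sumr_ge0// => j _; rewrite -expr2 sqr_ge0.
Qed.

Lemma enorm_le_sum x : enorm x <= \sum_i `|x 0 i|.
Proof.
have s0 : 0 <= \sum_i `|x 0 i| by apply: sumr_ge0.
rewrite -ler_sqr ?nnegrE ?enorm_ge0// sqr_enorm expr2 mulr_suml.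
apply: ler_sum => i _; apply: le_trans (ler_norm _) _; rewrite normrM ler_wpM2l//.
by rewrite (bigD1 i)//= lerDl sumr_ge0.
Qed.

Lemma norm_le_enorm x : `|x| <= enorm x.
Proof. by apply/(normr_rV_le _ (enorm_ge0 x)) => i; exact: coord_le_enorm. Qed.

Lemma enorm_le_norm x : enorm x <= d%:R * `|x|.
Proof.
apply: le_trans (enorm_le_sum x) _.
apply: (@le_trans _ _ (\sum_(i < d) `|x|)); last by rewrite sumr_const card_ord mulr_natl.
by apply: ler_sum => i _; exact: ((normr_rV_le x (normr_ge0 x)).1 (lexx _)).
Qed.

Lemma continuous_dotp (X : topologicalType) (f g : X -> E) :
  continuous f -> continuous g -> continuous (fun w => dotp (f w) (g w)).
Proof.
move=> cf cg; rewrite /dotp.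
have -> : (fun w => \sum_(i < d) f w 0 i * g w 0 i) = \sum_(i < d) (fun w => f w 0 i * g w 0 i).
  by apply/funext => w; rewrite fct_sumE.
elim/big_ind: _ => [|u v cu cv|i _] w.
- exact: cvg_cst.
- by apply: cvgD; [exact: cu|exact: cv].
- apply: cvgM.
    exact: (continuous_comp (cf _) (@coord_continuous _ _ _ 0 i _)).
  exact: (continuous_comp (cg _) (@coord_continuous _ _ _ 0 i _)).
Qed.

Lemma continuous_enorm (X : topologicalType) (f : X -> E) :
  continuous f -> continuous (fun w => enorm (f w)).
Proof.
move=> cf z; apply: (@continuous_comp _ _ _ (fun w => dotp (f w) (f w)) Num.sqrt).
  exact: continuous_dotp.
exact: sqrt_continuous.
Qed.

Lemma continuous_rV (X : topologicalType) (f : X -> E) :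
  (forall i, continuous (fun w => f w 0 i)) -> continuous f.
Proof.
move=> cf z; apply/cvg_ballP => e e0.
have : \forall w \near z, forall i, i \in enum 'I_d -> ball (f z 0 i) e (f w 0 i).
  elim: (enum 'I_d) => [|i s IH]; first by near=> w.
  have : \forall w \near z, ball (f z 0 i) e (f w 0 i) by move/cvg_ballP: (cf i z); exact.
  move: IH; apply: filterS2 => w h hi j; rewrite inE => /orP[/eqP ->//|]; exact: h.
apply: filterS => w h; apply/rV_ballP => // i.
by rewrite distrC; apply: h; rewrite mem_enum.
Unshelve. all: by end_near. Qed.

Lemma continuous_mulmx (X : topologicalType) (f : X -> E) (A : X -> 'M[R]_d) :
  continuous f -> (forall i j, continuous (fun w => A w i j)) ->
  continuous (fun w => f w *m A w).
Proof.
move=> cf cA; apply: continuous_rV => j.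
have -> : (fun w => (f w *m A w) 0 j) = (fun w => dotp (f w) (\row_i A w i j)).
  by apply/funext => z; rewrite mxE; apply: eq_bigr => i _; rewrite mxE.
apply: continuous_dotp => //; apply: continuous_rV => i.
by under eq_fun do rewrite mxE; exact: cA.
Qed.

Lemma compact_enorm_ball (r : R) : compact [set x : E | enorm x <= r].
Proof.
apply: bounded_closed_compact.
  exists r; split; first by rewrite num_real.
  by move=> s rs x /= xr; exact: le_trans (norm_le_enorm x) (le_trans xr (ltW rs)).
rewrite (_ : [set _ | _] = (fun x : E => enorm x) @^-1` [set s | s <= r])//.
apply: closed_comp => [x _|]; last exact: closed_le.
by apply: (@continuous_enorm _ id) => y; exact: cvg_id.
Qed.
End Euclid.

Lemma compact_continuous_bounded (R : realType) (X : topologicalType) (K : set X) (f : X -> R) :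
  compact K -> continuous f -> exists2 M : R, 0 <= M & forall z, K z -> `|f z| <= M.
Proof.
move=> cK cf.
have cfK : compact (f @` K).
  by apply: continuous_compact => //; exact: continuous_subspaceT.
have [M [Mr HM]] := compact_bounded cfK.
exists (`|M| + 1); first by rewrite addr_ge0.
move=> z Kz; apply: (HM (`|M| + 1)); first by rewrite (le_lt_trans (ler_norm M))// ltrDl.
by exists z.
Qed.
Section Differentiation.
Context {R : realType}.

Lemma is_diff_derive (V W : normedModType R) (f : V -> W) (df : V -> W) (z v : V) :
  is_diff z f df -> is_derive z v f (df v).
Proof.
move=> [dfz fE]; apply: DeriveDef; first exact: diff_derivable.
by rewrite deriveE// fE.
Qed.

Lemma segment_mean_value (V : normedModType R) (f : V -> R) (df : V -> V -> R) (x y : V) :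
  (forall z, is_diff z f (df z)) ->
  exists2 s, 0 < s < 1 & f y - f x = df (x + s *: (y - x)) (y - x).
Proof.
move=> fdf; set v := y - x.
pose phi (s : R) := f (x + s *: v).
have dphi s : is_derive s (1 : R) phi (df (x + s *: v) v).
  have daff : is_diff s (fun s : R => x + s *: v) ( *:%R^~ v).
    have d1 := is_diffD (is_diff_cst x s) (is_diff_scalel s v).
    by apply: is_diff_eq d1 _; apply/funext => r /=; rewrite /= !fctE add0r.
  have := is_diff_derive (1 : R) (is_diff_comp daff (fdf (x + s *: v))).
  by rewrite /= scale1r.
have cphi : {within `[0, 1], continuous phi}.
  apply: continuous_subspaceT => s; apply: differentiable_continuous.
  by apply/derivable1_diffP; case: (dphi s).
have [s s01 sE] := MVT ltr01 (fun s _ => dphi s) cphi.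
exists s; first by move: s01; rewrite in_itv.
by move: sE; rewrite subr0 mulr1 /phi scale1r scale0r addr0 [x + v]addrC subrK.
Qed.

Lemma is_diff_rV (d : nat) (V : normedModType R) (f df : V -> 'rV[R]_d) (z : V) :
  (forall i, is_diff z (fun w => f w 0 i) (fun v => df v 0 i)) -> is_diff z f df.
Proof.
move=> fi.
have sumE (g : V -> 'rV[R]_d) : g = \sum_i (fun w => g w 0 i *: delta_mx 0 i).
  by apply/funext => w; rewrite fct_sumE [LHS]row_sum_delta.
rewrite (sumE f) (sumE df).
elim/big_ind2: _ => [|u v u' v' du du'|i _]; first exact: is_diff_cst.
  exact: is_diffD.
exact: (is_diff_comp (fi i) (is_diff_scalel (f z 0 i) (delta_mx 0 i : 'rV[R]_d))).
Qed.

Context {d : nat}.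
Local Notation E := 'rV[R]_d.

Lemma is_diff_coord (V : normedModType R) (f df : V -> E) (z : V) i :
  is_diff z f df -> is_diff z (fun w => f w 0 i) (fun v => df v 0 i).
Proof.
move=> dfz; have [/(_ i) /(_ (f z)) di _ _] := @coordinates_space R d.
exact: (is_diff_comp dfz di).
Qed.

Lemma is_diff_fst (V W : normedModType R) (z : V * W) : is_diff z fst fst.
Proof. by apply: is_diff_continuous_linear => // y; exact: cvg_fst. Qed.

Lemma is_diff_snd (V W : normedModType R) (z : V * W) : is_diff z snd snd.
Proof. by apply: is_diff_continuous_linear => // y; exact: cvg_snd. Qed.

Lemma is_derive_diff (f : R -> R) (s a : R) :
  is_derive s (1 : R) f a -> is_diff s f (fun r => r * a).
Proof.
move=> [ds fE]; have dfs : differentiable f s by exact/derivable1_diffP.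
apply: DiffDef => //; apply/funext => r.
by rewrite diff1E//= /GRing.scale/= derive1E fE.
Qed.

(** The space gradient [g] and the time derivative [D] are carried as explicit functions because the
    Euler scheme produces them by recursion. Differentiability is joint in [(x, t)] and on the whole
    space, which implies the one-sided conditions of [cauchy_test]. *)
Definition has_gradient (w : E * R -> R) (g : E * R -> E) (D : E * R -> R) : Prop :=
  [/\ continuous g, continuous D &
      forall z, is_diff z w (fun v => dotp v.1 (g z) + v.2 * D z)].

Lemma has_gradient_derive w g D z v : has_gradient w g D ->
  is_derive z v w (dotp v.1 (g z) + v.2 * D z).
Proof. by move=> [_ _ /(_ z)]; exact: (@is_diff_derive _ _ _ _ _ v). Qed.

Lemma has_gradient_continuous w g D : has_gradient w g D -> continuous w.
Proof. by move=> [_ _ dw] z; apply: differentiable_continuous; case: (dw z). Qed.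

Lemma gradient_lipschitz w g D (M : R) (t : R) : has_gradient w g D ->
  (forall z, z.2 = t -> enorm (g z) <= M) ->
  forall x y, `|w (y, t) - w (x, t)| <= M * enorm (y - x).
Proof.
move=> [_ _ dw] gM x y.
have [s _ ->] := segment_mean_value (x, t) (y, t) dw.
have -> : (y, t) - (x, t) = (y - x, 0) :> E * R by congr (_, _); exact: subrr.
rewrite /= mul0r addr0 (le_trans (cauchy_schwarz _ _))// mulrC ler_wpM2r ?enorm_ge0//.
by apply: gM; rewrite /= scaler0 addr0.
Qed.

Lemma has_gradient_slice w g D z (v : E) : has_gradient w g D ->
  is_derive z.1 v (fun y => w (y, z.2)) (dotp v (g z)).
Proof.
case: z => x t /= [_ _ dw].
have dp : is_diff x (fun y : E => (y, t)) (fun y : E => (y, 0)).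
  exact: (is_diff_pair (is_diff_id x) (is_diff_cst t x)).
have := is_diff_derive v (is_diff_comp dp (dw (x, t))).
by rewrite /= mul0r addr0.
Qed.

Lemma gradx_has_gradient w g D z : has_gradient w g D -> gradx w z = g z.
Proof.
move=> hw; apply/rowP => i; rewrite mxE.
rewrite (@derive_val _ _ _ _ _ _ _ (has_gradient_slice z (delta_mx 0 i) hw)).
rewrite /dotp (bigD1 i)//= big1 ?addr0 => [|j ji]; rewrite mxE eqxx/= ?eqxx ?mul1r//.
by rewrite (negbTE ji) mul0r.
Qed.

Lemma dt_filter_proper (T : R) (z : E * R) : 0 <= z.2 < T -> ProperFilter (dt_filter T z).
Proof.
move=> /andP[z0 zT]; split; last exact: within_filter.
rewrite /dt_filter /within /= => /nbhs_ballP[e /= e0 eP].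
(* Positive and at most half of either margin, so [z.2 + h] stays in [[0, T[] even when
   [z.2 = 0]. *)
pose h := Num.min (e / 2) ((T - z.2) / 2).
have h0 : 0 < h by rewrite lt_min !divr_gt0 ?subr_gt0.
have he : h < e by rewrite gt_min; apply/orP; left; rewrite ltr_pdivrMr// ltr_pMr// ltr1n.
have hT : z.2 + h < T.
  rewrite addrC -ltrBrDr gt_min; apply/orP; right.
  by rewrite ltr_pdivrMr// ltr_pMr ?subr_gt0// ltr1n.
apply: (eP h) => /=; rewrite ?gt_eqF//.
  by rewrite /ball/= sub0r normrN gtr0_norm.
by rewrite hT addr_ge0// ltW.
Qed.

Lemma dt_has_gradient T w g D z : 0 <= z.2 < T -> has_gradient w g D ->
  dt_quot w z @ dt_filter T z --> D z.
Proof.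
move=> zT /(has_gradient_derive z (0, 1))[dw wE].
have h1 : (fun h : R => h^-1 *: (w (h *: (0, 1) + z) - w z)) @ 0^' --> D z.
  by move: wE; rewrite /= dotp0l add0r mul1r => <-; exact: dw.
have -> : dt_quot w z = (fun h : R => h^-1 *: (w (h *: (0, 1) + z) - w z)).
  apply/funext => h; case: z {zT dw wE h1} => x t /=.
  rewrite /dt_quot /GRing.scale/=; congr (_ * (w _ - _)).
  by congr (_, _); rewrite /= ?scaler0 ?add0r// /GRing.scale/= mulr1 addrC.
by apply: cvg_trans h1; apply: cvg_app; exact: cvg_within.
Qed.

Lemma has_gradient_cauchy_test T w g D (r : R) : has_gradient w g D ->
  (forall x t, 0 <= t < T -> r < enorm x -> w (x, t) = 0) ->
  cauchy_test T w /\ forall z, 0 <= z.2 < T -> dt T w z = D z.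
Proof.
move=> hw wr.
have dtE z : 0 <= z.2 < T -> dt T w z = D z.
  move=> zT; have := dt_filter_proper zT => pf.
  exact: (cvg_lim (@Rhausdorff R) (dt_has_gradient zT hw)).
split => //; split; last by exists r.
have [cg cD _] := hw.
split.
- by apply: continuous_subspaceT; exact: has_gradient_continuous hw.
- by move=> z zT; apply: cvgP (dt_has_gradient zT hw).
- apply: (@subspace_eq_continuous _ _ _ D); last exact: continuous_subspaceT.
  by move=> z /set_mem zT; symmetry; exact: dtE.
- by move=> z _ i; case: (has_gradient_slice z (delta_mx 0 i) hw).
- have -> : gradx w = g by apply/funext => z; exact: gradx_has_gradient hw.
  exact: continuous_subspaceT.
Qed.
End Differentiation.
Lemma continuous_sum (R : realType) (X : topologicalType) (I : Type) (s : seq I) (f : I -> X -> R) :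
  (forall i, continuous (f i)) -> continuous (fun z => \sum_(i <- s) f i z).
Proof.
move=> cf; elim: s => [|i s IH] z.
  by under eq_fun do rewrite big_nil; exact: cvg_cst.
by under eq_fun do rewrite big_cons; apply: cvgD; [exact: cf|exact: IH].
Qed.

Lemma continuous_normr (R : realType) (X : topologicalType) (f : X -> R) :
  continuous f -> continuous (fun z => `|f z|).
Proof. by move=> cf z; apply: cvg_norm; exact: cf. Qed.

Section ContinuouslyDifferentiable.
Context {R : realType} {d : nat}.
Local Notation E := 'rV[R]_d.

Lemma Ck1_is_diff (f : E -> R) x : Ck 1 f -> is_diff x f (fun v => dotp v (grad f x)).
Proof.
move=> [df _]; apply: DiffDef => //; apply/funext => v.
rewrite {1}(row_sum_delta v) linear_sum; apply: eq_bigr => i _.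
by rewrite linearZ mxE deriveE.
Qed.

Lemma Ck1_continuous_grad (f : E -> R) : Ck 1 f -> continuous (grad f).
Proof.
by move=> [_ cf]; apply: continuous_rV => i; under eq_fun do rewrite mxE; exact: cf.
Qed.

Lemma Ck1_has_gradient (f : E -> R) : Ck 1 f ->
  has_gradient (fun z => f z.1) (fun z => grad f z.1) (fun=> 0).
Proof.
move=> hf; split => [z|z|z]; [|exact: cvg_cst|].
  by apply: (@continuous_comp _ _ _ fst); [exact: cvg_fst|exact: Ck1_continuous_grad].
apply: is_diff_eq (is_diff_comp (is_diff_fst z) (Ck1_is_diff z.1 hf)) _.
by apply/funext => v /=; rewrite mulr0 addr0.
Qed.

Lemma grad_zero_outside (f : E -> R) (r : R) : (forall x, r < enorm x -> f x = 0) ->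
  forall x, r < enorm x -> grad f x = 0.
Proof.
move=> fr x rx; apply/rowP => i; rewrite !mxE.
rewrite (@near_eq_derive _ _ _ _ (cst 0)) ?derive_cst//.
have c : continuous (fun y : E => enorm y).
  by apply: (@continuous_enorm R d E id) => y; exact: cvg_id.
by apply: filterS (cvgr_gt _ (c x) _ rx) => y ry; rewrite fr.
Qed.

Lemma enorm_mulmx_le (v : E) (A : 'M[R]_d) :
  enorm (v *m A) <= (\sum_i \sum_j `|A i j|) * enorm v.
Proof.
apply: le_trans (enorm_le_sum _) _; rewrite exchange_big/= mulr_suml.
apply: ler_sum => j _; rewrite mxE mulr_suml.
apply: le_trans (ler_norm_sum _ _ _) _; apply: ler_sum => i _.
by rewrite normrM mulrC ler_wpM2l// coord_le_enorm.
Qed.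

Section Field.
Context (b : E * R -> E).
Hypothesis b1 : Ck 1 b.

(** Vectors are rows, so the entry [i j] is the derivative of component [j] in direction [i]: this
    is the matrix of hypothesis (ii), and [v *m jac z] is the derivative of the field along [v]. *)
Definition jac (z : E * R) : 'M[R]_d := 'J (fun y => b (y, z.2)) z.1.

Lemma is_diff_slice z : is_diff (z.1) (fun y => b (y, z.2)) (fun v => 'd b z (v, 0)).
Proof.
case: z => x t /=; have dp : is_diff x (fun y : E => (y, t)) (fun y : E => (y, 0)).
  exact: (is_diff_pair (is_diff_id x) (is_diff_cst t x)).
have db : is_diff (x, t) b ('d b (x, t)) by apply: DiffDef => //; exact: (b1.1 (x, t)).
exact: (is_diff_comp dp db).
Qed.

Lemma mul_jac z (v : E) : v *m jac z = 'd b z (v, 0).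
Proof.
have [ds sE] := is_diff_slice z.
by rewrite -deriveEjacobian// deriveE// sE.
Qed.

Lemma is_diff_slice_jac z : is_diff (z.1) (fun y => b (y, z.2)) (fun v => v *m jac z).
Proof. by apply: is_diff_eq (is_diff_slice z) _; apply/funext => v; rewrite mul_jac. Qed.

Lemma continuous_field : continuous b.
Proof. by move=> z; apply: differentiable_continuous; exact: (b1.1 z). Qed.

Lemma continuous_partial (v : E * R) j : continuous (fun z => 'd b z v 0 j).
Proof.
have -> : (fun z => 'd b z v 0 j) = (fun z => 'D_v b z 0 j).
  by apply/funext => z; rewrite deriveE//; exact: (b1.1 z).
move=> z; apply: (@continuous_comp _ _ _ (fun z => 'D_v b z) (fun y : E => y 0 j)).
  exact: (b1.2 v z).
exact: coord_continuous.
Qed.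

Lemma continuous_jac i j : continuous (fun z => jac z i j).
Proof.
have -> : (fun z => jac z i j) = (fun z => 'd b z (delta_mx 0 i, 0) 0 j).
  by apply/funext => z; rewrite -mul_jac -rowE [RHS]mxE.
exact: continuous_partial.
Qed.

(** The sum of the absolute values of the entries dominates the operator norms of both the matrix
    and its transpose, and it is continuous in [z]. *)
Lemma jac_bound (K : set (E * R)) : compact K ->
  exists2 M : R, 0 <= M & forall z, K z -> forall v,
    enorm (v *m jac z) <= M * enorm v /\ enorm (v *m (jac z)^T) <= M * enorm v.
Proof.
move=> cK.
have [M M0 MP] := compact_continuous_bounded cK (continuous_sum (s := index_enum 'I_d)
  (fun i => continuous_sum (s := index_enum 'I_d) (fun j => continuous_normr (continuous_jac (i := i) (j := j))))).
exists M => // z Kz v.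
have le_M : \sum_i \sum_j `|jac z i j| <= M := le_trans (ler_norm _) (MP z Kz).
split; apply: le_trans (enorm_mulmx_le _ _) _; rewrite ler_wpM2r ?enorm_ge0//.
rewrite exchange_big/=; apply: le_trans _ le_M.
by apply: ler_sum => i _; apply: ler_sum => j _; rewrite mxE.
Qed.

(** The mean value theorem gives a different intermediate point for each coordinate; this costs the
    factor [d] and requires segments to stay in [K]. *)
Lemma field_lipschitz (K : set (E * R)) : compact K ->
  (forall z z' s, K z -> K z' -> 0 < s < 1 -> K (z + s *: (z' - z))) ->
  exists2 L : R, 0 <= L & forall z z', K z -> K z' -> enorm (b z' - b z) <= L * `|z' - z|.
Proof.
move=> cK convK.
have [A A0 AP] := jac_bound cK.
have [B B0 BP] := compact_continuous_bounded cK
  (continuous_enorm (continuous_rV (continuous_partial (v := (0, 1))))).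
have bd y v : K y -> enorm ('d b y v) <= (A * d%:R + B) * `|v|.
  move=> Ky; have [v1 v2] : `|v.1| <= `|v| /\ `|v.2| <= `|v|.
    by case: v => v1 v2; rewrite prod_normE/= !le_max !lexx orbT.
  have -> : 'd b y v = v.1 *m jac y + v.2 *: 'd b y (0, 1).
    rewrite mul_jac -linearZ -linearD; congr ('d b y _).
    case: v {v1 v2} => v1 v2; congr (_, _); rewrite /= ?scaler0 ?addr0//.
    by rewrite /GRing.scale/= mulr1 add0r.
  rewrite mulrDl; apply: le_trans (enormD _ _) _; apply: lerD.
    apply: le_trans (AP y Ky _).1 _; rewrite -mulrA ler_wpM2l//.
    by apply: le_trans (enorm_le_norm _) _; rewrite ler_wpM2l.
  rewrite enormZ mulrC; apply: ler_pM; rewrite ?enorm_ge0//.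
  exact: le_trans (ler_norm _) (BP y Ky).
exists (d%:R * (A * d%:R + B)); first by rewrite mulr_ge0// addr_ge0// mulr_ge0.
move=> z z' Kz Kz'; apply: le_trans (enorm_le_sum _) _.
apply: (@le_trans _ _ (\sum_(i < d) (A * d%:R + B) * `|z' - z|)); last first.
  by rewrite sumr_const card_ord -[leLHS]mulr_natl mulrA.
apply: ler_sum => j _.
have df y : is_diff y (fun y => b y 0 j) (fun v => 'd b y v 0 j).
  by apply: is_diff_coord; apply: DiffDef => //; exact: (b1.1 y).
have [s s01] := segment_mean_value z z' df.
rewrite !mxE => ->; apply: le_trans (coord_le_enorm _ _) (bd _ _ _).
exact: convK.
Qed.
End Field.
End ContinuouslyDifferentiable.

(** * The Euler scheme *)

Section Hat.
Context {R : realType}.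
Implicit Types v : R.

Definition pospart v : R := Num.max v 0.

Definition ramp v : R := pospart v - pospart (v - 1).

(** The tent [1 - |v|] on [[-1, 1]], written as a difference of consecutive ramps so that sums over
    integer translates telescope. *)
Definition hat v : R := ramp (v + 1) - ramp v.

(* The primitive of [- hat] that vanishes on [1, +oo[. *)
Definition hat_tail v : R :=
  let q x := x * pospart x / 2 in 1 - (q (v + 1) - 2 * q v + q (v - 1)).

Lemma posE v : 0 <= v -> pospart v = v.
Proof. by move=> v0; apply/max_idPl. Qed.

Lemma neg_posE v : v <= 0 -> pospart v = 0.
Proof. by move=> v0; apply/max_idPr. Qed.

Lemma ramp0 v : v <= 0 -> ramp v = 0.
Proof. by move=> v0; rewrite /ramp !neg_posE ?subrr//; lra. Qed.

Lemma ramp1 v : 1 <= v -> ramp v = 1.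
Proof. by move=> v0; rewrite /ramp !posE; lra. Qed.

Lemma ramp_id v : 0 <= v <= 1 -> ramp v = v.
Proof. by move=> /andP[? ?]; rewrite /ramp posE// neg_posE; lra. Qed.

Lemma hat_eq0 v : 1 <= `|v| -> hat v = 0.
Proof.
rewrite ler_normr /hat => /orP[v1|v1]; first by rewrite !ramp1; lra.
by rewrite !ramp0; lra.
Qed.

Lemma hatE v : `|v| <= 1 -> hat v = 1 - `|v|.
Proof.
move=> v1; rewrite /hat; have [v0|/ltW v0] := leP 0 v.
  move: v1; rewrite ger0_norm// => v1.
  by rewrite ramp1 ?ramp_id ?v0 ?v1//; lra.
move: v1; rewrite ler0_norm// => v1.
by rewrite ramp_id ?ramp0//; [lra|apply/andP; split; lra].
Qed.

Lemma hat_ge0 v : 0 <= hat v.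
Proof.
have [v1|/ltW v1] := leP `|v| 1; first by rewrite hatE// subr_ge0.
by rewrite hat_eq0.
Qed.

Lemma hat_sum (s : R) n : \sum_(i < n) hat (s + i%:R) = ramp (s + n%:R) - ramp s.
Proof.
elim: n => [|n IH]; first by rewrite big_ord0 addr0 subrr.
by rewrite big_ord_recr/= IH /hat -(addrA s) natr1 addrC subrKA.
Qed.

Lemma hat_tail_eq0 v : 1 <= v -> hat_tail v = 0.
Proof. by move=> v1; rewrite /hat_tail/= !posE; lra. Qed.

Lemma hat_tail_eq1 v : v <= -1 -> hat_tail v = 1.
Proof. by move=> v1; rewrite /hat_tail/= !neg_posE; lra. Qed.

Lemma hat_tailE v : 0 <= v <= 1 -> hat_tail v = (1 - v) ^+ 2 / 2.
Proof.
move=> /andP[v0 v1]; rewrite /hat_tail/= (posE v0) (neg_posE (v := v - 1)); last lra.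
by rewrite posE; [field|lra].
Qed.

Lemma hat_tailNE v : -1 <= v <= 0 -> hat_tail v = 1 - (1 + v) ^+ 2 / 2.
Proof.
move=> /andP[v0 v1]; rewrite /hat_tail/= (neg_posE v1) (neg_posE (v := v - 1)); last lra.
by rewrite posE; [field|lra].
Qed.

Lemma hat_tail_itv v : 0 <= hat_tail v <= 1.
Proof.
have [v1|/ltW v1] := leP 1 v; first by rewrite hat_tail_eq0// lexx ler01.
have [v0|/ltW v0] := leP 0 v; first by rewrite hat_tailE ?v0//; nra.
have [vN|/ltW vN] := leP v (-1); first by rewrite hat_tail_eq1// ler01 lexx.
by rewrite hat_tailNE ?vN//; nra.
Qed.

(** Only [0 < v < 1] matters, where it reads [v (1 - v)^2 / 2 <= 1 - v]. *)
Lemma ramp_hat_tail_le v : ramp v * hat_tail v <= hat v.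
Proof.
have [v0|/ltW v0] := leP v 0; first by rewrite ramp0// mul0r hat_ge0.
have [v1|/ltW v1] := leP 1 v; first by rewrite hat_tail_eq0// mulr0 hat_ge0.
by rewrite ramp_id ?v0// hat_tailE ?v0// hatE ger0_norm//; nra.
Qed.

(** The sum telescopes to [ramp (s + n) - ramp s]. In the scheme it is the total rate of change of
    the steps before [n], and the factor [hat_tail] is the size of step [n] divided by [h]. *)
Lemma hat_sum_tail_le (s : R) n :
  (\sum_(i < n) hat (s + i%:R)) * hat_tail (s + n%:R) <= hat (s + n%:R).
Proof.
have [r0 r1] : 0 <= ramp s /\ 0 <= hat_tail (s + n%:R).
  split; last by have /andP[] := hat_tail_itv (s + n%:R).
  have [/ramp0->//|s0] := leP s 0; have [/ramp1->//|s1] := leP 1 s.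
  by rewrite ramp_id ?(ltW s0) ?ltW.
apply: le_trans _ (ramp_hat_tail_le _); rewrite ler_wpM2r// hat_sum; lra.
Qed.

Lemma hat_sum_eq1 (s : R) n : s <= 0 -> 1 <= s + n%:R -> \sum_(i < n) hat (s + i%:R) = 1.
Proof. by move=> s0 s1; rewrite hat_sum ramp1// ramp0// subr0. Qed.

(** For [i >= 2] the argument exceeds 1 and the term vanishes; the other two terms are at most 1. *)
Lemma hat_tail_sum (s : R) n : -1 < s -> \sum_(i < n) hat_tail (s + i%:R) <= 2.
Proof.
move=> s1; apply: (@le_trans _ _ (\sum_(i < n) (i < 2)%N%:R)).
  apply: ler_sum => i _; case: ltnP => i2; first by have /andP[] := hat_tail_itv (s + i%:R).
  rewrite hat_tail_eq0//; have : (2%:R : R) <= i%:R by rewrite ler_nat.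
  lra.
case: n => [|[|n]]; first by rewrite big_ord0.
  by rewrite big_ord_recl big_ord0/=; lra.
by rewrite !big_ord_recl big1//=; lra.
Qed.

Lemma is_derive_half_square v : is_derive v (1 : R) (fun x => x * pospart x / 2) (pospart v).
Proof.
have [v0|v0|<-] := ltgtP 0 v.
- apply: (@near_eq_is_derive _ _ _ (fun x : R => x * x / 2)).
    by apply: filterS (lt_nbhsr v0) => x x0; rewrite (posE (ltW x0)).
  have := is_deriveM (is_deriveM (is_derive_id v 1) (is_derive_id v 1)) (is_derive_cst (2^-1 : R) v 1).
  move/is_derive_eq; apply; rewrite (posE (ltW v0)) /GRing.scale/=; by field.
- apply: (@near_eq_is_derive _ _ _ (cst 0)).
    by apply: filterS (lt_nbhsl v0) => x x0; rewrite (neg_posE (ltW x0)) mulr0 mul0r.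
  by rewrite (neg_posE (ltW v0)); exact: is_derive_cst.
- have cv : (fun h : R => h^-1 *: ((h *: 1 + 0) * pospart (h *: 1 + 0) / 2 - 0 * pospart 0 / 2)) @ 0^' --> (0 : R).
    apply/cvgr0Pnorm_le => e e0; near=> h.
    have h0 : h != 0 by near: h; exact: nbhs_dnbhs_neq.
    rewrite !mul0r subr0 /GRing.scale/= mulr1 addr0 -!mulrA mulKf//.
    have he : `|h| < e by near: h; exact: dnbhs0_lt.
    have ph : `|pospart h| <= `|h|.
      by rewrite /pospart; case: (leP h 0) => _; rewrite ?normr0.
    rewrite normrM (ger0_norm (_ : 0 <= 2^-1 :> R)) ?invr_ge0//.
    have := le_lt_trans ph he; have := normr_ge0 (pospart h); lra.
  rewrite (neg_posE (lexx 0)); by apply: DeriveDef; [exact: (cvgP _ cv)|exact: (cvg_lim _ cv)].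
Unshelve. all: by end_near. Qed.

Lemma is_derive_hat_tail v : is_derive v (1 : R) hat_tail (- hat v).
Proof.
pose q x : R := x * pospart x / 2.
have dq (a : R) : is_derive v (1 : R) (fun x => q (x + a)) (pospart (v + a)).
  have ds := is_deriveD (is_derive_id v 1) (is_derive_cst a v (1 : R)).
  rewrite -[pospart _]mulr1 -[1 in X in is_derive _ _ _ X](addr0 1).
  exact: (@is_derive1_comp _ q (fun x => x + a) v _ _ (is_derive_half_square (v + a)) ds).
have -> : hat_tail = (fun=> 1) - ((fun x => q (x + 1)) - 2 *: (fun x => q (x + 0)) + (fun x => q (x + - 1))).
  by apply/funext => x; rewrite /hat_tail !fctE addr0.
apply: is_derive_eq; rewrite /hat /ramp addrK addr0 /GRing.scale/=; ring.
Qed.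

Lemma continuous_pospart : continuous pospart.
Proof. by move=> v; apply: continuous_max; [exact: cvg_id|exact: cvg_cst]. Qed.

Lemma continuous_hat : continuous hat.
Proof.
have cs (a : R) : continuous (fun v => pospart (v + a)).
  move=> v; apply: (@continuous_comp _ _ _ (fun x => x + a)); last exact: continuous_pospart.
  by apply: cvgD; [exact: cvg_id|exact: cvg_cst].
have -> : hat = (fun v => pospart (v + 1)) - (fun v => pospart (v + 0)) -
    ((fun v => pospart (v + 0)) - (fun v => pospart (v + - 1))).
  by apply/funext => v; rewrite /hat /ramp !fctE addrK addr0.
by move=> v; apply: cvgB; apply: cvgB; exact: cs.
Qed.
End Hat.

Lemma continuous_pair (X Y Z : topologicalType) (f : X -> Y) (g : X -> Z) :
  continuous f -> continuous g -> continuous (fun x => (f x, g x)).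
Proof.
by move=> cf cg x; apply: (cvg_pair (f := f) (g := g)); [exact: cf|exact: cg].
Qed.

Lemma continuous_compose (X Y Z : topologicalType) (f : X -> Y) (g : Y -> Z) :
  continuous f -> continuous g -> continuous (fun x => g (f x)).
Proof. by move=> cf cg x; apply: (continuous_comp (cf x)); exact: cg. Qed.

Lemma continuous_fst (X Y : topologicalType) : continuous (@fst X Y).
Proof. by move=> z; exact: cvg_fst. Qed.

Lemma continuous_snd (X Y : topologicalType) : continuous (@snd X Y).
Proof. by move=> z; exact: cvg_snd. Qed.

Section EulerScheme.
Context {R : realType} {d : nat}.
Local Notation E := 'rV[R]_d.
Context (b : E * R -> E) (h : R) (p : nat) (psi : E -> R).

(* Step [i] is performed between the times [node i + h] and [node i - h]: as [t] decreases
   through this interval, its size grows from [0] to [h].  Hence [euler p.+1] is close to [psi]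
   when [(p - 1) h < t <= p h], and the hat functions [hat (phase i t)], [i <= p], sum up to
   [1] when [0 <= t <= p h]. *)
Definition phase (i : nat) (t : R) : R := t / h - p%:R + i%:R.

Definition node (i : nat) : R := h * (p%:R - i%:R).

Definition step_size (i : nat) (t : R) : R := h * hat_tail (phase i t).

Definition euler_step (i : nat) (z : E * R) : E := z.1 + step_size i z.2 *: b (z.1, node i).

Fixpoint euler (n : nat) (z : E * R) : R :=
  if n is i.+1 then euler i (euler_step i z, z.2) else psi z.1.

Fixpoint euler_grad (n : nat) (z : E * R) : E :=
  if n is i.+1 then
    let g := euler_grad i (euler_step i z, z.2) in
    g + step_size i z.2 *: (g *m (jac b (z.1, node i))^T)
  else grad psi z.1.

Fixpoint euler_dt (n : nat) (z : E * R) : R :=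
  if n is i.+1 then
    let y := (euler_step i z, z.2) in
    euler_dt i y - hat (phase i z.2) * dotp (b (z.1, node i)) (euler_grad i y)
  else 0.

Hypothesis b1 : Ck 1 b.
Hypothesis psi1 : Ck 1 psi.
Hypothesis h0 : h != 0.

(** The factor [h] cancels the slope [1 / h] of [phase], so the rates of the steps are the tents
    themselves and stay bounded as [h] goes to 0. *)
Lemma is_derive_step_size i t : is_derive t (1 : R) (step_size i) (- hat (phase i t)).
Proof.
have dph : is_derive t (1 : R) (phase i) h^-1.
  have -> : phase i = h^-1 *: id + cst (i%:R - p%:R).
    by apply/funext => s; rewrite /phase !fctE /= /GRing.scale/=; ring.
  by apply: is_derive_eq; rewrite addr0 /GRing.scale/= mulr1.
have dh := is_deriveZ h (is_derive1_comp (is_derive_hat_tail (phase i t)) dph).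
apply: is_derive_eq dh _.
by rewrite /GRing.scale/= mulrCA divff// mulr1.
Qed.

Lemma is_diff_euler_step i z :
  is_diff z (euler_step i) (fun v => v.1 + step_size i z.2 *: (v.1 *m jac b (z.1, node i))
    - (v.2 * hat (phase i z.2)) *: b (z.1, node i)).
Proof.
apply: is_diff_rV => j.
have d1 : is_diff z (fun w : E * R => w.1 0 j) (fun v => v.1 0 j).
  exact: is_diff_coord (is_diff_fst z).
have d2 := is_diff_comp (is_diff_snd z) (is_derive_diff (is_derive_step_size i z.2)).
have d3 := is_diff_comp (is_diff_fst z) (is_diff_coord j (is_diff_slice_jac b1 (z.1, node i))).
have -> : (fun w => euler_step i w 0 j) =
    (fun w : E * R => w.1 0 j) + (step_size i \o snd) * ((fun y => b (y, node i) 0 j) \o fst).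
  by apply/funext => w; rewrite !fctE /euler_step/= !mxE.
apply: is_diff_eq (is_diffD d1 (is_diffM d2 d3)) _.
apply/funext => v; rewrite !fctE /= !mxE /GRing.scale/=; ring.
Qed.

Lemma continuous_step_size i : continuous (step_size i).
Proof.
move=> t; apply: differentiable_continuous; apply/derivable1_diffP.
by case: (is_derive_step_size i t).
Qed.

Lemma continuous_euler_step i : continuous (fun z : E * R => (euler_step i z, z.2)).
Proof.
apply: continuous_pair; last exact: continuous_snd.
by move=> z; apply: differentiable_continuous; case: (is_diff_euler_step i z).
Qed.

Lemma euler_has_gradient n : has_gradient (euler n) (euler_grad n) (euler_dt n).
Proof.
elim: n => [|i [cg cD dw]]; first exact: Ck1_has_gradient.
have cstep := @continuous_euler_step i.
have cnode : continuous (fun z : E * R => (z.1, node i)).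
  by apply: continuous_pair; [exact: continuous_fst|move=> z; exact: cvg_cst].
have cg' := continuous_compose cstep cg.
have cb := continuous_compose cnode (continuous_field b1).
split=> [z|z|z].
- apply: cvgD; first exact: cg'.
  apply: cvgZ; first exact: (continuous_compose (@continuous_snd _ _) (@continuous_step_size i)).
  apply: continuous_mulmx z => // k j.
  under eq_fun do rewrite mxE.
  exact: (continuous_compose cnode (@continuous_jac _ _ _ b1 j k)).
- apply: cvgB.
    exact: (continuous_compose cstep cD).
  apply: cvgM; last exact: (continuous_dotp cb cg').
  apply: (@continuous_comp _ _ _ (fun z : E * R => phase i z.2)); last exact: continuous_hat.
  apply: cvgD; last exact: cvg_cst.
  apply: cvgB; last exact: cvg_cst.
  by apply: cvgM; [exact: cvg_snd|exact: cvg_cst].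
- have ds : is_diff z (fun z => (euler_step i z, z.2)) _ :=
    is_diff_pair (is_diff_euler_step i z) (is_diff_snd z).
  apply: is_diff_eq (is_diff_comp ds (dw (euler_step i z, z.2))) _.
  apply/funext => v /=.
  set g := euler_grad i _; set c := b _; set J := jac b _.
  (* [dotp_mulmx] moves the Jacobian onto the gradient, which explains the transpose in
     [euler_grad]. *)
  rewrite !dotpDl dotpNl !dotpZl dotp_mulmx dotpDr dotpZr; ring.
Qed.
End EulerScheme.

Section EulerEstimates.
Context {R : realType} {d : nat}.
Local Notation E := 'rV[R]_d.
Context (b : E * R -> E) (h : R) (p : nat) (psi : E -> R).
Hypothesis b1 : Ck 1 b.
Hypothesis psi1 : Ck 1 psi.
Hypothesis h0 : 0 < h.
Local Notation w := (euler b h p psi).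
Local Notation gw := (euler_grad b h p psi).
Local Notation dw := (euler_dt b h p psi).
Local Notation Phi := (euler_step b h p).
Local Notation eta := (step_size h p).
Local Notation c := (node h p).

Lemma step_size_itv i t : 0 <= eta i t <= h.
Proof.
have /andP[t0 t1] := hat_tail_itv (phase h p i t).
rewrite /step_size mulr_ge0 ?(ltW h0)//=.
by rewrite -[leRHS]mulr1 ler_wpM2l// ltW.
Qed.

Section Support.
Context (C1 R0 R1 : R).
Hypothesis hC1 : h * C1 < 1.
Hypothesis linear_growth : forall i x, (i <= p)%N -> enorm (b (x, c i)) <= C1 + C1 * enorm x.
Hypothesis psi0 : forall x, R0 < enorm x -> psi x = 0.
Hypothesis R01 : forall n, (n <= p.+1)%N -> 1 + R0 <= (1 + R1) * (1 - h * C1) ^+ n.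

(** By the linear growth, one step multiplies [1 + |x|] by at least [1 - h * C1], so a point
    starting far out never reaches the support of [psi]. *)
Lemma euler_support_step n z : (n <= p.+1)%N -> 1 + R0 < (1 + enorm z.1) * (1 - h * C1) ^+ n ->
  [/\ w n z = 0, gw n z = 0 & dw n z = 0].
Proof.
elim: n z => [|n IH] z np hz.
  have zR : R0 < enorm z.1 by move: hz; rewrite expr0 mulr1 ltrD2l.
  by split => //=; [exact: psi0|exact: (grad_zero_outside psi0)].
have [h1 h2 h3] : [/\ w n (Phi n z, z.2) = 0, gw n (Phi n z, z.2) = 0 & dw n (Phi n z, z.2) = 0].
  apply: IH => /=; first exact: ltnW.
  apply: lt_le_trans hz _; rewrite exprS mulrA ler_wpM2r ?exprn_ge0 ?subr_ge0 ?(ltW hC1)//.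
  have := le_enormD z.1 (eta n z.2 *: b (z.1, c n)).
  rewrite enormZ.
  have /andP[e0 eh] := step_size_itv n z.2; rewrite (ger0_norm e0).
  have bn := linear_growth z.1 (np : (n <= p)%N).
  have : eta n z.2 * enorm (b (z.1, c n)) <= h * (C1 + C1 * enorm z.1).
    by apply: ler_pM; rewrite ?enorm_ge0.
  rewrite -/(Phi n z); lra.
by split => /=; rewrite ?h1 ?h2 ?h3// ?mul0mx ?scaler0 ?addr0// dotp0r mulr0 subr0.
Qed.

Lemma euler_support n z : (n <= p.+1)%N -> R1 < enorm z.1 ->
  [/\ w n z = 0, gw n z = 0 & dw n z = 0].
Proof.
move=> np zR; apply: euler_support_step => //.
apply: le_lt_trans (R01 np) _; rewrite ltr_pM2r ?ltrD2l//.
by rewrite exprn_gt0// subr_gt0.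
Qed.

Section Gradient.
Context (V : E -> R) (kappa Q0 : R).
Hypothesis V0 : forall x, 0 < V x.
Hypothesis kappa0 : 0 <= kappa.
Hypothesis psiV : forall x, enorm (grad psi x) ^+ 2 <= Q0 * V x.
Hypothesis stepV : forall i x s g, (i <= p)%N -> enorm x <= R1 -> 0 <= s <= h ->
  enorm (g + s *: (g *m (jac b (x, c i))^T)) ^+ 2 * V (x + s *: b (x, c i)) <=
  (1 + kappa * h) * enorm g ^+ 2 * V x.

(** The induction hypothesis is used at the image point [Phi n z] and carries the weight
    [V (Phi n z)]; [stepV] exchanges that weight for [V z.1] at the price of one factor
    [1 + kappa * h]. *)
Lemma euler_grad_bound n z : (n <= p.+1)%N ->
  enorm (gw n z) ^+ 2 <= (1 + kappa * h) ^+ n * Q0 * V z.1.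
Proof.
have k1 : 0 <= 1 + kappa * h by rewrite addr_ge0// mulr_ge0// ltW.
elim: n z => [|n IH] z np; first by rewrite expr0 mul1r; exact: psiV.
have [zR|zR] := leP (enorm z.1) R1; last first.
  have [_ -> _] := euler_support np zR.
  rewrite enorm0 expr0n/= !mulr_ge0 ?exprn_ge0 ?(ltW (V0 _))//.
  have := le_trans (sqr_ge0 _) (psiV z.1); rewrite pmulr_lge0//.
rewrite -(ler_pM2r (V0 (Phi n z))) /=.
apply: le_trans (stepV _ np zR (step_size_itv n z.2)) _.
have := IH (Phi n z, z.2) (ltnW np); rewrite /=.
set G2 := enorm _ ^+ 2 => /(ler_wpM2r (ltW (V0 z.1))) /(ler_wpM2l k1).
rewrite exprS !mulrA => /le_trans; apply.
by rewrite mulrAC lexx.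
Qed.
End Gradient.

Section Error.
Context (Gam A T B : R).
Hypothesis A0 : 0 <= A.
Hypothesis Gam0 : 0 <= Gam.
Hypothesis gwG : forall n z, (n <= p.+1)%N -> enorm (gw n z) <= Gam.
Hypothesis space_error : forall i x t s, (i <= p)%N -> enorm x <= R1 -> 0 <= t <= T -> 0 <= s <= h ->
  enorm (b (x, t) + s *: (b (x, t) *m jac b (x, c i)) - b (x + s *: b (x, c i), t)) <= A * s.
Hypothesis time_error : forall i x t s, (i <= p)%N -> enorm x <= R1 -> 0 <= t <= T -> 0 <= s <= h ->
  `|t - c i| <= h ->
  enorm (b (x, t) + s *: (b (x, t) *m jac b (x, c i)) - b (x, c i)) <= A * h.

Lemma phase_node i t : phase h p i t * h = t - c i.
Proof. by rewrite /phase /node; field; rewrite gt_eqF. Qed.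

(* [hat_sum_tail_le] bounds the product of the partial sum of the hats with the step size
   [n] by [h * hat (phase n t)], so the errors of the successive steps add up to [O(h)]. *)
Lemma euler_error n z : (n <= p.+1)%N -> 0 <= z.2 <= T ->
  `|dw n z + (\sum_(i < n) hat (phase h p i z.2)) * dotp (b z) (gw n z)| <=
  2 * Gam * A * h * \sum_(i < n) hat (phase h p i z.2).
Proof.
elim: n z => [|n IH] z np zT; first by rewrite !big_ord0 !mulr0/= mul0r addr0 normr0.
have th0 : 0 <= \sum_(i < n.+1) hat (phase h p i z.2) by apply: sumr_ge0 => i _; exact: hat_ge0.
have [zR|zR] := leP (enorm z.1) R1; last first.
  have [_ -> ->] := euler_support np zR.
  by rewrite dotp0r mulr0 addr0 normr0 !mulr_ge0// ltW.
rewrite big_ord_recr/=; set th := \sum_(i < n) _; set La := hat (phase h p n z.2).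
have := IH (Phi n z, z.2) (ltnW np) zT; rewrite /= -/th.
set y := Phi n z; set g := gw n (y, z.2); set D := dw n (y, z.2).
set J := jac b (z.1, c n); set s := eta n z.2; set bc := b (z.1, c n) => IHn.
have sh := step_size_itv n z.2.
have La0 : 0 <= La := hat_ge0 _.
have thn0 : 0 <= th by apply: sumr_ge0 => i _; exact: hat_ge0.
(* Two defects appear: the field pushed forward by the step against the field at the image point,
   weighted by [th], and the same push-forward against the field frozen at [c n], weighted by
   [La]. *)
have -> : D - La * dotp bc g + (th + La) * dotp (b z) (g + s *: (g *m J^T)) =
    (D + th * dotp (b (y, z.2)) g) +
    (th * dotp (b z + s *: (b z *m J) - b (y, z.2)) g + La * dotp (b z + s *: (b z *m J) - bc) g).
  by rewrite !dotpDl !dotpNl !dotpZl dotpDr dotpZr -dotp_mulmx; ring.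
have gG : enorm g <= Gam by apply: gwG; exact: ltnW.
have zE : (z.1, z.2) = z by case: (z).
have e1 : `|th * dotp (b z + s *: (b z *m J) - b (y, z.2)) g| <= Gam * A * h * La.
  rewrite normrM (ger0_norm thn0).
  have := space_error np zR zT sh; rewrite zE -/bc -/J -/s -/(Phi n z) -/y => se.
  have se' : enorm (b z + s *: (b z *m J) - b (y, z.2)) * enorm g <= A * s * Gam.
    by apply: ler_pM; rewrite ?enorm_ge0.
  apply: le_trans (ler_wpM2l thn0 (le_trans (cauchy_schwarz _ _) se')) _.
  have : th * hat_tail (phase h p n z.2) <= La := hat_sum_tail_le (z.2 / h - p%:R) n.
  rewrite /s /step_size; move: (hat_tail _) => G thG.
  have -> : th * (A * (h * G) * Gam) = Gam * A * h * (th * G) by ring.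
  by rewrite ler_wpM2l// !mulr_ge0// ltW.
have e2 : `|La * dotp (b z + s *: (b z *m J) - bc) g| <= Gam * A * h * La.
  rewrite normrM (ger0_norm La0).
  have [ph|ph] := leP `|phase h p n z.2| 1; last first.
    by rewrite /La hat_eq0 ?mul0r ?mulr0// ltW.
  have tc : `|z.2 - c n| <= h.
    by rewrite -phase_node normrM (gtr0_norm h0) ler_piMl// ltW.
  have := time_error np zR zT sh tc; rewrite zE -/bc -/J -/s => te.
  rewrite mulrC ler_wpM2r//; apply: le_trans (cauchy_schwarz _ _) _.
  by rewrite (_ : Gam * A * h = A * h * Gam); [apply: ler_pM; rewrite ?enorm_ge0|ring].
rewrite mulrDr; apply: le_trans (ler_normD _ _) _; apply: lerD => //.
apply: le_trans (ler_normD _ _) _; apply: le_trans (lerD e1 e2) _.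
by rewrite le_eqVlt; apply/orP; left; apply/eqP; ring.
Qed.

(** For [0 <= t <= p h] the tents sum to 1, which turns the weighted drift of the previous estimate
    into the full drift term. *)
Lemma euler_transport_error z : 0 <= z.2 <= T -> 0 <= z.2 <= p%:R * h ->
  `|dw p.+1 z + dotp (b z) (gw p.+1 z)| <= 2 * Gam * A * h.
Proof.
move=> zT /andP[z0 zp]; have := euler_error (leqnn p.+1) zT.
rewrite (hat_sum_eq1 (s := z.2 / h - p%:R)) ?mul1r ?mulr1//.
  by rewrite subr_le0 ler_pdivrMr.
by rewrite -natr1 addrA subrK lerDr divr_ge0// ltW.
Qed.

Hypothesis R0R1 : R0 <= R1.
Hypothesis B0 : 0 <= B.
Hypothesis b_bound : forall i x, (i <= p)%N -> enorm x <= R1 -> enorm (b (x, c i)) <= B.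

(** Each step moves the point by at most its size times [B], and the function it is inserted into is
    Lipschitz in space with constant [Gam]. *)
Lemma euler_close_step n z : (n <= p.+1)%N ->
  `|w n z - psi z.1| <= Gam * B * (\sum_(i < n) eta i z.2).
Proof.
elim: n z => [|n IH] z np; first by rewrite big_ord0 mulr0 subrr normr0.
have sh i : 0 <= eta i z.2 by have /andP[] := step_size_itv i z.2.
have [zR|zR] := leP (enorm z.1) R1; last first.
  have [-> _ _] := euler_support np zR.
  rewrite psi0 ?(le_lt_trans R0R1)// subrr normr0 !mulr_ge0//.
  by apply: sumr_ge0 => i _; exact: sh.
rewrite big_ord_recr/= mulrDr [leRHS]addrC.
have -> : w n (Phi n z, z.2) - psi z.1 =
    (w n (Phi n z, z.2) - w n (z.1, z.2)) + (w n (z.1, z.2) - psi z.1) by ring.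
apply: le_trans (ler_normD _ _) _; apply: lerD; last exact: (IH (z.1, z.2) (ltnW np)).
have hg := euler_has_gradient p b1 psi1 (lt0r_neq0 h0) n.
apply: le_trans (gradient_lipschitz hg (fun z _ => gwG z (ltnW np)) z.1 (Phi n z)) _.
rewrite -mulrA ler_wpM2l// /euler_step [X in enorm X]addrC addrA addNr add0r.
by rewrite enormZ ger0_norm// mulrC ler_wpM2r// b_bound.
Qed.

(** The hypothesis puts the phase of step 0 above -1, so the step sizes add up to at most [2 h]. *)
Lemma euler_close z : p%:R * h < z.2 + h -> `|w p.+1 z - psi z.1| <= 2 * Gam * B * h.
Proof.
move=> pz; apply: le_trans (euler_close_step z (leqnn _)) _.
rewrite -mulr_sumr.
have := @hat_tail_sum R (z.2 / h - p%:R) p.+1; rewrite -/(phase h p _ z.2) => hs.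
have : \sum_(i < p.+1) hat_tail (phase h p i z.2) <= 2.
  by apply: hs; rewrite ltrBrDl -(ltr_pM2r h0) mulrBl mul1r divfK ?gt_eqF// ltrBlDr.
move=> /(ler_wpM2l (ltW h0)) /(ler_wpM2l (mulr_ge0 Gam0 B0)) /le_trans; apply.
by rewrite le_eqVlt; apply/orP; left; apply/eqP; rewrite /step_size; ring.
Qed.
End Error.
End Support.
End EulerEstimates.

(** * Growth of the weighted gradient in one step *)

Section LyapunovStep.
Context {R : realType} {d : nat}.
Local Notation E := 'rV[R]_d.

(** Homogeneity extends the bound from the unit sphere; [0 < d] makes the sphere nonempty, so that
    [max_quad] is a true supremum. *)
Lemma max_quad_bound (A : 'M[R]_d) (M : R) : (0 < d)%N ->
  (forall v : E, enorm (v *m A^T) <= M * enorm v) ->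
  `|max_quad A| <= M /\ forall g : E, dotp (g *m A^T) g <= max_quad A * enorm g ^+ 2.
Proof.
move=> d0 AM; rewrite /max_quad; set S := (X in sup X).
have SM x : S x -> `|x| <= M.
  move=> [v v1 <-]; apply: le_trans (cauchy_schwarz _ _) _.
  by have := AM v; rewrite v1 !mulr1.
pose e : E := delta_mx 0 (Ordinal d0).
have e1 : enorm e = 1.
  rewrite /enorm /dotp (bigD1 (Ordinal d0))//= big1 => [|j ji].
    by rewrite mxE !eqxx mulr1 addr0 sqrtr1.
  by rewrite mxE (negbTE ji) andbF mul0r.
have Se : S (dotp (e *m A^T) e) by exists e.
have hS : has_sup S.
  split; first by exists (dotp (e *m A^T) e).
  by exists M => x /SM; apply: le_trans; exact: ler_norm.
have up x : S x -> x <= sup S by move=> Sx; exact: (sup_upper_bound hS).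
split.
  rewrite ler_norml; apply/andP; split.
    by apply: le_trans (up _ Se); have := SM _ Se; rewrite ler_norml => /andP[].
  by apply: ge_sup; [exact: hS.1|move=> x /SM; apply: le_trans; exact: ler_norm].
move=> g; have [->|g0] := eqVneq g 0; first by rewrite dotp0r enorm0 expr0n/= mulr0.
have ng : 0 < enorm g.
  by rewrite lt0r enorm_ge0 andbT -sqrf_eq0 sqr_enorm dotp_eq0.
have := up (dotp (((enorm g)^-1 *: g) *m A^T) ((enorm g)^-1 *: g)).
have Sg : S (dotp (((enorm g)^-1 *: g) *m A^T) ((enorm g)^-1 *: g)).
  exists ((enorm g)^-1 *: g) => //=.
  by rewrite enormZ normfV ger0_norm ?enorm_ge0// mulVf// gt_eqF.
move=> /(_ Sg); rewrite -scalemxAl dotpZl dotpZr mulrA -expr2 exprVn.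
by rewrite ler_pdivrMl ?exprn_gt0// mulrC.
Qed.

(** To first order [2 s m] and [- 2 s m] cancel and leave [s (C2 + 1/2)]; the smallness condition on
    [s] lets the second order terms fit into the remaining [s / 2]. *)
Lemma step_growth_le (s m M C2 : R) : 0 <= s <= 1 -> `|m| <= M -> 0 <= C2 ->
  s * (2 * M * (C2 + 2 * M + 1) + M ^+ 2 * (2 + C2 + 2 * M)) <= 1 / 2 ->
  0 <= 1 + 2 * s * m + s ^+ 2 * M ^+ 2 /\
  (1 + 2 * s * m + s ^+ 2 * M ^+ 2) * (1 + s * (C2 - 2 * m + 1 / 2)) <= 1 + s * (C2 + 1).
Proof.
move=> /andP[s0 s1]; rewrite ler_norml => /andP[mM Mm] C20 hs.
have M0 : 0 <= M by lra.
have sm : - (s * M) <= s * m by rewrite -mulrN ler_wpM2l.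
split; first by have := sqr_ge0 (1 - s * M); rewrite !expr2; lra.
set c := C2 - 2 * m + 1 / 2.
have c1 : c <= C2 + 2 * M + 1 by rewrite /c; lra.
have c2 : - (C2 + 2 * M + 1) <= c by rewrite /c; lra.
have c3 : `|m * c| <= M * (C2 + 2 * M + 1).
  by rewrite normrM; apply: ler_pM => //; rewrite ler_norml ?mM ?c2.
have c4 : 1 + s * c <= 2 + C2 + 2 * M.
  have : s * c <= 1 * (C2 + 2 * M + 1).
    by apply: le_trans (ler_wpM2l s0 c1) _; rewrite ler_wpM2r//; lra.
  lra.
have -> : (1 + 2 * s * m + s ^+ 2 * M ^+ 2) * (1 + s * c) =
    1 + s * (c + 2 * m) + s * (s * (2 * (m * c) + M ^+ 2 * (1 + s * c))) by ring.
have h1 : s * (2 * (m * c) + M ^+ 2 * (1 + s * c)) <= 1 / 2.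
  apply: le_trans hs; rewrite ler_wpM2l// -(mulrA 2) lerD//.
    by rewrite ler_pM2l// (le_trans (ler_norm _)).
  by rewrite ler_wpM2l// sqr_ge0.
have := ler_wpM2l s0 h1; rewrite /c; lra.
Qed.

(** By the mean value theorem the error is [s F (z, a s)] for some [a] in []0, 1[]. The function [F]
    is continuous and vanishes at [s = 0]; compactness makes its smallness uniform in [z]. *)
Lemma uniform_taylor (V : E -> R) (b : E * R -> E) (K : set (E * R)) (e : R) :
  Ck 1 V -> continuous b -> compact K -> 0 < e ->
  exists2 del : R, 0 < del & forall s z, 0 <= s <= del -> K z ->
    V (z.1 + s *: b z) <= V z.1 + s * (dotp (b z) (grad V z.1) + e).
Proof.
move=> V1 cb cK e0.
pose F (y : (E * R) * R) := dotp (b y.1) (grad V (y.1.1 + y.2 *: b y.1) - grad V y.1.1).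
have cF : continuous F.
  have cb' : continuous (fun y : (E * R) * R => b y.1) := continuous_compose (@continuous_fst _ _) cb.
  have cx : continuous (fun y : (E * R) * R => y.1.1).
    exact: (continuous_compose (@continuous_fst _ _) (@continuous_fst _ _)).
  have cV := Ck1_continuous_grad V1.
  apply: continuous_dotp => // y.
  apply: cvgB; last exact: (continuous_compose cx cV).
  apply: (@continuous_compose _ _ _ (fun y : (E * R) * R => y.1.1 + y.2 *: b y.1) _ _ cV) => x.
  apply: cvgD; first exact: cx.
  by apply: cvgZ; [exact: continuous_snd|exact: cb'].
have /compact_near_coveringP ncK := cK.
have : \forall s \near (0 : R), K `<=` (fun z => F (z, s) < e).
  apply: (ncK R (nbhs (0 : R)) (fun s z => F (z, s) < e) _) => z Kz.
  have Fz : F (z, 0) < e by rewrite /F/= scale0r addr0 subrr dotp0r.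
  have h : nbhs (z, (0 : R)) (fun t => F t < e) by exact: (cvgr_lt _ (cF (z, 0)) _ Fz).
  by apply: (@filterS _ (nbhs (z, (0 : R))) _ (fun t => F t < e) _ _ h) => -[].
move=> /nbhs_ballP[r /= r0 rP]; exists (r / 2); first by rewrite divr_gt0.
move=> s z /andP[s0 sr] Kz.
have [a /andP[a0 a1]] := segment_mean_value z.1 (z.1 + s *: b z) (fun x => Ck1_is_diff x V1).
rewrite [_ + _ - z.1]addrC addrA addNr add0r dotpZl scalerA => /eqP.
rewrite subr_eq => /eqP ->; rewrite addrC lerD2l ler_wpM2l//.
have : F (z, a * s) < e.
  apply: rP Kz; rewrite /ball/= sub0r normrN ger0_norm ?mulr_ge0 ?(ltW a0)//.
  apply: le_lt_trans (_ : s < r); first by rewrite ler_piMl// ltW.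
  by rewrite (le_lt_trans sr)// ltr_pdivrMr// ltr_pMr// ltr1n.
by rewrite /F/= dotpDr dotpNr ltrBlDl => /ltW.
Qed.

(* One step multiplies the squared gradient by at most [1 + 2 s max_quad + O(s^2)], while
   [V] grows along it by the factor [1 + s (C2 - 2 max_quad) + o(s)]. *)
Lemma lyapunov_step (V : E -> R) (b : E * R -> E) (K : set (E * R)) (C2 v0 : R) :
  (0 < d)%N -> Ck 1 V -> (forall x, 0 < V x) -> Ck 1 b -> compact K -> 0 <= C2 -> 0 < v0 ->
  (forall z, K z -> v0 <= V z.1) ->
  (forall z, K z -> dotp (b z) (grad V z.1) <= (C2 - 2 * max_quad (jac b z)) * V z.1) ->
  exists2 del : R, 0 < del & forall s z g, 0 <= s <= del -> K z ->
    enorm (g + s *: (g *m (jac b z)^T)) ^+ 2 * V (z.1 + s *: b z) <=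
    (1 + (C2 + 1) * s) * enorm g ^+ 2 * V z.1.
Proof.
move=> d0 V1 V0 b1 cK C20 v00 v0V hb.
have [M M0 MP] := jac_bound b1 cK.
(* The lower bound [v0] turns the additive Taylor error [v0 / 2] into the relative error [V / 2],
   which is the [1 / 2] in [step_growth_le]. *)
have e0 : 0 < v0 / 2 by rewrite divr_gt0.
have [del1 del10 delP] := uniform_taylor V1 (continuous_field b1) cK e0.
set C' := 2 * M * (C2 + 2 * M + 1) + M ^+ 2 * (2 + C2 + 2 * M).
have C'0 : 0 <= C' by rewrite addr_ge0// !mulr_ge0 ?addr_ge0 ?sqr_ge0// mulr_ge0.
pose del := Num.min del1 (Num.min 1 (2 * (C' + 1))^-1).
exists del; first by rewrite !lt_min del10 ltr01 invr_gt0 mulr_gt0// ltr_wpDl.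
move=> s z g /andP[s0]; rewrite !le_min => /and3P[sd s1 sC] Kz.
have [mM mQ] := max_quad_bound d0 (fun v => (MP z Kz v).2).
set m := max_quad _ in mM mQ.
have hs : s * C' <= 1 / 2.
  move: sC; rewrite -[leRHS]div1r ler_pdivlMr ?mulr_gt0 ?ltr_wpDl//.
  by move: (C') => C sC; lra.
have sI : 0 <= s <= 1 by rewrite s0.
have [g1 g2] := step_growth_le sI mM C20 hs.
have Vs : V (z.1 + s *: b z) <= (1 + s * (C2 - 2 * m + 1 / 2)) * V z.1.
  apply: le_trans (delP s z _ Kz) _; first by rewrite s0.
  have := hb z Kz; rewrite -/m => hbz.
  have : dotp (b z) (grad V z.1) + v0 / 2 <= (C2 - 2 * m + 1 / 2) * V z.1.
    by have := v0V z Kz; lra.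
  move=> /(ler_wpM2l s0); lra.
have gs : enorm (g + s *: (g *m (jac b z)^T)) ^+ 2 <=
    (1 + 2 * s * m + s ^+ 2 * M ^+ 2) * enorm g ^+ 2.
  rewrite sqr_enorm dotpDl !dotpDr !dotpZl !dotpZr (dotpC g) -!sqr_enorm.
  have h1 := ler_wpM2l s0 (mQ g).
  have : enorm (g *m (jac b z)^T) ^+ 2 <= (M * enorm g) ^+ 2.
    rewrite lerXn2r ?nnegrE ?enorm_ge0 ?mulr_ge0 ?enorm_ge0//.
    exact: (MP z Kz g).2.
  move=> /(ler_wpM2l (sqr_ge0 s)); move: h1; rewrite -/m.
  move: (dotp _ _) (enorm g) (enorm _) => D G1 G2; lra.
apply: le_trans (ler_pM (sqr_ge0 _) (ltW (V0 _)) gs Vs) _.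
rewrite mulrACA -[leRHS]mulrA (mulrC (C2 + 1)); apply: ler_wpM2r => //.
by rewrite mulr_ge0 ?sqr_ge0// ltW.
Qed.
End LyapunovStep.

(** * Test functions for one smooth field *)

Section EulerFamily.
Context {R : realType} {d : nat} (T : R).
Local Notation E := 'rV[R]_d.
Hypothesis T0 : 0 < T.

Lemma archi_step (S : R) : exists2 M : nat, (0 < M)%N & T / M%:R * S <= 1.
Proof.
have [M MS] : exists M : nat, T * S <= M%:R.
  exists (Num.truncn (Num.max 0 (T * S))).+1; apply/ltW.
  by apply: le_lt_trans (truncnS_gt _); rewrite le_max lexx orbT.
exists M.+1 => //; rewrite mulrAC ler_pdivrMr// mul1r.
by apply: le_trans MS _; rewrite ler_nat.
Qed.

Lemma small_time_step (C del x y : R) : 0 <= C -> 0 < del -> 0 <= x -> 0 <= y ->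
  exists2 M : nat, (0 < M)%N & let h := T / M%:R in
  [/\ 0 < h, h <= 1, h * C <= 1 / 2, h <= del & h * x <= 1 /\ h * y <= 1].
Proof.
move=> C0 del0 x0 y0.
have di0 : 0 < del^-1 by rewrite invr_gt0.
have [M M0 hS] := archi_step (1 + 2 * C + del^-1 + x + y).
exists M => //=; set h := T / M%:R in hS *.
have h0 : 0 < h by rewrite divr_gt0// ltr0n.
have hx z : z <= 1 + 2 * C + del^-1 + x + y -> h * z <= 1.
  by move=> zS; apply: le_trans hS; rewrite ler_wpM2l// ltW.
split => //.
- by rewrite -[leLHS]mulr1; apply: hx; lra.
- have := hx (2 * C); rewrite mulrCA; lra.
- by rewrite -[leRHS]mul1r -ler_pdivrMr//; apply: hx; lra.
- by split; apply: hx; lra.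
Qed.

Lemma sqr_le_le1D (x y : R) : x ^+ 2 <= y -> x <= 1 + y.
Proof. by move=> xy; have := sqr_ge0 (x - 1); nra. Qed.

Lemma time_step (M : nat) (t : R) : (0 < M)%N -> 0 < t <= T ->
  exists2 p : nat, (p <= M)%N & t <= p%:R * (T / M%:R) /\ p%:R * (T / M%:R) < t + T / M%:R.
Proof.
move=> M0 /andP[t0 tT]; set h := T / M%:R.
have hM : M%:R * h = T by rewrite /h mulrC divfK// pnatr_eq0 -lt0n.
have ex : exists n : nat, t <= n%:R * h by exists M; rewrite hM.
have [p tp minp] := ex_minnP ex.
exists p; first by apply: minp; rewrite hM.
split => //; case: p tp minp => [|p] tp minp; first by move: tp; rewrite mul0r leNgt t0.
rewrite -natr1 mulrDl mul1r ltrD2r ltNge; apply/negP => /minp.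
by rewrite ltnn.
Qed.

Lemma discount_ge (x : R) n : 0 <= x <= 1 / 2 -> expR (- (2 * x * n%:R)) <= (1 - x) ^+ n.
Proof.
move=> /andP[x0 x1].
have h : expR (- (2 * x)) <= 1 - x.
  rewrite expRN -[leLHS]div1r ler_pdivrMr ?expR_gt0//.
  (* For [0 <= x <= 1/2] the product [(1 - x)(1 + 2x)] is at least 1, and [1 + 2x <= exp(2x)]. *)
  apply: (@le_trans _ _ ((1 - x) * (1 + 2 * x))); last first.
    by rewrite ler_wpM2l ?expR_ge1Dx//; lra.
  by nra.
have -> : expR (- (2 * x * n%:R)) = expR (- (2 * x)) ^+ n.
  by rewrite -expRM_natl; congr expR; ring.
by rewrite lerXn2r ?nnegrE ?expR_ge0//; lra.
Qed.

Definition ball_time (rho : R) : set (E * R) := [set x | enorm x <= rho] `*` `[0, T].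

Lemma compact_ball_time rho : compact (ball_time rho).
Proof. by apply: compact_setX; [exact: compact_enorm_ball|exact: segment_compact]. Qed.

Lemma ball_timeE rho x t : enorm x <= rho -> 0 <= t <= T -> ball_time rho (x, t).
Proof. by move=> xr tT; split => //=; rewrite in_itv. Qed.

Lemma convex_le (x y m s : R) : 0 <= s <= 1 -> x <= m -> y <= m -> (1 - s) * x + s * y <= m.
Proof.
move=> /andP[s0 s1] xm ym; have s1' : 0 <= 1 - s by rewrite subr_ge0.
by have := lerD (ler_wpM2l s1' xm) (ler_wpM2l s0 ym); rewrite -mulrDl subrK mul1r.
Qed.

Lemma convex_ball_time rho z z' s : ball_time rho z -> ball_time rho z' -> 0 < s < 1 ->
  ball_time rho (z + s *: (z' - z)).
Proof.
case: z z' => [x t] [x' t'] [/= xr +] [/= xr' +] s01.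
have s01' : 0 <= s <= 1 by case/andP: s01 => /ltW -> /ltW ->.
have /andP[s0 s1] := s01; rewrite !in_itv/= => /andP[t0 tT] /andP[t0' tT']; split => /=.
  have -> : x + s *: (x' - x) = (1 - s) *: x + s *: x'.
    by rewrite scalerBr scalerBl scale1r addrA addrAC.
  apply: le_trans (enormD _ _) _; rewrite !enormZ !gtr0_norm ?subr_gt0//.
  exact: convex_le.
rewrite in_itv/= /GRing.scale/=.
have -> : t + s * (t' - t) = (1 - s) * t + s * t' by ring.
rewrite (convex_le s01' tT tT') andbT addr_ge0// mulr_ge0//; first by rewrite subr_ge0 ltW.
exact: ltW.
Qed.

(* The constant in the gradient bound does not involve [b], except through [C2] and [v0]. *)
Lemma euler_family (b : E * R -> E) (V psi : E -> R) (C1 C2 v0 G0 R0 R1 r e : R) :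
  (0 < d)%N -> 0 <= C1 -> 0 <= C2 -> 0 < v0 -> 0 <= R0 ->
  1 + R1 = (1 + R0) * expR (4 * C1 * T) -> R1 < r -> 0 < e ->
  Ck 1 b -> Ck 1 V -> (forall x, 0 < V x) -> Ck 1 psi ->
  (forall x, R0 < enorm x -> psi x = 0) ->
  (forall x, enorm (grad psi x) ^+ 2 <= G0) ->
  (forall x t, 0 <= t <= T -> enorm (b (x, t)) <= C1 + C1 * enorm x) ->
  (forall x, enorm x < r -> v0 <= V x) ->
  (forall x t, enorm x < r -> 0 <= t <= T ->
    dotp (b (x, t)) (grad V x) <= (C2 - 2 * max_quad (jac b (x, t))) * V x) ->
  exists (w : nat -> E * R -> R) (gw : nat -> E * R -> E) (dw : nat -> E * R -> R),
  [/\ forall p, has_gradient (w p) (gw p) (dw p),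
      forall p z, R1 < enorm z.1 -> [/\ w p z = 0, gw p z = 0 & dw p z = 0],
      forall p z, enorm (gw p z) ^+ 2 <= expR (2 * (C2 + 1) * T) * (G0 / v0) * V z.1 &
      forall t, 0 < t <= T -> exists p,
        (forall x s, 0 <= s <= t -> `|dw p (x, s) + dotp (b (x, s)) (gw p (x, s))| <= e) /\
        forall x, `|w p (x, t) - psi x| <= e].
Proof.
move=> d0 C10 C20 v00 R00 R1E R1r e0 b1 V1 V0 psi1 psi0 psiG growth v0V drift.
have R0R1 : R0 <= R1.
  rewrite -(lerD2l 1) R1E ler_peMr ?addr_ge0// -[leLHS]expR0 ler_expR.
  by rewrite !mulr_ge0// ltW.
have R10 : 0 <= R1 := le_trans R00 R0R1.
pose Bd := C1 + C1 * R1.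
have Bd0 : 0 <= Bd by rewrite addr_ge0// mulr_ge0.
have bBd x t : enorm x <= R1 -> 0 <= t <= T -> enorm (b (x, t)) <= Bd.
  by move=> xR tT; apply: le_trans (growth _ _ tT) _; rewrite lerD2l ler_wpM2l.
have [be be0 beP] := jac_bound b1 (@compact_ball_time R1).
(* Step sizes will be at most 1, so a point of the ball of radius [R1] is moved into the ball of
   radius [R1 + Bd]. *)
have [L L0 LP] := field_lipschitz b1 (@compact_ball_time (R1 + Bd)) (@convex_ball_time (R1 + Bd)).
have Kr z : ball_time R1 z -> enorm z.1 < r by case=> zR _; exact: le_lt_trans R1r.
have hdrift z : ball_time R1 z ->
    dotp (b z) (grad V z.1) <= (C2 - 2 * max_quad (jac b z)) * V z.1.
  move=> Kz; case: z Kz (Kr z Kz) => x t [_ /=]; rewrite in_itv/= => tT xr.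
  exact: drift.
have [del del0 delP] := lyapunov_step d0 V1 V0 b1 (@compact_ball_time R1) C20 v00
  (fun z Kz => v0V z.1 (Kr z Kz)) hdrift.
have [MV MV0 MVP] := compact_continuous_bounded (@compact_enorm_ball R d R1)
  (fun x => differentiable_continuous (V1.1 x)).
(* The first term pays for the displacement of the base point, the second for the Jacobian term, the
   third for the change of time. *)
pose A := L * Bd + be * Bd + L.
have A0 : 0 <= A by rewrite !addr_ge0// mulr_ge0.
have G00 : 0 <= G0 := le_trans (sqr_ge0 _) (psiG 0).
pose Cst := expR (2 * (C2 + 1) * T) * (G0 / v0).
have Cst0 : 0 <= Cst by rewrite mulr_ge0 ?expR_ge0// divr_ge0// ltW.
(* An unweighted gradient bound. It depends on [V] through [MV], which is harmless because it only
   enters the choice of [h]. *)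
pose Gam := 1 + Cst * MV.
have Gam0 : 0 <= Gam by rewrite addr_ge0// mulr_ge0.
have GA0 : 0 <= 2 * Gam * A / e by rewrite !mulr_ge0// invr_ge0 ltW.
have GB0 : 0 <= 2 * Gam * Bd / e by rewrite !mulr_ge0// invr_ge0 ltW.
have [M M0 []] := small_time_step C10 del0 GA0 GB0.
set h := T / M%:R => h0 h1 hC hdel [hA hB].
have hM : M%:R * h = T by rewrite /h mulrC divfK// pnatr_eq0 -lt0n.
have hT : h <= T by rewrite ler_pdivrMr ?ltr0n// ler_peMr ?ler1n// ltW.
have {hA}hA : 2 * Gam * A * h <= e.
  by move: hA; rewrite mulrA ler_pdivrMr// mul1r mulrC.
have {hB}hB : 2 * Gam * Bd * h <= e.
  by move: hB; rewrite mulrA ler_pdivrMr// mul1r mulrC.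
have hC1' : h * C1 < 1 by apply: le_lt_trans hC _; rewrite ltr_pdivrMr// mul1r ltr1n.
have nodeT q i : (q <= M)%N -> (i <= q)%N -> 0 <= node h q i <= T.
  move=> qM iq; rewrite /node -natrB// mulr_ge0 ?(ltW h0)//= mulrC -hM ler_pM2r// ler_nat.
  exact: leq_trans (leq_subr _ _) qM.
have growth' q (qM : (q <= M)%N) i x : (i <= q)%N ->
    enorm (b (x, node h q i)) <= C1 + C1 * enorm x.
  by move=> iq; apply: growth; exact: nodeT.
(* At most [M + 1] steps of length [h <= T] have total length at most [2 T]; hence [4 C1 T] and
   [2 (C2 + 1) T] in the exponents. *)
have nT n : (n <= M.+1)%N -> n%:R * h <= 2 * T.
  move=> nM; apply: (@le_trans _ _ (M.+1%:R * h)); first by rewrite ler_wpM2r ?ler_nat// ltW.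
  by rewrite -natr1 mulrDl hM mul1r [leRHS]mulrDl mul1r lerD2l.
have R01 q (qM : (q <= M)%N) n : (n <= q.+1)%N -> 1 + R0 <= (1 + R1) * (1 - h * C1) ^+ n.
  move=> nq; rewrite R1E -mulrA ler_peMr ?addr_ge0//.
  have hCI : 0 <= h * C1 <= 1 / 2 by rewrite mulr_ge0 ?(ltW h0).
  apply: le_trans _ (ler_wpM2l (expR_ge0 _) (discount_ge n hCI)).
  rewrite -expRD -[leLHS]expR0 ler_expR.
  have := ler_wpM2l (mulr_ge0 (ler0n R 2) C10) (nT n (leq_trans nq (qM : (q.+1 <= M.+1)%N))).
  rewrite subr_ge0; congr (_ <= _); ring.
have step_ball q i x : (q <= M)%N -> (i <= q)%N -> enorm x <= R1 -> ball_time R1 (x, node h q i).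
  by move=> qM iq xR; apply: ball_timeE => //; exact: nodeT.
have k0 : 0 <= C2 + 1 by rewrite addr_ge0.
have stepV q (qM : (q <= M)%N) i x s g : (i <= q)%N -> enorm x <= R1 -> 0 <= s <= h ->
    enorm (g + s *: (g *m (jac b (x, node h q i))^T)) ^+ 2 * V (x + s *: b (x, node h q i)) <=
    (1 + (C2 + 1) * h) * enorm g ^+ 2 * V x.
  move=> iq xR /andP[s0 sh].
  apply: le_trans (delP s (x, node h q i) g _ (step_ball _ _ _ qM iq xR)) _.
    by rewrite s0 (le_trans sh).
  apply: ler_wpM2r; first exact: ltW.
  by apply: ler_wpM2r; rewrite ?sqr_ge0// lerD2l ler_wpM2l.
(* The lower bound on [V] is given inside radius [r]; beyond it the gradient of [psi] vanishes. *)
have psiV x : enorm (grad psi x) ^+ 2 <= G0 / v0 * V x.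
  have [xr|xr] := ltP (enorm x) r.
    apply: le_trans (psiG x) _; rewrite -mulrA ler_peMr// ler_pdivlMl// mulr1.
    exact: v0V.
  rewrite (grad_zero_outside psi0) ?(le_lt_trans R0R1 (lt_le_trans R1r xr))//.
  by rewrite enorm0 expr0n/= mulr_ge0 ?divr_ge0 ?(ltW v00) ?(ltW (V0 x)).
have gradV q n z : (q <= M)%N -> (n <= q.+1)%N ->
    enorm (euler_grad b h q psi n z) ^+ 2 <= Cst * V z.1.
  move=> qM nq.
  apply: le_trans (euler_grad_bound h0 hC1' (growth' q qM) psi0 (R01 q qM) V0 k0 psiV
    (stepV q qM) z nq) _.
  rewrite /Cst -!mulrA ler_wpM2r ?mulr_ge0 ?invr_ge0 ?(ltW v00) ?(ltW (V0 _))//.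
  apply: (@le_trans _ _ (expR ((C2 + 1) * h) ^+ n)).
    by rewrite lerXn2r ?nnegrE ?expR_ge0 ?expR_ge1Dx// addr_ge0// mulr_ge0// ltW.
  rewrite -expRM_natl ler_expR.
  have := ler_wpM2l k0 (nT n (leq_trans nq (qM : (q.+1 <= M.+1)%N))).
  congr (_ <= _); ring.
have supp q n z : (q <= M)%N -> (n <= q.+1)%N -> R1 < enorm z.1 ->
    [/\ euler b h q psi n z = 0, euler_grad b h q psi n z = 0 & euler_dt b h q psi n z = 0].
  by move=> qM; exact: (euler_support h0 hC1' (growth' q qM) psi0 (R01 q qM)).
have gwG q n z : (q <= M)%N -> (n <= q.+1)%N -> enorm (euler_grad b h q psi n z) <= Gam.
  move=> qM nq; have [zR|zR] := leP (enorm z.1) R1; last first.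
    by have [_ -> _] := supp q n z qM nq zR; rewrite enorm0.
  apply: sqr_le_le1D; apply: le_trans (gradV q n z qM nq) _; rewrite ler_wpM2l//.
  exact: le_trans (ler_norm _) (MVP _ zR).
have bL x t y u : enorm x <= R1 + Bd -> enorm y <= R1 + Bd -> 0 <= t <= T -> 0 <= u <= T ->
    enorm (b (y, u) - b (x, t)) <= L * Num.max (enorm (y - x)) `|u - t|.
  move=> xR yR tT uT; apply: le_trans (LP _ _ (ball_timeE xR tT) (ball_timeE yR uT)) _.
  rewrite ler_wpM2l// prod_normE/= ge_max !le_max lexx orbT andbT.
  by rewrite norm_le_enorm.
have bJ q i x t : (q <= M)%N -> (i <= q)%N -> enorm x <= R1 -> 0 <= t <= T ->
    enorm (b (x, t) *m jac b (x, node h q i)) <= be * Bd.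
  move=> qM iq xR tT; apply: le_trans (beP _ (step_ball _ _ _ qM iq xR) _).1 _.
  by rewrite ler_wpM2l// bBd.
have space_error q (qM : (q <= M)%N) i x t s : (i <= q)%N -> enorm x <= R1 -> 0 <= t <= T ->
    0 <= s <= h ->
    enorm (b (x, t) + s *: (b (x, t) *m jac b (x, node h q i)) -
      b (x + s *: b (x, node h q i), t)) <= A * s.
  move=> iq xR tT /andP[s0 sh]; rewrite addrAC; apply: le_trans (enormD _ _) _.
  have xB : enorm x <= R1 + Bd by apply: le_trans xR _; rewrite lerDl.
  have sb : enorm (s *: b (x, node h q i)) <= s * Bd.
    by rewrite enormZ ger0_norm// ler_wpM2l// bBd// nodeT.
  have yB : enorm (x + s *: b (x, node h q i)) <= R1 + Bd.
    apply: le_trans (enormD _ _) _; rewrite lerD//; apply: le_trans sb _.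
    by rewrite ler_piMl// (le_trans sh).
  have e1 : enorm (b (x, t) - b (x + s *: b (x, node h q i), t)) <= L * (s * Bd).
    rewrite enormB; apply: le_trans (bL _ _ _ _ xB yB tT tT) _.
    rewrite ler_wpM2l// subrr normr0 ge_max [X in enorm X]addrC addrA addNr add0r sb/=.
    by rewrite mulr_ge0.
  have e2 : enorm (s *: (b (x, t) *m jac b (x, node h q i))) <= s * (be * Bd).
    by rewrite enormZ ger0_norm// ler_wpM2l// bJ.
  apply: le_trans (lerD e1 e2) _; rewrite /A.
  rewrite [leRHS](_ : _ = L * (s * Bd) + s * (be * Bd) + L * s); last by ring.
  by rewrite lerDl mulr_ge0.
have time_error q (qM : (q <= M)%N) i x t s : (i <= q)%N -> enorm x <= R1 -> 0 <= t <= T ->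
    0 <= s <= h -> `|t - node h q i| <= h ->
    enorm (b (x, t) + s *: (b (x, t) *m jac b (x, node h q i)) - b (x, node h q i)) <= A * h.
  move=> iq xR tT /andP[s0 sh] th; rewrite addrAC; apply: le_trans (enormD _ _) _.
  have xB : enorm x <= R1 + Bd by apply: le_trans xR _; rewrite lerDl.
  have e1 : enorm (b (x, t) - b (x, node h q i)) <= L * h.
    apply: le_trans (bL _ _ _ _ xB xB (nodeT _ _ qM iq) tT) _.
    by rewrite ler_wpM2l// subrr enorm0 ge_max (ltW h0).
  have e2 : enorm (s *: (b (x, t) *m jac b (x, node h q i))) <= h * (be * Bd).
    by rewrite enormZ ger0_norm//; apply: ler_pM; rewrite ?enorm_ge0// bJ.
  apply: le_trans (lerD e1 e2) _; rewrite /A.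
  rewrite [leRHS](_ : _ = L * h + h * (be * Bd) + L * Bd * h); last by ring.
  by rewrite lerDl !mulr_ge0// ltW.
(* The estimates hold for at most [M] nodes, and times up to [T] only call for such [p]; truncation
   makes the family total in [p]. *)
pose q p := minn p M; have qM p : (q p <= M)%N by rewrite geq_minr.
exists (fun p => euler b h (q p) psi (q p).+1), (fun p => euler_grad b h (q p) psi (q p).+1),
  (fun p => euler_dt b h (q p) psi (q p).+1); split.
- by move=> p; apply: euler_has_gradient => //; rewrite gt_eqF.
- by move=> p z; exact: supp.
- by move=> p z; exact: gradV.
move=> t /andP[t0 tT]; have [|p pM [tp pt]] := @time_step M t M0; first by rewrite t0.
have qp : q p = p by apply/minn_idPl.
have pM' := qM p; exists p; rewrite qp in pM' *; split.
  move=> x s /andP[s0 st]; apply: le_trans hA.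
  apply: (euler_transport_error h0 hC1' (growth' p pM) psi0 (R01 p pM) A0 Gam0
    (fun n z => @gwG p n z pM) (space_error p pM) (time_error p pM) (z := (x, s))).
    by rewrite /= s0 (le_trans st).
  by rewrite /= s0 (le_trans st).
move=> x; apply: le_trans hB.
apply: (@euler_close _ _ b h p psi b1 psi1 h0 C1 R0 R1 hC1' (growth' p pM) psi0 (R01 p pM)
  Gam Bd Gam0 (fun n z => @gwG p n z pM) R0R1 Bd0 _ (x, t)) => //.
by move=> i y iq yR; apply: bBd => //; exact: nodeT.
Qed.

End EulerFamily.

(** * Uniqueness *)

Section Slices.
Context {R : realType} {d : nat} (T : R).
Local Notation E := 'rV[R]_d.
Local Notation L := (lebesgueType R).
Hypothesis T0 : 0 < T.

Lemma measurable_swap_fun d' (Y : measurableType d') (f : borel (E * R)%type -> Y)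
    (A : set (L * borel E)) :
  measurable_fun setT f -> measurable_fun A (f \o swap_time).
Proof.
move=> mf; apply: measurable_funTS; apply: measurableT_comp => //.
exact: measurable_swap_time.
Qed.

Lemma measurable_slice_fun d' (Y : measurableType d') (f : borel (E * R)%type -> Y) (t : R)
    (D : set (borel E)) :
  measurable_fun setT f -> measurable_fun D (fun x : borel E => f (x, t)).
Proof.
move=> mf; apply: measurable_funTS.
have mfs : measurable_fun setT (f \o swap_time) by exact: measurable_swap_fun.
exact: (measurableT_comp mfs (@pair1_measurable _ _ L (borel E) t)).
Qed.

(** [b] is given as measurable on the strip; cutting it off by 0 yields a measurable function on the
    whole space without changing integrals over [[0, T]]. *)
Definition field_cut (b : E * R -> E) (z : E * R) : E := if 0 <= z.2 <= T then b z else 0.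

Lemma field_cutE b x t : 0 <= t <= T -> field_cut b (x, t) = b (x, t).
Proof. by rewrite /field_cut/= => ->. Qed.

Lemma measurable_field_cut (b : E * R -> E) j :
  measurable_fun (setT `*` `[0, T] : set (borel (E * R)%type))
    (b : borel (E * R)%type -> borel E) ->
  measurable_fun setT (fun z : borel (E * R)%type => field_cut b z 0 j).
Proof.
move=> mb; have mS : measurable (setT `*` `[0, T] : set (borel (E * R)%type)).
  by apply: borel_setX; [exact: measurableT|exact: measurable_itv].
have mco : measurable_fun (setT : set (borel E)) (fun y : borel E => (y : E) 0 j : R).
  by apply: continuous_borel_real; exact: coord_continuous.
have mbj : measurable_fun (setT `*` `[0, T] : set (borel (E * R)%type))
    (fun z : borel (E * R)%type => b z 0 j) := measurableT_comp mco mb.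
have SE (z : E * R) : (0 <= z.2 <= T) = (z \in (setT `*` `[0, T] : set (E * R))).
  apply/idP/idP; first by move=> zT; apply/mem_set; split => //=; rewrite in_itv.
  by move=> /set_mem[_]; rewrite /= in_itv.
have -> : (fun z : borel (E * R)%type => field_cut b z 0 j) =
    (fun z => if z \in (setT `*` `[0, T] : set (E * R)) then b z 0 j else 0).
  by apply/funext => z; rewrite /field_cut SE; case: ifP => // _; rewrite mxE.
apply: measurable_fun_if => //.
- apply: (measurable_fun_bool true); rewrite setTI.
  rewrite (_ : _ @^-1` _ = (setT `*` `[0, T])) //.
  by apply/seteqP; split=> z /=; [move=> /set_mem|move=> ?; apply/mem_set].
- by apply: (measurable_funS mS) mbj => z [_ /=]; exact: set_mem.
Qed.

Section OneFamily.
Context (mu : lbmeasure (E * R)%type) (mus : R -> lbmeasure E).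
Hypothesis mu_mus : given_by T mu mus.
Context (q : 'I_d -> R * R).
Let J : set L := `[0, T].
Let mJ : measurable J := measurable_J T.
Let coE := @coordinates_space R d.
Let D : set E := box (@co_space R d) q.
Let bD : bounded_borel D := box_bounded_borel coE q.
Let mD : measurable (D : set (borel E)) := bD.1.
Let DJ : set (E * R) := D `*` `[0, T].

Lemma measurable_tv_integral (nus : R -> lbmeasure E) (A : set E) (f : borel (E * R)%type -> \bar R) :
  lbm_family (patched T nus) -> bounded_borel A ->
  (forall z, 0 <= f z)%E -> measurable_fun setT f ->
  measurable_fun J (fun t => \int[lbm_tv (nus t)]_(x in A) f (x, t))%E.
Proof.
move=> fam bA f0 mf; have mA : measurable (A : set (borel E)) := bA.1.
have fam' := lbm_family_opp fam.
pose g (t : L) := (\int[lbm_pos (patched T nus t)]_(x in A) f (x, t) +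
    \int[lbm_pos (lbm_opp (patched T nus t))]_(x in A) f (x, t))%E.
apply: (eq_measurable_fun g).
  move=> t /set_mem Jt; rewrite /g -(patchedE nus Jt); symmetry.
  exact: (ge0_integral_measure_add (lbm_pos (patched T nus t)) (lbm_neg (patched T nus t)) mA
    (fun x _ => f0 (x, t)) (@measurable_slice_fun _ _ f t A mf)).
apply: emeasurable_funD.
- apply: (measurable_lbm_pos_integral coE bA fam mJ (f := f \o swap_time)).
    by move=> z; exact: f0.
  exact: measurable_swap_fun.
- apply: (measurable_lbm_pos_integral coE bA fam' mJ (f := f \o swap_time)).
    by move=> z; exact: f0.
  exact: measurable_swap_fun.
Qed.

Context (f : borel (E * R)%type -> R).
Hypothesis mf : measurable_fun setT f.
Hypothesis intf : (lbm_tv mu).-integrable (DJ : set (borel (E * R)%type)) (EFin \o f).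

Let mnf : measurable_fun setT (fun z => `|f z|%:E).
Proof. by apply/measurable_EFinP; apply: measurableT_comp. Qed.

Let nf0 (z : borel (E * R)%type) : (0 <= `|f z|%:E)%E.
Proof. by rewrite lee_fin. Qed.

Let fam := lbm_family_patched mu_mus.

Lemma integrable_slice_tv :
  leb.-integrable J (fun t => \int[lbm_tv (mus t)]_(x in D) `|f (x, t)|%:E)%E.
Proof.
apply/integrableP; split; first exact: (measurable_tv_integral fam bD nf0 mnf).
rewrite (eq_integral (fun t : L => \int[lbm_tv (mus t)]_(x in D) `|f (x, t)|%:E)%E); last first.
  by move=> t _; rewrite gee0_abs//; apply: integral_ge0 => x _; exact: nf0.
apply: le_lt_trans (disintegration_tv_le mu_mus T0 q nf0 mnf) _.
by have /integrableP[_] := intf.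
Qed.

Lemma ae_slice_integrable : {ae leb, forall t : L, J t ->
  (lbm_tv (mus t)).-integrable D (EFin \o (fun x => f (x, t)))}.
Proof.
have := integrable_ae mJ integrable_slice_tv; apply: filterS => t h Jt.
apply/integrableP; split.
  by apply/measurable_EFinP; exact: (@measurable_slice_fun _ _ f t D mf).
by have := h Jt; rewrite ge0_fin_numE//; apply: integral_ge0 => x _; exact: nf0.
Qed.

Lemma integrable_lbm_integral_slice :
  leb.-integrable J (EFin \o (fun t => lbm_integral (mus t) D (fun x => f (x, t)))).
Proof.
have mI : measurable_fun J (fun t : L => lbm_integral (mus t) D (fun x => f (x, t))).
  apply: (eq_measurable_fun (fun t : L => lbm_integral (patched T mus t) D (fun x => f (x, t)))).
    by move=> t /set_mem Jt; rewrite patchedE.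
  apply: (measurable_lbm_integral coE bD (f := f \o swap_time) fam mJ).
  exact: measurable_swap_fun.
apply/integrableP; split; first exact/measurable_EFinP.
have /integrableP[mtv itv] := integrable_slice_tv.
have mI' : measurable_fun J (EFin \o (fun t : L => lbm_integral (mus t) D (fun x => f (x, t)))).
  exact/measurable_EFinP.
refine (le_lt_trans _ itv).
refine (ae_ge0_le_integral mJ (fun t _ => abse_ge0 _) (measurableT_comp (@abse_measurable _ setT) mI')
  (fun t _ => abse_ge0 _) (measurableT_comp (@abse_measurable _ setT) mtv) _).
have := ae_slice_integrable; apply: filterS => t h Jt /=.
rewrite [leRHS]gee0_abs; last by apply: integral_ge0 => x _; exact: nf0.
exact: le_abs_lbm_integral mD (h Jt).
Qed.
End OneFamily.
End Slices.

Lemma ae_leb_filterS (R : realType) (P Q : lebesgueType R -> Prop) :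
  (forall t, P t -> Q t) -> {ae leb, forall t, P t} -> {ae leb, forall t, Q t}.
Proof. exact: (@filterS _ _ (ae_filter_ringOfSetsType leb) P Q). Qed.

Lemma ae_leb_filterS2 (R : realType) (P1 P2 Q : lebesgueType R -> Prop) :
  (forall t, P1 t -> P2 t -> Q t) ->
  {ae leb, forall t, P1 t} -> {ae leb, forall t, P2 t} -> {ae leb, forall t, Q t}.
Proof. exact: (@filterS2 _ _ (ae_filter_ringOfSetsType leb) P1 P2 Q). Qed.

Lemma bounded_borel_eball (R : realType) (d : nat) (c : 'rV[R]_d) (r : R) :
  0 < r -> bounded_borel (eball c r).
Proof.
move=> r0; have ce : continuous (fun x : 'rV[R]_d => enorm (x - c)).
  apply: (@continuous_enorm R d 'rV[R]_d (fun x => x - c)).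
  have dc (x : 'rV[R]_d) : differentiable (fun x : 'rV[R]_d => x - c) x by [].
  by move=> x; exact: differentiable_continuous (dc x).
have oU : open (eball c r).
  rewrite (_ : eball c r = (fun x => enorm (x - c)) @^-1` [set y | y < r])//.
  by apply: open_comp => [x _|]; [exact: ce|exact: open_lt].
split; first exact: open_borel.
exists [set x | enorm x <= r + enorm c]; first exact: compact_enorm_ball.
move=> x /ltW xr /=; have := enormD (x - c) c; rewrite subrK => /le_trans; apply.
by rewrite lerD2r.
Qed.

(** * Testing the equation for one solution *)

Section SolutionIdentity.
Context {R : realType} {d : nat} (T : R).
Local Notation E := 'rV[R]_d.
Local Notation L := (lebesgueType R).
Hypothesis T0 : 0 < T.
Context (b : E * R -> E) (nu : lbmeasure E) (w dw : E * R -> R) (gw : E * R -> E) (R1 rho : R).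
Hypothesis mb : measurable_fun (setT `*` `[0, T] : set (borel (E * R)%type))
    (b : borel (E * R)%type -> borel E).
Hypothesis hw : has_gradient w gw dw.
Hypothesis supp : forall z, R1 < enorm z.1 -> [/\ w z = 0, gw z = 0 & dw z = 0].
Hypothesis R1rho : R1 < rho.

Let q (i : 'I_d) : R * R := (0, rho).
Let J : set L := `[0, T].
Let mJ : measurable J := measurable_J T.
Let coE := @coordinates_space R d.
Let D : set E := box (@co_space R d) q.
Let bD : bounded_borel D := box_bounded_borel coE q.
Let mD : measurable (D : set (borel E)) := bD.1.
Let DJ : set (E * R) := D `*` `[0, T].

Definition transport (z : E * R) : R := dw z + dotp (field_cut T b z) (gw z).

Lemma support_in_box (x : E) : ~ D x -> R1 < enorm x.
Proof.
move=> nD; rewrite ltNge; apply/negP => xR; apply: nD => i.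
by rewrite /q/= subr0 (le_lt_trans (coord_le_enorm x i))// (le_lt_trans xR).
Qed.

Lemma measurable_transport : measurable_fun setT (transport : borel (E * R)%type -> R).
Proof.
have [cg cD _] := hw.
apply: measurable_funD; first exact: continuous_borel_real.
apply: measurable_sum => i; apply: measurable_funM; first exact: measurable_field_cut.
have ci : continuous (fun y : E => y 0 i) by exact: coord_continuous.
exact: (continuous_borel_real (continuous_compose cg ci)).
Qed.

Lemma transport_bound : exists A B : R, [/\ 0 <= A, 0 <= B &
  forall z, 0 <= z.2 <= T -> `|transport z| <= A + B * enorm (b z)].
Proof.
have [cg cD _] := hw.
have [A A0 AP] := compact_continuous_bounded (@compact_ball_time R d T R1) cD.
have [B B0 BP] := compact_continuous_bounded (@compact_ball_time R d T R1) (continuous_enorm cg).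
exists A, B; split => // z zT.
have [zR|zR] := leP (enorm z.1) R1; last first.
  rewrite /transport; have [_ -> ->] := supp zR.
  by rewrite dotp0r addr0 normr0 addr_ge0// mulr_ge0// enorm_ge0.
have Kz : ball_time T R1 z by case: z zR zT => x t; exact: ball_timeE.
rewrite /transport /field_cut zT; apply: le_trans (ler_normD _ _) _; apply: lerD; first exact: AP.
apply: le_trans (cauchy_schwarz _ _) _; rewrite mulrC ler_wpM2r ?enorm_ge0//.
exact: le_trans (ler_norm _) (BP z Kz).
Qed.

Section OneSolution.
Context (mu : lbmeasure (E * R)%type) (mus : R -> lbmeasure E).
Hypothesis sol : cauchy_solution T b nu mu mus.

Lemma bounded_borel_strip : bounded_borel DJ.
Proof.
have [mDb [K cK DK]] := bD; split.
  by apply: borel_setX; [exact: mDb|exact: measurable_itv].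
by exists (K `*` `[0, T]); [apply: compact_setX => //; exact: segment_compact|by move=> z [/DK zK zT]].
Qed.

Lemma integrable_transport :
  (lbm_tv mu).-integrable (DJ : set (borel (E * R)%type)) (EFin \o transport).
Proof.
have [A [B [A0 B0 ABP]]] := transport_bound.
have [_ _ ib _] := sol.
(* A cube of half-side [rho] lies in the Euclidean ball of radius [d |rho|]; the integrability of
   [b] is given over balls. *)
have r0 : 0 < d%:R * `|rho| + 1 :> R by rewrite ltr_wpDl// mulr_ge0.
have mDJ : measurable (DJ : set (borel (E * R)%type)) := bounded_borel_strip.1.
have DJb : DJ `<=` eball (0 : E) (d%:R * `|rho| + 1) `*` `[0, T].
  move=> z [zD zT]; split => //; rewrite /eball/= subr0.
  apply: le_lt_trans (enorm_le_norm _) _; rewrite ltr_pwDr// ler_wpM2l//.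
  apply/normr_rV_le => // i; have := zD i; rewrite /q/= subr0 => /ltW/le_trans; apply.
  exact: ler_norm.
have meb : measurable (eball (0 : E) (d%:R * `|rho| + 1) `*` `[0, T] : set (borel (E * R)%type)).
  by apply: borel_setX; [exact: (bounded_borel_eball 0 r0).1|exact: measurable_itv].
have ib' := integrableS meb mDJ DJb (ib 0 _ r0).
pose g (z : borel (E * R)%type) := (A%:E + B%:E * (enorm (b z))%:E)%E.
apply: (le_integrable mDJ (g := g)).
- by apply: measurable_funTS; apply/measurable_EFinP; exact: measurable_transport.
- move=> z [_ zT]; rewrite /g -EFinM -EFinD /= lee_fin [leRHS]ger0_norm.
    by apply: ABP; move: zT; rewrite /= in_itv.
  by rewrite addr_ge0// mulr_ge0// enorm_ge0.
apply: integrableD => //; last exact: integrableZl.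
apply/integrableP; split; first exact: measurable_cst.
rewrite integral_cst//; apply: lte_mul_pinfty => //.
exact: lbm_tv_finite bounded_borel_strip.
Qed.

(** For [t < T] all [s <= t] lie in [[0, T[], where [dt] is the derivative [dw]. Integrals over the
    whole space reduce to the bounded box [D], outside which [w] vanishes. *)
Lemma solution_identity : {ae leb, forall t : L, 0 < t < T ->
  lbm_integral (mus t) D (fun x => w (x, t)) = lbm_integral nu D (fun x => w (x, 0)) +
  \int[leb]_(s in `[0, t]) lbm_integral (mus s) D (fun x => transport (x, s))}.
Proof.
have [_ _ _ solw] := sol.
have w0 x t : 0 <= t < T -> R1 < enorm x -> w (x, t) = 0.
  by move=> _ xR; have [] := @supp (x, t) xR.
have [tw dtw] := has_gradient_cauchy_test hw w0.
apply: (ae_leb_filterS _ (solw w tw)) => t h /andP[t0 tT].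
have out (m : lbmeasure E) (f : E -> R) : (forall x, R1 < enorm x -> f x = 0) ->
    lbm_integral m setT f = lbm_integral m D f.
  move=> f0; apply: lbm_integral_support => // x _ nDx.
  by apply: f0; exact: support_in_box.
rewrite -out; last by move=> x xR; have [] := @supp (x, t) xR.
rewrite h; last by rewrite in_itv/= !ltW.
rewrite -out; last by move=> x xR; have [] := @supp (x, 0) xR.
congr (_ + _); apply: eq_Rintegral => s /set_mem.
rewrite /= in_itv/= => /andP[s0 st].
have sT : s < T := le_lt_trans st tT.
rewrite -out; last first.
  by move=> x xR; rewrite /transport; have [_ -> ->] := @supp (x, s) xR; rewrite dotp0r addr0.
congr lbm_integral; apply/funext => x; rewrite /transport field_cutE ?s0 ?(ltW sT)//.
by rewrite dtw/= ?s0// (gradx_has_gradient (x, s) hw).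
Qed.
End OneSolution.
End SolutionIdentity.

Lemma integrable_continuous_lbm (R : realType) (X : normedModType R) (mu : lbmeasure X)
    (D : set X) (g : X -> R) : bounded_borel D -> continuous g ->
  (lbm_tv mu).-integrable D (EFin \o g).
Proof.
move=> bD cg; have [mD [K cK DK]] := bD.
have [M M0 MP] := compact_continuous_bounded cK cg.
apply: (le_integrable mD (g := fun=> M%:E)).
- by apply/measurable_EFinP; exact: continuous_borel_real.
- by move=> x /DK Kx; rewrite /= lee_fin [leRHS]ger0_norm//; exact: MP.
- apply/integrableP; split; first exact: measurable_cst.
  rewrite integral_cst//; apply: lte_mul_pinfty => //.
  exact: lbm_tv_finite bD.
Qed.

(** * Difference of the two solutions *)

Section DifferenceEstimate.
Context {R : realType} {d : nat} (T : R).
Local Notation E := 'rV[R]_d.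
Local Notation L := (lebesgueType R).
Hypothesis T0 : 0 < T.
Context (b : E * R -> E) (nu : lbmeasure E) (mu1 mu2 : lbmeasure (E * R)%type)
  (mus1 mus2 : R -> lbmeasure E).
Hypothesis mb : measurable_fun (setT `*` `[0, T] : set (borel (E * R)%type))
    (b : borel (E * R)%type -> borel E).
Hypothesis sol1 : cauchy_solution T b nu mu1 mus1.
Hypothesis sol2 : cauchy_solution T b nu mu2 mus2.

Definition diff_family (t : R) : lbmeasure E := lbm_sub (mus1 t) (mus2 t).

Let J : set L := `[0, T].
Let mJ : measurable J := measurable_J T.
Let given1 : given_by T mu1 mus1. Proof. by case: sol1. Qed.
Let given2 : given_by T mu2 mus2. Proof. by case: sol2. Qed.

Lemma lbm_family_diff : lbm_family (patched T diff_family).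
Proof.
move=> B bB.
have -> : (fun t : L => patched T diff_family t B) =
    (fun t : L => patched T mus1 t B - patched T mus2 t B).
  apply/funext => t; rewrite /patched; case: ifP => // _.
  by rewrite /= !subrr.
by apply: measurable_funB; [exact: lbm_family_patched given1 _ bB|exact: lbm_family_patched given2 _ bB].
Qed.

Context (r : R).
Hypothesis r0 : 0 < r.
Let U : set E := eball 0 r.
Let bU : bounded_borel U := bounded_borel_eball 0 r0.
Let mU : measurable (U : set (borel E)) := bU.1.

Definition diff_integral (f : E * R -> \bar R) : \bar R :=
  (\int[leb]_(t in (`[0%R, T]%classic : set L)) \int[lbm_tv (diff_family t)]_(x in eball 0 r) f (x, t))%E.

Lemma diff_integral1_fin : (diff_integral (fun=> 1%E) < +oo)%E.
Proof.
have tvE (m : lbmeasure E) : (\int[lbm_tv m]_(x in U) 1 = lbm_tv m U)%E.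
  by rewrite integral_cst// mul1e.
have ip1 := integrable_patched_tv given1 bU; have ip2 := integrable_patched_tv given2 bU.
have [m1 f1] := integrableP _ _ _ ip1; have [m2 f2] := integrableP _ _ _ ip2.
have tvD (t : L) : J t ->
    (\int[lbm_tv (diff_family t)]_(x in U) 1 <= lbm_tv (patched T mus1 t) U + lbm_tv (patched T mus2 t) U)%E.
  by move=> Jt; rewrite tvE !patchedE//; exact: lbm_tv_sub_le.
have m0 : measurable_fun J (fun t : L => \int[lbm_tv (diff_family t)]_(x in U) 1)%E.
  apply: (measurable_tv_integral (f := fun=> 1%E) lbm_family_diff bU) => //.
apply: (@le_lt_trans _ _ (\int[leb]_(t in J)
  (lbm_tv (patched T mus1 t) U + lbm_tv (patched T mus2 t) U))%E).
  refine (ge0_le_integral leb mJ _ m0 _ tvD).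
    by move=> t _; apply: integral_ge0.
  exact: emeasurable_funD.
rewrite (ge0_integralD _ mJ (fun t _ => measure_ge0 _ _) m1 (fun t _ => measure_ge0 _ _) m2).
have absE (ms : L -> lbmeasure E) :
    (\int[leb]_(t in J) `|lbm_tv (ms t) U| = \int[leb]_(t in J) lbm_tv (ms t) U)%E.
  by apply: eq_integral => t _; rewrite gee0_abs// measure_ge0.
by rewrite absE in f1; rewrite absE in f2; exact: lte_add_pinfty.
Qed.

Section Test.
Context (w dw : E * R -> R) (gw : E * R -> E) (R1 : R).
Hypothesis hw : has_gradient w gw dw.
Hypothesis supp : forall z, R1 < enorm z.1 -> [/\ w z = 0, gw z = 0 & dw z = 0].
Hypothesis R1r : R1 < r.
Context (H : E * R -> R) (e C : R).
Hypothesis mH : measurable_fun setT (H : borel (E * R)%type -> R).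
Hypothesis H0 : forall z, 0 <= H z.
Hypothesis e0 : 0 <= e.
Hypothesis C0 : 0 <= C.

Let coE := @coordinates_space R d.
Let D : set E := box (@co_space R d) (fun=> (0, r)).
Let bD : bounded_borel D := box_bounded_borel coE _.
Let mD : measurable (D : set (borel E)) := bD.1.
Let F := transport T b dw gw.
Let UD : U `<=` D.
Proof.
move=> x; rewrite /U /eball/= subr0 => xr i.
by rewrite /= subr0; exact: le_lt_trans (coord_le_enorm x i) xr.
Qed.

Let bound (t : L) : \bar R :=
  (e%:E * \int[lbm_tv (diff_family t)]_(x in U) 1 +
   C%:E * \int[lbm_tv (diff_family t)]_(x in U) (H (x, t))%:E)%E.

Let mtv (f : E * R -> \bar R) : (forall z, 0 <= f z)%E ->
  measurable_fun setT (f : borel (E * R)%type -> \bar R) ->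
  measurable_fun J (fun t => \int[lbm_tv (diff_family t)]_(x in U) f (x, t))%E.
Proof. by move=> f0 mf; exact: (measurable_tv_integral lbm_family_diff bU f0 mf). Qed.

Let tv_ge0 (f : E * R -> \bar R) t : (forall z, 0 <= f z)%E ->
  (0 <= \int[lbm_tv (diff_family t)]_(x in U) f (x, t))%E.
Proof. by move=> f0; apply: integral_ge0 => x _; exact: f0. Qed.

Let one0 (z : E * R) : (0 <= 1 :> \bar R)%E. Proof. by []. Qed.
Let H0e (z : E * R) : (0 <= (H z)%:E)%E. Proof. by rewrite lee_fin. Qed.
Let mHe : measurable_fun setT ((fun z => (H z)%:E) : borel (E * R)%type -> \bar R).
Proof. exact/measurable_EFinP. Qed.

Lemma slice_bound (t : L) : (forall x, U x -> `|F (x, t)| <= e + C * H (x, t)) ->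
  (lbm_tv (mus1 t)).-integrable D (EFin \o (fun x => F (x, t))) ->
  (lbm_tv (mus2 t)).-integrable D (EFin \o (fun x => F (x, t))) ->
  (`|lbm_integral (mus1 t) D (fun x => F (x, t)) -
    lbm_integral (mus2 t) D (fun x => F (x, t))|%:E <= bound t)%E.
Proof.
move=> FH i1 i2; rewrite -(lbm_integral_sub bD i1 i2) -/(diff_family t).
have Fout x : D x -> ~ U x -> F (x, t) = 0.
  move=> _ nU; have xR : R1 < enorm x.
    by rewrite (lt_le_trans R1r)// leNgt; apply/negP => xr; apply: nU; rewrite /U /eball/= subr0.
  by rewrite /F /transport; have [_ -> ->] := @supp (x, t) xR; rewrite dotp0r addr0.
rewrite (lbm_integral_support (diff_family t) mU UD Fout).
have iD := integrable_lbm_tv_sub mD i1 i2.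
have iU : (lbm_tv (diff_family t)).-integrable U (EFin \o (fun x => F (x, t))) :=
  integrableS mD mU UD iD.
apply: le_trans (le_abs_lbm_integral mU iU) _.
have mHt : measurable_fun (U : set (borel E)) (fun x : borel E => (H (x, t))%:E).
  by apply: (measurable_slice_fun t) mHe.
have ee0 : (0 <= e%:E)%E by rewrite lee_fin.
have Ce0 : (0 <= C%:E)%E by rewrite lee_fin.
have m1 : measurable_fun (U : set (borel E)) (fun=> 1%E : \bar R) by exact: measurable_cst.
have mZ1 : measurable_fun (U : set (borel E)) (fun=> e%:E * 1%E : \bar R)%E by exact: measurable_cst.
have mZH : measurable_fun (U : set (borel E)) (fun x : borel E => C%:E * (H (x, t))%:E)%E.
  exact: measurable_funeM.
pose tv := lbm_tv (diff_family t).
have -> : bound t = (\int[tv]_(x in U) (e%:E * 1 + C%:E * (H (x, t))%:E))%E.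
  rewrite (ge0_integralD tv mU (fun x _ => mule_ge0 ee0 (one0 (x, t))) mZ1
    (fun x _ => mule_ge0 Ce0 (H0e (x, t))) mZH).
  rewrite (ge0_integralZl tv mU m1 (fun x _ => one0 (x, t)) ee0).
  by rewrite (ge0_integralZl tv mU mHt (fun x _ => H0e (x, t)) Ce0).
have nF0 x : U x -> (0 <= `|F (x, t)|%:E)%E by rewrite lee_fin.
refine (ge0_le_integral tv mU nF0 _ (emeasurable_funD mZ1 mZH) _).
  have /integrableP[/measurable_EFinP mF _] := iU.
  by apply/measurable_EFinP; apply: measurableT_comp.
by move=> x Ux; rewrite mule1 -EFinM -EFinD lee_fin; exact: FH.
Qed.

(** Subtracting the two identities cancels the initial datum. The bound on [F] is assumed under the
    almost everywhere quantifier, at each [t], because an Euler function is guaranteed to satisfy it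
    only up to the time it was chosen for. *)
Lemma ae_difference_estimate : {ae leb, forall t : L, 0 < t < T ->
  (forall x s, U x -> 0 <= s <= t -> `|F (x, s)| <= e + C * H (x, s)) ->
  (`|lbm_integral (diff_family t) U (fun x => w (x, t))|%:E <=
   e%:E * diff_integral (fun=> 1%E) + C%:E * diff_integral (fun z => (H z)%:E))%E}.
Proof.
have mF := measurable_transport mb hw.
have sl1 := integrable_transport r mb hw supp sol1.
have sl2 := integrable_transport r mb hw supp sol2.
have I1 := integrable_lbm_integral_slice T0 given1 mF sl1.
have I2 := integrable_lbm_integral_slice T0 given2 mF sl2.
have A1 := ae_slice_integrable T0 given1 mF sl1.
have A2 := ae_slice_integrable T0 given2 mF sl2.
have A12 := ae_leb_filterS2 (fun t h1 h2 => conj h1 h2) A1 A2.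
apply: (ae_leb_filterS2 _ (solution_identity hw supp R1r sol1)
  (solution_identity hw supp R1r sol2)) => t h1 h2 t0T FH.
have /andP[t0 tT] := t0T.
pose g1 (s : L) := lbm_integral (mus1 s) D (fun x => F (x, s)).
pose g2 (s : L) := lbm_integral (mus2 s) D (fun x => F (x, s)).
pose Jt : set L := `[(0 : R), (t : R)]%classic.
have mJt : measurable Jt := measurable_J t.
have JtJ : Jt `<=` J.
  by move=> s; rewrite /Jt /J/= !in_itv/= => /andP[-> st]; exact: (le_trans st (ltW tT)).
have g1i : leb.-integrable Jt (EFin \o g1) := integrableS mJ mJt JtJ I1.
have g2i : leb.-integrable Jt (EFin \o g2) := integrableS mJ mJt JtJ I2.
have cwt : continuous (fun x : E => w (x, t)).
  exact: (continuous_compose (@continuous_pair_cst _ _ t) (has_gradient_continuous hw)).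
have wint (m : lbmeasure E) := integrable_continuous_lbm m bD cwt.
have wout x : D x -> ~ U x -> w (x, t) = 0.
  move=> _ nU; have xR : R1 < enorm x.
    by rewrite (lt_le_trans R1r)// leNgt; apply/negP => xr; apply: nU; rewrite /U /eball/= subr0.
  by have [] := @supp (x, t) xR.
rewrite -(lbm_integral_support (diff_family t) mU UD wout).
rewrite (lbm_integral_sub bD (wint _) (wint _)).
have -> : lbm_integral (mus1 t) D (fun x => w (x, t)) - lbm_integral (mus2 t) D (fun x => w (x, t)) =
    \int[leb]_(s in Jt) (g1 s - g2 s).
  rewrite (RintegralB mJt g1i g2i).
  have := h1 t0T; have := h2 t0T; rewrite -/D => -> ->.
  by rewrite opprD addrACA subrr add0r.
have gi : leb.-integrable Jt (EFin \o (fun s => g1 s - g2 s)).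
  by apply: (eq_integrable mJt _ _ _ (integrableB mJt g1i g2i)) => s _.
rewrite -[(_%:E)%E]/(`|(\int[leb]_(s in Jt) (g1 s - g2 s))%:E|)%E.
rewrite /Rintegral fineK; last exact: (integrable_fin_num mJt gi).
have /integrableP[mg _] := gi.
apply: le_trans (le_abse_integral leb mJt mg) _.
have ee0 : (0 <= e%:E)%E by rewrite lee_fin.
have Ce0 : (0 <= C%:E)%E by rewrite lee_fin.
have tv1 s : (0 <= \int[lbm_tv (diff_family s)]_(x in U) 1)%E := tv_ge0 s one0.
have tvH s : (0 <= \int[lbm_tv (diff_family s)]_(x in U) (H (x, s))%:E)%E := tv_ge0 s H0e.
have bound0 s : J s -> (0 <= bound s)%E.
  by move=> _; exact: (adde_ge0 (mule_ge0 ee0 (tv1 s)) (mule_ge0 Ce0 (tvH s))).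
have m1 := mtv one0 (measurable_cst (1%E : \bar R)).
have mH1 := mtv H0e mHe.
have me1 : measurable_fun J (fun s : L => e%:E * \int[lbm_tv (diff_family s)]_(x in U) 1)%E.
  exact: measurable_funeM.
have mC1 : measurable_fun J (fun s : L => C%:E * \int[lbm_tv (diff_family s)]_(x in U) (H (x, s))%:E)%E.
  exact: measurable_funeM.
have mbound : measurable_fun J bound := emeasurable_funD me1 mC1.
apply: (@le_trans _ _ (\int[leb]_(s in Jt) bound s)%E).
  refine (ae_ge0_le_integral mJt (fun s _ => abse_ge0 _) (measurableT_comp (@abse_measurable _ setT) mg)
    (fun s h => bound0 s (JtJ s h)) (measurable_funS mJ JtJ mbound) _).
  apply: (ae_leb_filterS _ A12) => s [i1 i2] Js; have Js' := JtJ s Js.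
  apply: slice_bound (i1 Js') (i2 Js') => x Ux; exact: FH.
apply: le_trans (ge0_subset_integral leb mJt mJ mbound bound0 JtJ) _.
rewrite (ge0_integralD leb mJ (fun s _ => mule_ge0 ee0 (tv1 s)) me1 (fun s _ => mule_ge0 Ce0 (tvH s)) mC1).
rewrite (ge0_integralZl leb mJ m1 (fun s _ => tv1 s) ee0).
by rewrite (ge0_integralZl leb mJ mH1 (fun s _ => tvH s) Ce0).
Qed.
End Test.
End DifferenceEstimate.

Lemma smooth_Ck1 (R : realType) (V W : normedModType R) (f : V -> W) : smooth f -> Ck 1 f.
Proof. by move=> sf; exact: (sf 1%N). Qed.

Lemma gradient_bounded (R : realType) (d : nat) (psi : 'rV[R]_d -> R) (R0 : R) :
  Ck 1 psi -> (forall x, R0 < enorm x -> psi x = 0) ->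
  exists G : R, forall x, enorm (grad psi x) ^+ 2 <= G.
Proof.
move=> psi1 psi0.
have [G G0 GP] := compact_continuous_bounded (@compact_enorm_ball R d R0)
  (continuous_enorm (Ck1_continuous_grad psi1)).
exists (G ^+ 2) => x; have [xR|xR] := leP (enorm x) R0.
  rewrite lerXn2r ?nnegrE ?enorm_ge0//; exact: le_trans (ler_norm _) (GP x xR).
by rewrite (grad_zero_outside psi0 xR) enorm0 expr0n sqr_ge0.
Qed.

Lemma ae_leb_interior (R : realType) (T : R) : {ae leb, forall t : lebesgueType R,
  (t : R) \in `[0, T] -> 0 < (t : R) < T}.
Proof.
exists ([set 0; T] : set (lebesgueType R)); split.
- by apply: measurableU; apply: lebesgue_type_borel; exact: measurable_set1.
- have : lebesgue_measure ([set 0; T] : set R) = 0%E.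
    exact/countable_lebesgue_measure0/finite_set_countable/finite_set2.
  exact.
- move=> t /= nt; apply: contrapT => t0T; apply: nt; rewrite in_itv/= => /andP[t0 tT].
  rewrite !lt_neqAle t0 tT !andbT eq_sym.
  by apply/andP; split; apply/eqP => tE; apply: t0T; [left|right].
Qed.

Lemma ae_leb_countable (R : realType) (I : countType) (P : I -> lebesgueType R -> Prop) :
  (forall i, {ae leb, forall t, P i t}) -> {ae leb, forall t, forall i, P i t}.
Proof.
move=> h.
have : {ae leb, forall t : lebesgueType R, forall n : nat, if unpickle n is Some i then P i t else True}.
  apply: ae_foralln => n; case: (unpickle n) => [i|]; first exact: h.
  exact: (@filterE _ _ (ae_filter_ringOfSetsType leb)).
by apply: ae_leb_filterS => t ht i; have := ht (pickle i); rewrite pickleK.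
Qed.

Section Vanishing.
Context {R : realType} {d : nat} (T : R).
Local Notation E := 'rV[R]_d.
Local Notation L := (lebesgueType R).
Hypothesis d0 : (0 < d)%N.
Hypothesis T0 : 0 < T.
Context (b : E * R -> E) (nu : lbmeasure E) (mu1 mu2 : lbmeasure (E * R)%type)
  (mus1 mus2 : R -> lbmeasure E).
Hypothesis mb : measurable_fun (setT `*` `[0, T] : set (borel (E * R)%type))
    (b : borel (E * R)%type -> borel E).
Hypothesis sol1 : cauchy_solution T b nu mu1 mus1.
Hypothesis sol2 : cauchy_solution T b nu mu2 mus2.
Local Notation m := (diff_family mus1 mus2).

Definition weighted_error (b' : E * R -> E) (V : E -> R) (z : E * R) : R :=
  enorm (b' z - field_cut T b z) * Num.sqrt (V z.1).

Lemma measurable_weighted_error b' V : Ck 1 b' -> Ck 1 V ->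
  measurable_fun setT (weighted_error b' V : borel (E * R)%type -> R).
Proof.
move=> b'1 V1.
have msq : measurable_fun setT (@Num.sqrt R).
  by apply: continuous_measurable_fun; exact: sqrt_continuous.
have mdot : measurable_fun setT
    ((fun z => dotp (b' z - field_cut T b z) (b' z - field_cut T b z)) : borel (E * R)%type -> R).
  have mc i : measurable_fun setT ((fun z => (b' z - field_cut T b z) 0 i) : borel (E * R)%type -> R).
    under eq_fun do rewrite !mxE.
    apply: measurable_funB; last exact: measurable_field_cut.
    have ci : continuous (fun y : E => y 0 i) by exact: coord_continuous.
    exact: (continuous_borel_real (continuous_compose (continuous_field b'1) ci)).
  by apply: measurable_sum => i; apply: measurable_funM.
apply: measurable_funM; first exact: (measurableT_comp msq mdot).
apply: measurableT_comp msq _; apply: continuous_borel_real.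
have cV : continuous V by move=> x; exact: differentiable_continuous (V1.1 x).
exact: (continuous_compose (@continuous_fst _ _) cV).
Qed.

Section TestFunction.
Context (psi : E -> R) (R0 R1 r C1 C2 v0 G0 : R).
Hypothesis psi1 : Ck 1 psi.
Hypothesis psi0 : forall x, R0 < enorm x -> psi x = 0.
Hypothesis psiG : forall x, enorm (grad psi x) ^+ 2 <= G0.
Hypothesis R00 : 0 <= R0.
Hypothesis R1E : 1 + R1 = (1 + R0) * expR (4 * C1 * T).
Hypothesis R1r : R1 < r.
Hypothesis C10 : 0 <= C1.
Hypothesis C20 : 0 <= C2.
Hypothesis v00 : 0 < v0.
Hypothesis r0 : 0 < r.

Let U : set E := eball 0 r.
Let bU : bounded_borel U := bounded_borel_eball 0 r0.
Let mU : measurable (U : set (borel E)) := bU.1.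

Let Cst := expR (2 * (C2 + 1) * T) * (G0 / v0).

Lemma ae_test_estimate (b' : E * R -> E) (V : E -> R) (e : R) : 0 < e ->
  Ck 1 b' -> Ck 1 V -> (forall x, 0 < V x) ->
  (forall x t, 0 <= t <= T -> enorm (b' (x, t)) <= C1 + C1 * enorm x) ->
  (forall x, enorm x < r -> v0 <= V x) ->
  (forall x t, enorm x < r -> 0 <= t <= T ->
    dotp (b' (x, t)) (grad V x) <= (C2 - 2 * max_quad (jac b' (x, t))) * V x) ->
  {ae leb, forall t : L, 0 < t < T -> (`|lbm_integral (m t) U psi|%:E <=
     e%:E * (diff_integral T mus1 mus2 r (fun=> 1) + lbm_tv (m t) U) +
     (Num.sqrt Cst)%:E * diff_integral T mus1 mus2 r (fun z => (weighted_error b' V z)%:E))%E}.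
Proof.
move=> e0 b'1 V1 V0 growth v0V drift.
have [w [gw [dw [hw supp gwV close]]]] :=
  euler_family T0 d0 C10 C20 v00 R00 R1E R1r e0 b'1 V1 V0 psi1 psi0 psiG growth v0V drift.
pose H := weighted_error b' V.
have H0 z : 0 <= H z by rewrite mulr_ge0 ?enorm_ge0 ?sqrtr_ge0.
have mH := measurable_weighted_error b'1 V1.
have G00 : 0 <= G0 := le_trans (sqr_ge0 _) (psiG 0).
have Cst0 : 0 <= Cst by rewrite mulr_ge0 ?expR_ge0// divr_ge0// ltW.
have est p := ae_difference_estimate T0 mb sol1 sol2 r0 (hw p) (supp p) R1r mH H0 (ltW e0)
  (sqrtr_ge0 Cst).
(* The null sets of all [p] are discarded together, so that [p] may afterwards be chosen depending
   on [t]. *)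
apply: (ae_leb_filterS _ (ae_foralln est)) => t {}est t0T.
have /andP[t0 tT] := t0T.
have [|p [pb pc]] := close t; first by rewrite t0 ltW.
have tr x s : U x -> 0 <= s <= t ->
    `|transport T b (dw p) (gw p) (x, s)| <= e + Num.sqrt Cst * H (x, s).
  move=> Ux st; have sT : 0 <= s <= T by case/andP: st => -> /le_trans -> //; exact: ltW.
  rewrite /transport.
  (* The Euler function nearly solves the transport equation of [b']; the difference [b' - b] is
     paired with its gradient. *)
  have -> : dw p (x, s) + dotp (field_cut T b (x, s)) (gw p (x, s)) =
      (dw p (x, s) + dotp (b' (x, s)) (gw p (x, s))) -
      dotp (b' (x, s) - field_cut T b (x, s)) (gw p (x, s)).
    by rewrite dotpDl dotpNl; ring.
  apply: le_trans (ler_normB _ _) _; apply: lerD; first exact: pb.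
  apply: le_trans (cauchy_schwarz _ _) _; rewrite /H /weighted_error mulrCA ler_wpM2l ?enorm_ge0//.
  (* Here the bound [|grad w|^2 <= Cst V] meets the weight [sqrt V] of (iii). *)
  rewrite -sqrtrM// -[leLHS]ger0_norm ?enorm_ge0// -sqrtr_sqr.
  by apply: ler_wsqrtr; exact: (gwV p (x, s)).
have {}est := est p t0T tr.
pose tv := lbm_tv (m t).
have cpsi : continuous psi by move=> x; exact: differentiable_continuous (psi1.1 x).
have cw : continuous (fun x => w p (x, t)).
  exact: (continuous_compose (@continuous_pair_cst _ _ t) (has_gradient_continuous (hw p))).
have cdiff : continuous (fun x => psi x - w p (x, t)).
  exact: (fun x => cvgB (cpsi x) (cw x)).
have idiff := integrable_continuous_lbm (m t) bU cdiff.
(* [w p] only approximates [psi] at time [t]; the remainder, at most [e], is paid with the variation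
   of the slice on [U]. *)
have -> : psi = (fun x => w p (x, t)) \+ (fun x => psi x - w p (x, t)).
  by apply/funext => x /=; rewrite addrC subrK.
rewrite (lbm_integralD mU (integrable_continuous_lbm (m t) bU cw) idiff).
have h2 : (`|lbm_integral (m t) U (fun x => psi x - w p (x, t))|%:E <= e%:E * tv U)%E.
  apply: le_trans (le_abs_lbm_integral mU idiff) _.
  rewrite -(integral_cst tv mU).
  refine (ge0_le_integral tv mU _ _ (measurable_cst _) _).
  - by move=> x _; rewrite lee_fin.
  - apply/measurable_EFinP; apply: measurableT_comp => //.
    by have /integrableP[/measurable_EFinP] := idiff.
  - by move=> x _; rewrite lee_fin distrC; exact: pc.
have e0e : (0 <= e%:E)%E by rewrite lee_fin ltW.
have N0 : (0 <= diff_integral T mus1 mus2 r (fun=> 1%E))%E.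
  by apply: integral_ge0 => s _; apply: integral_ge0.
rewrite (ge0_muleDr _ N0 (measure_ge0 _ _)) addeAC.
apply: le_trans (leeD est h2); rewrite -EFinD lee_fin.
exact: ler_normD.
Qed.
End TestFunction.
End Vanishing.

(** [N] and [S] depend neither on [k] nor on [n], so each of the two terms can be brought down to
    [del / 2]. *)
Lemma le_vanishing (R : realType) (x N S : R) (a : nat -> \bar R) :
  0 <= N -> 0 <= S -> (a k @[k --> \oo] --> 0)%E ->
  (forall k n, x%:E <= n.+1%:R^-1%:E * N%:E + S%:E * a k)%E -> x <= 0.
Proof.
move=> N0 S0 a0 h.
have [afin acvg] := (fine_cvgP a 0).1 a0.
apply/ler_addgt0Pr => del del0; rewrite add0r.
have N1 : 0 < N + 1 by rewrite ltr_wpDl.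
have S1 : 0 < S + 1 by rewrite ltr_wpDl.
have d2 : 0 < del / 2 by rewrite divr_gt0.
have [n] := ltr_add_invr (y := 0) (x := del / 2 / (N + 1)) (divr_gt0 d2 N1).
rewrite add0r ltr_pdivlMr// => nP.
have [k [kfin ka]] : exists k, a k \is a fin_num /\ fine (a k) < del / 2 / (S + 1).
  have near_a : \forall k \near \oo, (fine \o a) k < del / 2 / (S + 1).
    by apply: (cvgr_lt _ acvg); rewrite divr_gt0.
  near \oo => k; exists k; split; first by near: k.
  by near: k; exact: near_a.
have := h k n; rewrite -(fineK kfin) -!EFinM -EFinD lee_fin.
move: ka; rewrite ltr_pdivlMr//; move: (fine (a k)) => f fP hx.
have f1 : S * f <= del / 2.
  have [f0|/ltW f0] := leP 0 f; first by move: fP; rewrite mulrDr mulr1 (mulrC f); lra.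
  by apply: (@le_trans _ _ 0); [exact: mulr_ge0_le0|exact: ltW].
have n0 : (0 : R) <= n.+1%:R^-1 by rewrite invr_ge0.
move: (n.+1%:R^-1) n0 nP hx => y y0 nP hx.
by move: nP; rewrite mulrDr mulr1; lra.
Unshelve. all: by end_near. Qed.

(** * Equality of the slices *)

Section Uniqueness.
Context {R : realType} {d : nat} (T : R).
Local Notation E := 'rV[R]_d.
Local Notation L := (lebesgueType R).
Hypothesis d0 : (0 < d)%N.
Hypothesis T0 : 0 < T.
Context (b : E * R -> E) (nu : lbmeasure E) (mu1 mu2 : lbmeasure (E * R)%type)
  (mus1 mus2 : R -> lbmeasure E).
Hypothesis mb : measurable_fun (setT `*` `[0, T] : set (borel (E * R)%type))
    (b : borel (E * R)%type -> borel E).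
Hypothesis sol1 : cauchy_solution T b nu mu1 mus1.
Hypothesis sol2 : cauchy_solution T b nu mu2 mus2.
Local Notation m := (diff_family mus1 mus2).
Context (C1 : R).
Hypothesis C10 : 0 <= C1.
Hypothesis approx : forall (r : R), 0 < r ->
    let U := eball (0 : E) r in
    exists (C2 : R) (bk : nat -> E * R -> E) (V : nat -> E -> R),
      [/\ 0 <= C2,
          forall k, smooth (bk k) &
          forall k, Ck 1 (V k) /\ forall x, 0 < V k x] /\
      [/\ forall k x t, t \in `[0, T] ->
            enorm (bk k (x, t)) <= C1 + C1 * enorm x,
          0 < inf (range (fun k => inf [set V k x | x in U])),
          forall k x t, U x -> t \in `[0, T] ->
            dotp (bk k (x, t)) (grad (V k) x) <=
            (C2 - 2 * max_quad ('J (fun y => bk k (y, t)) x)) * V k x &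
          (fun k => \int[leb]_(t in `[0%R, T])
             \int[lbm_tv (m t)]_(x in U)
               (enorm (bk k (x, t) - b (x, t)) * Num.sqrt (V k x))%:E)%E
            @ \oo --> 0%E].

Lemma ae_test_vanishes (psi : E -> R) (R0 : R) : Ck 1 psi -> 0 <= R0 ->
  (forall x, R0 < enorm x -> psi x = 0) ->
  {ae leb, forall t : L, 0 < t < T -> lbm_integral (m t) setT psi = 0}.
Proof.
move=> psi1 R00 psi0; have [G0 psiG] := gradient_bounded psi1 psi0.
(* The ball must contain the supports after all steps. Their radius depends on [C1], [R0] and [T]
   only, and [C1] is the same for all balls, so [r] can be fixed before [C2], [bk] and [V] are
   obtained. *)
pose r := (1 + R0) * expR (4 * C1 * T); pose R1 := r - 1.
have r0 : 0 < r by rewrite mulr_gt0 ?expR_gt0// ltr_wpDr.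
have R1E : 1 + R1 = (1 + R0) * expR (4 * C1 * T) by rewrite /R1 addrC subrK.
have R1r : R1 < r by rewrite ltrBlDr ltrDl.
have R0r : R0 < r.
  apply: (@lt_le_trans _ _ (1 + R0)); first by rewrite ltrDr.
  rewrite ler_peMr ?addr_ge0// -[leLHS]expR0 ler_expR.
  by rewrite !mulr_ge0// ltW.
have [C2 [bk [V [[C20 sb V1] [growth v0inf drift err]]]]] := approx r0.
set v0 := inf _ in v0inf.
have UE x : eball (0 : E) r x = (enorm x < r) by rewrite /eball/= subr0.
(* [inf] is a lower bound only for sets bounded below, which the positivity of [V k] provides at
   both levels. *)
have lbV k : lbound [set V k x | x in eball (0 : E) r] 0.
  by move=> _ [x _ <-]; exact: ltW ((V1 k).2 x).
have lbR : has_lbound (range (fun k => inf [set V k x | x in eball (0 : E) r])).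
  exists 0 => _ [k _ <-]; apply: lb_le_inf; last exact: lbV.
  by exists (V k 0), 0 => //; rewrite UE enorm0.
have v0V k x : enorm x < r -> v0 <= V k x.
  move=> xr; apply: le_trans (ge_inf lbR (ex_intro2 _ _ k I erefl)) _.
  by apply: ge_inf; [exists 0; exact: lbV|exists x => //; rewrite UE].
have inv0 n : (0 : R) < n.+1%:R^-1 by rewrite invr_gt0.
have growth' k x t : 0 <= t <= T -> enorm (bk k (x, t)) <= C1 + C1 * enorm x.
  by move=> tT; apply: growth; rewrite in_itv.
have drift' k x t : enorm x < r -> 0 <= t <= T ->
    dotp (bk k (x, t)) (grad (V k) x) <= (C2 - 2 * max_quad (jac (bk k) (x, t))) * V k x.
  by move=> xr tT; apply: drift; rewrite ?UE ?in_itv.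
have est k n := ae_test_estimate d0 T0 mb sol1 sol2 psi1 psi0 psiG R00 R1E R1r C10 C20
  v0inf r0 (inv0 n) (smooth_Ck1 (sb k)) (V1 k).1 (V1 k).2 (growth' k) (v0V k) (drift' k).
pose U : set E := eball 0 r.
have bU : bounded_borel U := bounded_borel_eball 0 r0.
pose S := Num.sqrt (expR (2 * (C2 + 1) * T) * (G0 / v0)).
pose N := diff_integral T mus1 mus2 r (fun=> 1%E).
have N0 : (0 <= N)%E by apply: integral_ge0 => s _; apply: integral_ge0.
have Nfin : N \is a fin_num by rewrite ge0_fin_numE// (diff_integral1_fin sol1 sol2 r0).
pose a k := diff_integral T mus1 mus2 r (fun z => (weighted_error T b (bk k) (V k) z)%:E).
have acvg : (a k @[k --> \oo] --> 0)%E.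
  (* On [[0, T]] the cut field is [b], so [a] is the sequence of (iii). *)
  have -> : a = (fun k => \int[leb]_(t in `[0%R, T])
      \int[lbm_tv (m t)]_(x in eball (0 : E) r)
        (enorm (bk k (x, t) - b (x, t)) * Num.sqrt (V k x))%:E)%E.
    apply/funext => k; apply: eq_integral => t /set_mem; rewrite /= in_itv/= => tT.
    by apply: eq_integral => x _; rewrite /weighted_error field_cutE.
  exact: err.
have {}est := ae_leb_countable (fun kn : nat * nat => est kn.1 kn.2).
apply: (ae_leb_filterS _ est) => t {}est t0T.
have psiU x : setT x -> ~ U x -> psi x = 0.
  move=> _ nU; apply: psi0; apply: lt_le_trans R0r _; rewrite leNgt; apply/negP => xr.
  by apply: nU; rewrite /U UE.
rewrite (lbm_integral_support (m t) bU.1 (@subsetT _ U) psiU).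
apply/eqP; rewrite -normr_le0.
have tvfin : lbm_tv (m t) U \is a fin_num.
  by rewrite ge0_fin_numE ?measure_ge0// lbm_tv_finite.
apply: (@le_vanishing _ _ (fine (N + lbm_tv (m t) U)%E) S a) => //.
- by apply: fine_ge0; apply: adde_ge0; rewrite ?measure_ge0.
- exact: sqrtr_ge0.
- move=> k n; rewrite fineK; first exact: (est (k, n) t0T).
  by rewrite fin_numD Nfin.
Qed.

(** Bumps with rational parameters on cubes of integer half-side form a countable family, so one
    null set of times serves all of them. For the other [t] the positive and negative parts of the
    difference agree inside each cube, hence the slices coincide on bounded Borel sets. *)
Lemma ae_slices_eq : {ae leb, forall t : L, t \in `[0, T] ->
  forall B : set E, bounded_borel B -> mus1 t B = mus2 t B}.
Proof.
have coE := @coordinates_space R d.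
pose p0 n (i : 'I_d) : R * R := (0, n%:R).
pose psi n k (l : seq {ffun 'I_d -> rat * rat}) := bumps (@co_space R d) k (p0 n :: map rat_param l).
have psi1 n k l : Ck 1 (psi n k l).
  exact: (smooth_Ck1 (flat_algebra_smooth (flat_algebra_bumps coE k (p0 n :: map rat_param l)))).
have psi_out n k l x : ~ box (@co_space R d) (p0 n) x -> psi n k l x = 0.
  by move=> nb; apply: bumps_support => //; rewrite boxes_cons => -[].
have psi0 n k l x : d%:R * n%:R < enorm x -> psi n k l x = 0.
  move=> nx; apply: psi_out => xb; move: nx; apply/negP; rewrite -leNgt.
  apply: le_trans (enorm_le_norm _) _; rewrite ler_wpM2l//.
  by apply/normr_rV_le => // i; have := xb i; rewrite /p0/= subr0 => /ltW.
have van := ae_leb_countable (fun nkl : (nat * nat) * seq {ffun 'I_d -> rat * rat} =>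
  ae_test_vanishes (psi1 nkl.1.1 nkl.1.2 nkl.2) (mulr_ge0 (ler0n _ _) (ler0n _ _))
    (@psi0 nkl.1.1 nkl.1.2 nkl.2)).
apply: (ae_leb_filterS2 _ van (@ae_leb_interior R T)) => t {}van t0T tT B bB.
have {}van n k l := van ((n, k), l) (t0T tT); rewrite /= in van.
have [n Bn] : exists n, B `<=` box (@co_space R d) (p0 n).
  have [_ [K cK BK]] := bB.
  have [M M0 MP] := compact_continuous_bounded cK (@norm_continuous R E).
  exists (Num.truncn M).+1 => x /BK Kx i; rewrite /p0/= subr0.
  apply: le_lt_trans (truncnS_gt M); have := MP x Kx; rewrite normr_id.
  by apply: le_trans; exact: ((normr_rV_le x (normr_ge0 x)).1 (lexx _)).
pose D : set E := box (@co_space R d) (p0 n).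
have bD : bounded_borel D := box_bounded_borel coE (p0 n).
have mD : measurable (D : set (borel E)) := bD.1.
have posD := lbm_pos_finite (m t) bD; have negD := lbm_neg_finite (m t) bD.
suff eqB : lbm_pos (m t) B = lbm_neg (m t) B.
  apply/eqP; rewrite -subr_eq0; apply/eqP.
  by have := lbm_jordan_fine (m t) bB; rewrite /= eqB subrr.
apply: (bumps_measure_unique coE (m1 := lbm_pos (m t)) (m2 := lbm_neg (m t)) (p := p0 n)) => //.
- by rewrite -ge0_fin_numE// lbm_pos_ge0.
- by rewrite -ge0_fin_numE// lbm_pos_ge0.
- move=> k l.
  have h := van n k l.
  have out x : setT x -> ~ D x -> psi n k l x = 0 by move=> _; exact: psi_out.
  rewrite (lbm_integral_support (m t) mD (@subsetT _ D) out) in h.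
  have cpsi : continuous (psi n k l) by move=> x; exact: differentiable_continuous ((psi1 n k l).1 x).
  have := integrable_continuous_lbm (m t) bD cpsi.
  move=> /(lbm_tv_integrableP (m t) _ mD)[ip ineg].
  have pf := integrable_fin_num mD ip; have nf := integrable_fin_num mD ineg.
  rewrite -(fineK pf) -(fineK nf); congr (_%:E).
  by apply/eqP; rewrite -subr_eq0; apply/eqP; exact: h.
- exact: bB.1.
Qed.
End Uniqueness.

Theorem theorem1p1 (R : realType) (d : nat) (T : R)
    (b : 'rV[R]_d * R -> 'rV[R]_d) (nu : lbmeasure 'rV[R]_d)
    (mu1 mu2 : lbmeasure ('rV[R]_d * R)%type)
    (mu1_ mu2_ : R -> lbmeasure 'rV[R]_d) :
  (0 < d)%N -> 0 < T ->
  measurable_fun (setT `*` `[0, T] : set (borel ('rV[R]_d * R)%type))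
    (b : borel ('rV[R]_d * R)%type -> borel 'rV[R]_d) ->
  cauchy_solution T b nu mu1 mu1_ ->
  cauchy_solution T b nu mu2 mu2_ ->
  let mu_ t := lbm_sub (mu1_ t) (mu2_ t) in
  (exists2 C1 : R, 0 <= C1 &
    forall (c : 'rV[R]_d) (r : R), 0 < r ->
    let U := eball c r in
    exists (C2 : R) (bk : nat -> 'rV[R]_d * R -> 'rV[R]_d)
      (V : nat -> 'rV[R]_d -> R),
      [/\ 0 <= C2,
          forall k, smooth (bk k) &
          forall k, Ck 1 (V k) /\ forall x, 0 < V k x] /\
      [/\ forall k x t, t \in `[0, T] ->
            enorm (bk k (x, t)) <= C1 + C1 * enorm x,
          0 < inf (range (fun k => inf [set V k x | x in U])),
          forall k x t, U x -> t \in `[0, T] ->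
            dotp (bk k (x, t)) (grad (V k) x) <=
            (C2 - 2 * max_quad ('J (fun y => bk k (y, t)) x)) * V k x &
          (fun k => \int[leb]_(t in `[0%R, T])
             \int[lbm_tv (mu_ t)]_(x in U)
               (enorm (bk k (x, t) - b (x, t)) * Num.sqrt (V k x))%:E)%E
            @ \oo --> 0%E]) ->
  {ae leb, forall t, t \in `[0, T] ->
    forall B, bounded_borel B -> mu1_ t B = mu2_ t B}.
Proof.
move=> d0 T0 mb sol1 sol2 mu_ [C1 C10 approx].
exact: (ae_slices_eq d0 T0 mb sol1 sol2 C10 (fun r r0 => approx 0 r r0)).
Qed.
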